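(* Let $(X_i)_{i\in\mathbb N}$ be a square integrable martingale difference sequence. Suppose that the series $\sum_{i=0}^{+\infty}\sigma_i^2$ diverges a.s. and that there exists a nondecreasing sequence of random variables $(Y_i)_{i\in\mathbb N}$ adapted to the filtration $(\mathcal F_i,\ i\in\mathbb N)$ such that, for all $i\in\mathbb N^*$, $$\mathbb E(Y_i^4)<+\infty,\qquad 1\le Y_i\qquad\text{and}\qquad \mathbb E(|X_i|^3\,|\,\mathcal F_{i-1})\le Y_{i-1}\,\sigma_{i-1}^2\quad\text{a.s.}$$ Put $a_n=(\mathbb E\, Y_{\nu(n)}^4)^{1/2}$. Then for all $n$ sufficiently large $$\sup_{x\in\mathbb R}\bigl|F_n(x)-\phi(x)\bigr|\le \frac{a_n^{1/2}}{\pi n^{1/4}}\Bigl(11+\frac{3}{4n^{1/4}}+\frac{2}{9n^{1/2}}+\frac{1}{8n^{3/4}}\Bigr)$$ and $$\sup_{x\in\mathbb R}\bigl|H_n(x)-\phi(x)\bigr|\le \frac{a_n^{1/2}}{\pi n^{1/4}}\Bigl(11+\frac{9}{4n^{1/4}}+\frac{2}{9n^{1/2}}+\frac{1}{8n^{3/4}}\Bigr).$$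
   Context: $\mathbb N=\{0,1,2,\dots\}$, $\mathbb N^*=\{1,2,\dots\}$. Let $(X_i)_{i\in\mathbb N}$ be real random variables on a probability space $(\Omega,\mathcal F,\mathbb P)$, and let $\mathcal F_k$ be the $\sigma$-algebra generated by $X_i$, $i\le k$. The sequence is a martingale difference sequence if for every $k\ge 0$, $\mathbb E|X_k|<+\infty$ and $\mathbb E\{X_{k+1}|\mathcal F_k\}=0$; square integrable means $\mathbb E X_k^2<\infty$ for all $k$. Notation, for integers $n\ge1$ and real $x$: $S_0=0$, $S_n=\sum_{i=1}^n X_i$; $\phi(x)=\frac1{\sqrt{2\pi}}\int_{-\infty}^x e^{-t^2/2}\,dt$; $\sigma_{n-1}^2=\mathbb E\{X_n^2|\mathcal F_{n-1}\}$ (so $\sigma_k^2=\mathbb E\{X_{k+1}^2|\mathcal F_k\}$ for $k\ge0$); $\nu(n)=\inf\{k\in\mathbb N^*:\sum_{i=0}^k\sigma_i^2\ge n\}$ (a.s. finite when $\sum_i\sigma_i^2$ diverges a.s.). $S_{\nu(n)}$, $\sigma^2_{\nu(n)}$, $X_{\nu(n)+1}$, $Y_{\nu(n)}$ denote the random variables equal to $S_k$, $\sigma_k^2$, $X_{k+1}$, $Y_k$ on the event $\{\nu(n)=k\}$. $\gamma(n)$ is a nonnegative random variable such that $\sum_{i=0}^{\nu(n)-1}\sigma_i^2+\gamma(n)\,\sigma_{\nu(n)}^2=n$ a.s.; the existence of such $\gamma(n)$ for the (sufficiently large) $n$ considered is a standing assumption. $S'_{\nu(n)}=S_{\nu(n)}+\sqrt{\gamma(n)}\,X_{\nu(n)+1}$,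 $F_n(x)=\mathbb P(S_{\nu(n)}\le x\sqrt n)$, $H_n(x)=\mathbb P(S'_{\nu(n)}\le x\sqrt n)$. *)

(* Defs.v *)
From HB Require Import structures.
From mathcomp Require Import all_boot all_order all_algebra.
From mathcomp Require Import all_classical all_reals all_analysis.
From mathcomp Require Import measurable_realfun.

Set Implicit Arguments.
Unset Strict Implicit.
Unset Printing Implicit Defensive.

Import Order.TTheory GRing.Theory Num.Theory.
Import numFieldNormedType.Exports.
Local Open Scope classical_set_scope.
Local Open Scope ring_scope.

Section conditional_expectation.
Context {d : measure_display} {T : measurableType d} {R : realType}.
Variable P : probability T R.

Definition measurable_wrt {d'} {U : measurableType d'} (G : set (set T))
    (Z : T -> U) : Prop :=
  preimage_set_system setT Z measurable `<=` G.

(* [Z] is a version of the conditional expectation of [X] given the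
   sub-sigma-algebra [G].  To be used when [X] is integrable (the case [A = T]
   then forces [Z] to be integrable) or when [X] is nonnegative; in the latter
   case no integrability is needed and [Z] may take the value [+oo]. *)
Definition is_cond_exp (G : set (set T)) (X Z : T -> \bar R) : Prop :=
  measurable_wrt G Z /\
  forall A, G A -> (\int[P]_(t in A) Z t = \int[P]_(t in A) X t)%E.

Definition natural_filtration (X : nat -> T -> R) (k : nat) : set (set T) :=
  <<s \bigcup_(i in [set i | (i <= k)%N])
        preimage_set_system setT (X i) measurable >>.

Definition martingale_difference (X : nat -> {RV P >-> R}) : Prop :=
  forall k, P.-integrable setT (EFin \o X k) /\
    is_cond_exp (natural_filtration X k) (EFin \o X k.+1) (cst 0%E).

Definition square_integrable (X : nat -> {RV P >-> R}) : Prop :=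
  forall k, ('E_P[fun t => (X k t ^+ 2)%R] < +oo)%E.

(* [sigmasq k] is a version of the conditional expectation of [X_(k+1) ^ 2]
   given [X_0, ..., X_k]. *)
Definition conditional_variances (X : nat -> {RV P >-> R})
    (sigmasq : nat -> T -> R) : Prop :=
  forall k, is_cond_exp (natural_filtration X k)
    (fun t => (X k.+1 t ^+ 2)%:E) (EFin \o sigmasq k).

End conditional_expectation.

Section stopped_sums.
Context {d : measure_display} {T : measurableType d} {R : realType}.
Variable P : probability T R.
Implicit Types (X : nat -> {RV P >-> R}) (sigmasq gamma : nat -> T -> R).

(* The index 0 is never allowed, although [sigmasq 0] enters the sum.  On the
   event (negligible when the series diverges a.s.) where no index qualifies,
   the value is 0 by convention. *)
Definition nu sigmasq (n : nat) (t : T) : nat :=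
  xget 0%N [set k | [/\ (0 < k)%N, n%:R <= \sum_(0 <= i < k.+1) sigmasq i t
    & forall j, (0 < j)%N -> n%:R <= \sum_(0 <= i < j.+1) sigmasq i t ->
        (k <= j)%N]].

(* The sum starts at [X_1]; [X_0] only contributes to the filtration. *)
Definition Spart X (n : nat) (t : T) : R := \sum_(1 <= i < n.+1) X i t.

Definition Sprime X sigmasq gamma (n : nat) (t : T) : R :=
  Spart X (nu sigmasq n t) t
  + Num.sqrt (gamma n t) * X (nu sigmasq n t).+1 t.

Definition Fdist X sigmasq (n : nat) (x : R) : R :=
  fine (P [set t | Spart X (nu sigmasq n t) t <= x * Num.sqrt n%:R]).

Definition Hdist X sigmasq gamma (n : nat) (x : R) : R :=
  fine (P [set t | Sprime X sigmasq gamma n t <= x * Num.sqrt n%:R]).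

(* Kept in the extended reals, since the fourth moment of [Y] at the unbounded
   time [nu n] may be infinite. *)
Definition a_ (Y : nat -> T -> R) sigmasq (n : nat) : \bar R :=
  ('E_P[fun t => (Y (nu sigmasq n t) t ^+ 4)%R] `^ (1 / 2))%E.

End stopped_sums.

Definition phi {R : realType} (x : R) : R :=
  (Num.sqrt (2 * pi))^-1 *
  (\int[lebesgue_measure]_(t in `]-oo, x]) expR (- t ^+ 2 / 2))%R.

Definition sup_dist {R : realType} (f g : R -> R) : \bar R :=
  ereal_sup (range (fun x => `|f x - g x|%:E)).

(* Main.v *)
Require Import Defs.
From HB Require Import structures.
From mathcomp Require Import all_boot all_order all_algebra.
From mathcomp Require Import all_classical all_reals all_analysis.
From mathcomp Require Import measurable_realfun.
From mathcomp Require Import ring lra.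

(** The theorem is proved by Lindeberg's replacement method along the Gaussian
    heat flow, without characteristic functions.

    Fix a level [L > 0] and a point [z], and let
    [u x v = phi ((z - x) / sqrt v)], the probability that [x] plus an
    independent centred normal variable of variance [v] is at most [z].  This
    function solves the heat equation [u_v = u_xx / 2].  Let [V k] be the sum of
    the first [k] conditional variances.  The process [u (S k) (n + L - V k)],
    followed up to the crossing time [nu n], is almost a martingale: in the
    Taylor expansion of one step the first order term vanishes because the
    increments are martingale differences, and the second order term cancels
    against the variation in [v].  What remains is the third order term,
    controlled by the conditional third moments, and the second order term in
    time ([step_le]).  The derivatives of [u] decay like [v ^ (-3/2)] and
    [v ^ (-2)], and the variable [v] decreases by exactly the conditional variance
    at each step, so the errors add up to right-endpoint Riemann sums
    ([sum_inv_cube], [sum_inv_square]).  The mesh of these sums is at most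
    [Y_nu ^ 2], because a conditional form of Young's inequality turns the
    hypothesis on third moments into [sigmasq k <= Y k ^ 2]
    ([cond_variance_le]).  With [r = Y_nu / sqrt L] the total error has mean at
    most that of a polynomial of degree four in [r] ([stopped_le]): this is where
    the fourth moment of [Y_nu] is needed.  At the end [V (nu n)] misses the level
    [n] by at most [Y_nu ^ 2], which costs one more term in [r ^ 2]; for the second
    statement the missing variance is supplied by the fraction
    [sqrt gamma * X_(nu + 1)] of one more increment, and the cost is of the same
    order ([stopped'_le]).

    So the law of [S_nu / sqrt n], convolved with a centred normal law of standard
    deviation [e = sqrt (L / n)], is close to the normal law.  The convolution is
    removed by a smoothing inequality ([smoothing]): a monotone function
    cannot deviate from a Lipschitz one at a point without deviating on an interval
    next to it, which a Gaussian average detects.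

    Write [b = (E Y_nu ^ 4) ^ (1/4)], so that [b] is the square root of [a_n], and
    [q = n ^ (1/4)].  The choice [L = q ^ 2 b ^ 2] makes [e = b / q] and all the
    errors of the order of [b / q].  The sum of the constants is below [11 / pi],
    the leading constant of both bounds, as long as [b / q < pi / 11]; otherwise
    the bounds exceed 1 and there is nothing to prove, and this is also the case
    when the fourth moment is infinite. *)

Set Implicit Arguments.
Unset Strict Implicit.
Unset Printing Implicit Defensive.

Import Order.TTheory GRing.Theory Num.Theory.
Import numFieldNormedType.Exports.
Local Open Scope classical_set_scope.
Local Open Scope ring_scope.

(** * Taylor's inequality and the Gaussian distribution function *)

Section scalar_derivatives.
Context {R : realType}.
Implicit Types (f g : R -> R) (x a b c : R).

(** A plain proposition, unlike the class [is_derive]: as a premise it does not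
    trigger a search for the derivative of an unknown function. *)
Definition has_deriv f x a : Prop := is_derive x 1 f a.

Lemma is_derive1_eq f x a b : is_derive x 1 f a -> a = b -> is_derive x 1 f b.
Proof. by move=> D <-. Qed.

Lemma is_derive1_id x : is_derive x 1 (fun t : R => t) (1 : R).
Proof. exact: is_derive_id. Qed.

Lemma is_derive1_cst c x : is_derive x 1 (fun=> c : R) (0 : R).
Proof. exact: is_derive_cst. Qed.

Lemma is_derive1D f g x a b : is_derive x 1 f a -> is_derive x 1 g b ->
  is_derive x 1 (fun t => f t + g t) (a + b).
Proof. by move=> Df Dg; exact: is_deriveD. Qed.

Lemma is_derive1B f g x a b : is_derive x 1 f a -> is_derive x 1 g b ->
  is_derive x 1 (fun t => f t - g t) (a - b).
Proof. by move=> Df Dg; exact: is_deriveB. Qed.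

Lemma is_derive1M f g x a b : is_derive x 1 f a -> is_derive x 1 g b ->
  is_derive x 1 (fun t => f t * g t) (f x * b + g x * a).
Proof. by move=> Df Dg; exact: is_deriveM. Qed.

Lemma is_derive1Z c f x a : is_derive x 1 f a ->
  is_derive x 1 (fun t => c * f t) (c * a).
Proof. by move=> Df; exact: is_deriveZ. Qed.

Lemma is_derive1V f x a : f x != 0 -> is_derive x 1 f a ->
  is_derive x 1 (fun t => (f t)^-1) (- (f x) ^- 2 * a).
Proof.
move=> fx0 Df; apply: DeriveDef; first exact: derivableV.
by have [_ <-] := Df; rewrite deriveV.
Qed.

Lemma is_derive1_sqr x : is_derive x 1 (fun t : R => t ^+ 2) (2 * x).
Proof.
have -> : (fun t : R => t ^+ 2) = (fun t => t * t).
  by apply/funext => t; rewrite expr2.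
apply: (is_derive1_eq (is_derive1M (is_derive1_id x) (is_derive1_id x))).
by ring.
Qed.

Lemma is_derive1_linear a x : is_derive x 1 (fun t : R => a * t) a.
Proof.
apply: (is_derive1_eq (is_derive1Z a (is_derive1_id x))).
exact: mulr1.
Qed.

Lemma is_derive1_affine f (df : R -> R) a b c : (forall t : R, is_derive t 1 f (df t)) ->
  is_derive c 1 (fun t => f (a + b * t)) (b * df (a + b * c)).
Proof.
move=> Df.
have D1 : is_derive c 1 (fun t : R => a + b * t) b.
  apply: (is_derive1_eq (is_derive1D (is_derive1_cst a c) (is_derive1_linear b c))).
  exact: add0r.
apply: (is_derive1_eq (is_derive1_comp (Df _) D1)).
exact: mulrC.
Qed.

(** A comparison principle: [g + f] and [g - f] have nonnegative derivatives and
    vanish at the origin.  All Taylor estimates below are instances of it. *)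
Lemma derive_norm_le (f g df dg : R -> R) (h : R) : 0 <= h ->
  (forall s, 0 <= s <= h -> has_deriv f s (df s)) ->
  (forall s, 0 <= s <= h -> has_deriv g s (dg s)) ->
  (forall s, 0 <= s <= h -> `|df s| <= dg s) ->
  f 0 = 0 -> g 0 = 0 -> `|f h| <= g h.
Proof.
move=> h0 Df Dg dfg f0 g0.
have mono (k dk : R -> R) : (forall s, 0 <= s <= h -> has_deriv k s (dk s)) ->
    (forall s, 0 <= s <= h -> 0 <= dk s) -> k 0 <= k h.
  move=> Dk dk0.
  have [||c] := @MVT_segment R k dk 0 h h0.
  - by move=> x; rewrite in_itv/= => /andP[x0 xh]; apply: Dk; rewrite !ltW.
  - apply: derivable_within_continuous => x; rewrite in_itv/= => xh.
    by have [] := Dk _ xh.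
  rewrite in_itv/= => ch kE; rewrite -subr_ge0 kE mulr_ge0 ?subr_ge0//.
  exact: dk0.
have le0D : g 0 + f 0 <= g h + f h.
  apply: (mono (fun s => g s + f s) (fun s => dg s + df s)) => s sh.
    exact: (is_derive1D (Dg _ sh) (Df _ sh)).
  by have := dfg _ sh; rewrite ler_norml => /andP[? ?]; lra.
have le0B : g 0 - f 0 <= g h - f h.
  apply: (mono (fun s => g s - f s) (fun s => dg s - df s)) => s sh.
    exact: (is_derive1B (Dg _ sh) (Df _ sh)).
  by have := dfg _ sh; rewrite ler_norml => /andP[? ?]; lra.
by rewrite f0 g0 in le0D le0B; rewrite ler_norml; lra.
Qed.

(** Taylor's inequality at orders one to three.  The increment is written [k * s]
    with [s] in the unit interval, so that [k] may have either sign. *)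
Lemma taylor1_le (f f1 : R -> R) (C x k : R) :
  (forall t : R, is_derive t 1 f (f1 t)) -> (forall t, `|f1 t| <= C) ->
  `|f (x + k) - f x| <= C * `|k|.
Proof.
move=> Df f1C.
have := @derive_norm_le (fun s => f (x + k * s) - f x) (fun s => C * `|k| * s)
  (fun s => k * f1 (x + k * s) - 0) (fun s => C * `|k|) 1.
rewrite /= !(mulr1, mulr0, addr0); apply; [exact: ler01| | | | |].
- move=> s _.
  exact: (is_derive1B (is_derive1_affine _ _ _ Df) (is_derive1_cst _ _)).
- by move=> s _; exact: is_derive1_linear.
- by move=> s _; rewrite subr0 normrM mulrC ler_wpM2r.
- by rewrite subrr.
- by [].
Qed.

Lemma taylor2_le (f f1 f2 : R -> R) (C x k : R) :
  (forall t : R, is_derive t 1 f (f1 t)) -> (forall t : R, is_derive t 1 f1 (f2 t)) ->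
  (forall t, `|f2 t| <= C) ->
  `|f (x + k) - f x - f1 x * k| <= C / 2 * k ^+ 2.
Proof.
move=> Df Df1 f2C.
have := @derive_norm_le (fun s => f (x + k * s) - f x - f1 x * k * s)
  (fun s => C / 2 * k ^+ 2 * s ^+ 2)
  (fun s => k * f1 (x + k * s) - 0 - f1 x * k)
  (fun s => C / 2 * k ^+ 2 * (2 * s)) 1.
rewrite /= !expr1n !(mulr1, mulr0, addr0) expr0n/= mulr0 subrr subr0.
apply; [exact: ler01| | | | |].
- move=> s _.
  exact: (is_derive1B (is_derive1B (is_derive1_affine _ _ _ Df)
    (is_derive1_cst _ _)) (is_derive1_linear _ _)).
- by move=> s _; exact: (is_derive1Z _ (is_derive1_sqr s)).
- move=> s /andP[s0 _].
  have -> : k * f1 (x + k * s) - 0 - f1 x * k = k * (f1 (x + k * s) - f1 x).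
    by ring.
  rewrite normrM (le_trans (ler_wpM2l _ (taylor1_le _ _ Df1 f2C)))//.
  rewrite normrM (ger0_norm s0) -(real_normK (num_real k)).
  by rewrite le_eqVlt; apply/orP; left; apply/eqP; field.
- by [].
- by [].
Qed.

Lemma taylor3_le (f f1 f2 f3 : R -> R) (C x k : R) :
  (forall t : R, is_derive t 1 f (f1 t)) -> (forall t : R, is_derive t 1 f1 (f2 t)) ->
  (forall t : R, is_derive t 1 f2 (f3 t)) -> (forall t, `|f3 t| <= C) ->
  `|f (x + k) - f x - f1 x * k - f2 x / 2 * k ^+ 2| <= C / 6 * `|k| ^+ 3.
Proof.
move=> Df Df1 Df2 f3C.
have Dcube (s : R) : is_derive s 1 (fun t : R => t ^+ 3) (3 * s ^+ 2).
  have -> : (fun t : R => t ^+ 3) = (fun t => t * t ^+ 2).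
    by apply/funext => t; rewrite exprS.
  apply: (is_derive1_eq (is_derive1M (is_derive1_id s) (is_derive1_sqr s))).
  by rewrite /=; ring.
have := @derive_norm_le
  (fun s => f (x + k * s) - f x - f1 x * k * s - f2 x / 2 * k ^+ 2 * s ^+ 2)
  (fun s => C / 6 * `|k| ^+ 3 * s ^+ 3)
  (fun s => k * f1 (x + k * s) - 0 - f1 x * k - f2 x / 2 * k ^+ 2 * (2 * s))
  (fun s => C / 6 * `|k| ^+ 3 * (3 * s ^+ 2)) 1.
rewrite /= !expr1n !(mulr1, mulr0, addr0) !expr0n/= !mulr0 subrr !subr0.
apply; [exact: ler01| | | | |].
- move=> s _.
  exact: (is_derive1B (is_derive1B
    (is_derive1B (is_derive1_affine _ _ _ Df) (is_derive1_cst _ _))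
    (is_derive1_linear _ _)) (is_derive1Z _ (is_derive1_sqr s))).
- by move=> s _; exact: (is_derive1Z _ (Dcube s)).
- move=> s /andP[s0 _].
  have -> : k * f1 (x + k * s) - 0 - f1 x * k - f2 x / 2 * k ^+ 2 * (2 * s) =
      k * (f1 (x + k * s) - f1 x - f2 x * (k * s)) by field.
  rewrite normrM (le_trans (ler_wpM2l _ (taylor2_le _ _ Df1 Df2 f3C)))//.
  rewrite exprMn -(real_normK (num_real k)).
  by rewrite le_eqVlt; apply/orP; left; apply/eqP; field.
- by [].
- by [].
Qed.

End scalar_derivatives.

Section gaussian_calculus.
Context {R : realType}.
Implicit Types (x y v s : R).

Definition gauss_peak : R := (Num.sqrt (2 * pi))^-1.
Definition gauss_pdf x : R := gauss_peak * expR (- x ^+ 2 / 2).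
Definition gauss_pdf1 x : R := - x * gauss_pdf x.
Definition gauss_pdf2 x : R := (x ^+ 2 - 1) * gauss_pdf x.

Lemma gauss_peak_gt0 : 0 < gauss_peak.
Proof. by rewrite invr_gt0 sqrtr_gt0 mulr_gt0// pi_gt0. Qed.

Lemma gauss_pdfE : gauss_pdf = normal_pdf 0 1 :> (R -> R).
Proof.
apply/funext => x; rewrite normal_pdfE// /normal_peak /normal_fun /gauss_pdf.
rewrite subr0 expr1n mul1r; congr (_ * _); rewrite /gauss_peak.
by rewrite -[in RHS]mulr_natr mulrC.
Qed.

Lemma phiE x : (phi x)%:E = normal_prob 0 1 `]-oo, x].
Proof.
rewrite /normal_prob -gauss_pdfE /phi /Rintegral -[in LHS]/gauss_peak.
have mf : measurable_fun setT (fun t : R => expR (- t ^+ 2 / 2)).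
  apply: measurableT_comp => //; apply: measurable_funM => //.
  exact: measurableT_comp.
rewrite -RintegralZl//; last first.
  have : (@lebesgue_measure R).-integrable `]-oo, x]
    (fun t => (gauss_peak^-1)%:E * (normal_pdf 0 1 t)%:E)%E.
    apply: integrableZl => //.
    apply: (@integrableS _ _ _ _ setT) => //; exact: integrable_normal_pdf.
  apply: eq_integrable => // t _ /=.
  by rewrite -EFinM -gauss_pdfE /gauss_pdf mulKf// gt_eqF// gauss_peak_gt0.
rewrite /Rintegral fineK//.
rewrite [X in X \is a fin_num](_ : _ =
   \int[lebesgue_measure]_(t in `]-oo, x]) (normal_pdf 0 1 t)%:E)%E; last first.
  by apply: eq_integral => t _; rewrite -gauss_pdfE.
exact: (@fin_num_measure _ _ _ (normal_prob 0 1)).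
Qed.

Lemma phi_ge0 x : 0 <= phi x.
Proof. by rewrite -lee_fin phiE. Qed.

Lemma phi_le1 x : phi x <= 1.
Proof. by rewrite -lee_fin phiE probability_le1. Qed.

Lemma is_derive_phi x : is_derive x 1 phi (gauss_pdf x).
Proof.
have fE t : phi t = (\int[lebesgue_measure]_(s in `]-oo, t]) gauss_pdf s)%R.
  apply: EFin_inj; rewrite phiE /normal_prob -gauss_pdfE /Rintegral fineK//.
  rewrite gauss_pdfE; exact: (@fin_num_measure _ _ _ (normal_prob 0 1)).
have -> : phi = fun t => (\int[lebesgue_measure]_(s in `]-oo, t]) gauss_pdf s)%R.
  exact/funext.
have [] := @continuous_FTC1 R gauss_pdf -oo%O x (x + 1).
- by rewrite ltrDl.
- apply: (@integrableS _ _ _ _ setT) => //.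
  by rewrite gauss_pdfE; exact: integrable_normal_pdf.
- exact: ltNyr.
- rewrite gauss_pdfE; exact: continuous_normal_pdf.
by move=> D E; apply: DeriveDef; [exact: D|rewrite -derive1E; exact: E].
Qed.

Lemma is_derive_gauss_pdf x : is_derive x 1 gauss_pdf (gauss_pdf1 x).
Proof.
have D1 : is_derive x 1 (fun t : R => - t ^+ 2 / 2) (- x).
  have -> : (fun t : R => - t ^+ 2 / 2) = (fun t => - 2^-1 * t ^+ 2).
    by apply/funext => t; field.
  apply: (is_derive1_eq (is_derive1Z (- 2^-1) (is_derive1_sqr x))).
  by field.
apply: (is_derive1_eq
  (is_derive1Z gauss_peak (is_derive1_comp (is_derive_expR _) D1))).
by rewrite /gauss_pdf1 /gauss_pdf; ring.
Qed.

Lemma is_derive_gauss_pdf1 x : is_derive x 1 gauss_pdf1 (gauss_pdf2 x).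
Proof.
apply: (is_derive1_eq (is_derive1M (is_deriveNid x 1) (is_derive_gauss_pdf x))).
by rewrite /gauss_pdf2 /gauss_pdf1; ring.
Qed.

(** The square of [1 + u <= exp u] at [u = x ^ 2 / 4]; it dominates the
    polynomials that appear in the derivatives of the normal density. *)
Lemma exp_quad_ge x : 1 + x ^+ 2 / 2 + x ^+ 4 / 16 <= expR (x ^+ 2 / 2).
Proof.
rewrite [X in expR X](_ : _ = x ^+ 2 / 4 + x ^+ 2 / 4); last by field.
rewrite expRD; have : 1 + x ^+ 2 / 4 <= expR (x ^+ 2 / 4) by exact: expR_ge1Dx.
have := sqr_ge0 x; nra.
Qed.

Lemma gauss_pdf_poly_le (p c : R) x : 0 <= c ->
  `|p| <= c * (1 + x ^+ 2 / 2 + x ^+ 4 / 16) ->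
  `|p * gauss_pdf x| <= c * gauss_peak.
Proof.
move=> c0 pc; rewrite /gauss_pdf mulrCA normrM (ger0_norm (ltW gauss_peak_gt0)).
rewrite mulrC ler_wpM2r ?(ltW gauss_peak_gt0)//.
rewrite normrM (ger0_norm (expR_ge0 _)) mulNr expRN ler_pdivrMr ?expR_gt0//.
by rewrite (le_trans pc)// ler_wpM2l// exp_quad_ge.
Qed.

Lemma gauss_pdf_le x : `|gauss_pdf x| <= gauss_peak.
Proof.
rewrite -[gauss_pdf x]mul1r -[leRHS]mul1r; apply: gauss_pdf_poly_le => //.
by rewrite normr1; nra.
Qed.

Lemma gauss_pdf1_le x : `|gauss_pdf1 x| <= gauss_peak.
Proof.
rewrite -[leRHS]mul1r; apply: gauss_pdf_poly_le => //.
by rewrite ler_norml; nra.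
Qed.

Lemma gauss_pdf2_le x : `|gauss_pdf2 x| <= gauss_peak.
Proof.
rewrite -[leRHS]mul1r; apply: gauss_pdf_poly_le => //.
by rewrite ler_norml; nra.
Qed.

Lemma gauss_pdf3_le x : `|(3 * x - x ^+ 3) * gauss_pdf x| <= 4 * gauss_peak.
Proof.
apply: gauss_pdf_poly_le => //.
rewrite ler_norml; apply/andP; split; have := sqr_ge0 (x - 2);
  have := sqr_ge0 (x + 2); have := sqr_ge0 (x * (x - 2));
  have := sqr_ge0 (x * (x + 2)); nra.
Qed.

Lemma phi_lipschitz x k : `|phi (x + k) - phi x| <= gauss_peak * `|k|.
Proof. exact: (taylor1_le _ _ is_derive_phi gauss_pdf_le). Qed.

Lemma phi_taylor2 x k :
  `|phi (x + k) - phi x - gauss_pdf x * k| <= gauss_peak / 2 * k ^+ 2.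
Proof.
exact: (taylor2_le _ _ is_derive_phi is_derive_gauss_pdf gauss_pdf1_le).
Qed.

Lemma phi_taylor3 x k :
  `|phi (x + k) - phi x - gauss_pdf x * k - gauss_pdf1 x / 2 * k ^+ 2|
  <= gauss_peak / 6 * `|k| ^+ 3.
Proof.
exact: (taylor3_le _ _ is_derive_phi is_derive_gauss_pdf is_derive_gauss_pdf1
  gauss_pdf2_le).
Qed.

Lemma is_derive_div_sqrt y v : 0 < v ->
  is_derive v 1 (fun t => y / Num.sqrt t) (- (y / Num.sqrt v) / (2 * v)).
Proof.
move=> v0; have sv0 : 0 < Num.sqrt v by rewrite sqrtr_gt0.
have sv0' : Num.sqrt v != 0 by rewrite gt_eqF.
apply: (is_derive1_eq (is_derive1Z y (is_derive1V sv0' (is_derive1_sqrt v0)))).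
rewrite -[X in _ = - _ / (2 * X)](sqr_sqrtr (ltW v0)).
by field.
Qed.

(** The heat equation: the derivative in [v] of [phi (y / sqrt v)] is half its
    second derivative in [y]. *)
Lemma is_derive_phi_div_sqrt y v : 0 < v ->
  is_derive v 1 (fun t => phi (y / Num.sqrt t))
    (gauss_pdf1 (y / Num.sqrt v) / (2 * v)).
Proof.
move=> v0; apply: (is_derive1_eq (is_derive1_comp (is_derive_phi _) (is_derive_div_sqrt y v0))).
by rewrite /gauss_pdf1; ring.
Qed.

Lemma is_derive_heat_rate y v : 0 < v ->
  is_derive v 1 (fun t => gauss_pdf1 (y / Num.sqrt t) / (2 * t))
    (let z := y / Num.sqrt v in (3 * z - z ^+ 3) * gauss_pdf z / (4 * v ^+ 2)).
Proof.
move=> v0 /=; have v20 : 2 * v != 0 by rewrite gt_eqF// mulr_gt0.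
apply: (is_derive1_eq (is_derive1M
  (is_derive1_comp (is_derive_gauss_pdf1 _) (is_derive_div_sqrt y v0))
  (is_derive1V v20 (is_derive1_linear 2 v)))).
rewrite /= /gauss_pdf2 /gauss_pdf1; set z := y / _; set p := gauss_pdf z.
by field; rewrite gt_eqF.
Qed.

Lemma is_derive1_shift (f : R -> R) (a c s : R) : is_derive (a + s) 1 f c ->
  is_derive s 1 (fun t => f (a + t)) c.
Proof.
move=> Df.
apply: (is_derive1_eq (is_derive1_comp Df
  (is_derive1D (is_derive1_cst a s) (is_derive1_id s)))).
by rewrite add0r mulr1.
Qed.

Lemma derive_norm_le_linear (f df : R -> R) (a c h : R) : 0 <= h ->
  (forall s, 0 <= s <= h -> has_deriv f (a + s) (df (a + s))) ->
  (forall s, 0 <= s <= h -> `|df (a + s)| <= c) ->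
  `|f (a + h) - f a| <= c * h.
Proof.
move=> h0 Df dfc.
apply: (@derive_norm_le _ (fun s => f (a + s) - f a) (fun s => c * s)
  (fun s => df (a + s) - 0) (fun=> c) h h0).
- move=> s sh.
  exact: (is_derive1B (is_derive1_shift (Df s sh)) (is_derive1_cst _ _)).
- by move=> s _; exact: is_derive1_linear.
- by move=> s sh; rewrite subr0; exact: dfc.
- by rewrite addr0 subrr.
- by rewrite mulr0.
Qed.

Lemma heat_lipschitz y v s : 0 < v -> 0 <= s ->
  `|phi (y / Num.sqrt (v + s)) - phi (y / Num.sqrt v)| <= gauss_peak / (2 * v) * s.
Proof.
move=> v0 s0; apply: (derive_norm_le_linear (f := fun t => phi (y / Num.sqrt t))
  (df := fun t => gauss_pdf1 (y / Num.sqrt t) / (2 * t))) => // u /andP[u0 _].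
  exact: (is_derive_phi_div_sqrt _ (ltr_wpDr u0 v0)).
rewrite normrM ler_pM// ?gauss_pdf1_le// ger0_norm; last first.
  by rewrite invr_ge0 mulr_ge0// addr_ge0// ltW.
by rewrite lef_pV2 ?ler_pM2l ?lerDl// posrE mulr_gt0// ltr_wpDr.
Qed.

Lemma heat_rate_lipschitz y v s : 0 < v -> 0 <= s ->
  `|gauss_pdf1 (y / Num.sqrt (v + s)) / (2 * (v + s))
    - gauss_pdf1 (y / Num.sqrt v) / (2 * v)| <= gauss_peak / v ^+ 2 * s.
Proof.
move=> v0 s0.
pose dh t := let z := y / Num.sqrt t in
  (3 * z - z ^+ 3) * gauss_pdf z / (4 * t ^+ 2).
have D u : 0 <= u <= s ->
    has_deriv (fun t => gauss_pdf1 (y / Num.sqrt t) / (2 * t)) (v + u) (dh (v + u)).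
  by move=> /andP[u0 _]; exact: (is_derive_heat_rate _ (ltr_wpDr u0 v0)).
have B u : 0 <= u <= s -> `|dh (v + u)| <= gauss_peak / v ^+ 2.
  move=> /andP[u0 _]; have vu0 : 0 < v + u by rewrite ltr_wpDr.
  rewrite normrM [X in _ * X]ger0_norm; last first.
    by rewrite invr_ge0 mulr_ge0// sqr_ge0.
  rewrite (le_trans (ler_wpM2r _ (gauss_pdf3_le _)))//.
    by rewrite invr_ge0 mulr_ge0// sqr_ge0.
  rewrite invfM mulrACA mulfV// mul1r ler_wpM2l ?(ltW gauss_peak_gt0)//.
  rewrite lef_pV2 ?posrE ?exprn_gt0//.
  by rewrite lerXn2r ?nnegrE ?(ltW v0) ?(ltW vu0)// lerDl.
exact: (derive_norm_le_linear s0 D B).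
Qed.

Lemma heat_taylor2 y v s : 0 < v -> 0 <= s ->
  `|phi (y / Num.sqrt (v + s)) - phi (y / Num.sqrt v)
    - gauss_pdf1 (y / Num.sqrt v) / (2 * v) * s| <= gauss_peak / 2 * (s / v) ^+ 2.
Proof.
move=> v0 s0; set c := gauss_pdf1 _ / _.
have -> : gauss_peak / 2 * (s / v) ^+ 2 = gauss_peak / (2 * v ^+ 2) * s ^+ 2.
  by field; rewrite gt_eqF.
apply: (@derive_norm_le _
  (fun t => phi (y / Num.sqrt (v + t)) - phi (y / Num.sqrt v) - c * t)
  (fun t => gauss_peak / (2 * v ^+ 2) * t ^+ 2)
  (fun t => gauss_pdf1 (y / Num.sqrt (v + t)) / (2 * (v + t)) - 0 - c)
  (fun t => gauss_peak / (2 * v ^+ 2) * (2 * t)) s s0).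
- move=> t /andP[t0 _].
  have vt : 0 < v + t by rewrite ltr_wpDr.
  exact: (is_derive1B (is_derive1B
    (is_derive1_shift (is_derive_phi_div_sqrt y vt)) (is_derive1_cst _ _))
    (is_derive1_linear c t)).
- by move=> t _; exact: (is_derive1Z _ (is_derive1_sqr t)).
- move=> t /andP[t0 _]; rewrite subr0 (le_trans (heat_rate_lipschitz _ _ _))//.
  by rewrite le_eqVlt; apply/orP; left; apply/eqP; field; rewrite gt_eqF.
- by rewrite addr0 mulr0 subr0 subrr.
- by rewrite expr0n mulr0.
Qed.

End gaussian_calculus.

(** * Removing a Gaussian smoothing *)

Section gaussian_moments.
Context {R : realType}.
Local Notation mu := (@lebesgue_measure R).

Lemma measurable_gauss_pdf : measurable_fun [set: R] gauss_pdf.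
Proof. by rewrite gauss_pdfE; exact: measurable_normal_pdf. Qed.

Lemma gauss_pdf_ge0 (x : R) : 0 <= gauss_pdf x.
Proof. by rewrite gauss_pdfE normal_pdf_ge0. Qed.

Lemma integrable_gauss_pdf : mu.-integrable setT (EFin \o gauss_pdf).
Proof. by rewrite gauss_pdfE; exact: integrable_normal_pdf. Qed.

Lemma Rintegral_gauss_pdf : (\int[mu]_x gauss_pdf x)%R = 1.
Proof. by rewrite /Rintegral gauss_pdfE integral_normal_pdf. Qed.

Lemma cvg_gauss_pdf : gauss_pdf x @[x --> +oo%R] --> (0 : R).
Proof.
rewrite -[X in _ --> X](mulr0 gauss_peak); apply: cvgMr.
have -> : (fun x : R => expR (- x ^+ 2 / 2)) = (fun x => expR (- x)) \o (fun x => x ^+ 2 / 2).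
  by apply/funext => x /=; rewrite mulNr.
apply: (cvg_comp _ _ _ (@cvgr_expR R)).
apply: gt0_cvgMly; last exact: cvgr_expr2.
by [].
Qed.

(** [x * gauss_pdf x] is the derivative of [- gauss_pdf x]. *)
Lemma integral_pos_part_gauss :
  (\int[mu]_(x in `[0%R, +oo[) (x * gauss_pdf x)%:E)%E = gauss_peak%:E.
Proof.
rewrite (@ge0_continuous_FTC2y _ _ (fun x => - gauss_pdf x) _ 0).
- rewrite sub0e -EFinN opprK; congr EFin.
  by rewrite /gauss_pdf expr0n/= oppr0 mul0r expR0 mulr1.
- by move=> x x0; rewrite mulr_ge0// gauss_pdf_ge0.
- apply: continuous_subspaceT => x.
  apply: cvgM; first exact: cvg_id.
  by rewrite gauss_pdfE; exact: continuous_normal_pdf.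
- by rewrite -[X in _ --> X]oppr0; apply: cvgN; exact: cvg_gauss_pdf.
- by move=> x x0; apply: derivableN; have [] := is_derive_gauss_pdf x.
- apply: cvg_at_right_filter; apply: cvgN.
  by rewrite gauss_pdfE; exact: continuous_normal_pdf.
- move=> x _; rewrite derive1E deriveN; last by have [] := is_derive_gauss_pdf x.
  by have [_ ->] := is_derive_gauss_pdf x; rewrite /gauss_pdf1 mulNr opprK.
Qed.

Lemma integral_maxr_gauss_pdf :
  (\int[mu]_x (Num.max x 0 * gauss_pdf x)%:E)%E = gauss_peak%:E.
Proof.
rewrite -integral_pos_part_gauss [RHS]integral_mkcond.
apply: eq_integral => x _; rewrite patchE mem_setE in_itv/= andbT.
case: ifPn => x0; first by rewrite max_l.
by rewrite max_r ?mul0r// ltW// ltNge.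
Qed.

Lemma integral_maxrN_gauss_pdf :
  (\int[mu]_x (Num.max (- x) 0 * gauss_pdf x)%:E)%E = gauss_peak%:E.
Proof.
pose f (x : R) : \bar R := (Num.max x 0 * gauss_pdf x)%:E.
have mf : measurable_fun setT f.
  apply/measurable_EFinP; apply: measurable_funM; last exact: measurable_gauss_pdf.
  exact: measurable_maxr.
have f0 x : (0 <= f x)%E.
  by rewrite lee_fin mulr_ge0 ?gauss_pdf_ge0// le_max lexx orbT.
rewrite -integral_pos_part_gauss.
rewrite (_ : (\int[mu]_(x in `[0%R, +oo[) _)%E = (\int[mu]_(x in `[0%R, +oo[) f x)%E).
  rewrite (ge0_integration_by_substitution0 mf f0) [RHS]integral_mkcond.
  apply: eq_integral => x _; rewrite patchE mem_setE in_itv/=.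
  have -> : gauss_pdf x = gauss_pdf (- x) by rewrite /gauss_pdf sqrrN.
  case: ifPn => // x0; rewrite max_r ?mul0r//.
  by rewrite oppr_le0 ltW// ltNge.
apply: eq_integral => x; rewrite mem_setE in_itv/= andbT /f => x0.
by rewrite max_l.
Qed.

Lemma integrable_maxr_gauss_pdf :
  mu.-integrable setT (fun s => (Num.max s 0 * gauss_pdf s)%:E).
Proof.
apply/integrableP; split.
  apply/measurable_EFinP; apply: measurable_funM; last exact: measurable_gauss_pdf.
  exact: measurable_maxr.
under eq_integral => s _.
  rewrite gee0_abs; last first.
    by rewrite lee_fin mulr_ge0 ?gauss_pdf_ge0// le_max lexx orbT.
  over.
by rewrite integral_maxr_gauss_pdf ltry.
Qed.

Lemma integrable_maxrN_gauss_pdf :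
  mu.-integrable setT (fun s => (Num.max (- s) 0 * gauss_pdf s)%:E).
Proof.
apply/integrableP; split.
  apply/measurable_EFinP; apply: measurable_funM; last exact: measurable_gauss_pdf.
  exact: measurable_maxr.
under eq_integral => s _.
  rewrite gee0_abs; last first.
    by rewrite lee_fin mulr_ge0 ?gauss_pdf_ge0// le_max lexx orbT.
  over.
by rewrite integral_maxrN_gauss_pdf ltry.
Qed.

End gaussian_moments.

(** The smoothing inequality in abstract form.  [F] is a distribution function,
    [G] a Lipschitz one and [A] the Gaussian average of [F] at scale [e]; of the
    average only the comparison with functions [a -+ b * s^+-] is used, the normal
    law giving mass [m] to the positive part of [s] and to its negative part. *)
Section contraction.
Context {R : realType}.
Variables (F G A : R -> R) (m e K M : R).
Hypotheses (m0 : 0 < m) (m12 : m <= 1 / 2) (e0 : 0 < e).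
Hypothesis F_nd : forall x y, x <= y -> F x <= F y.
Hypothesis G_lip : forall x k, `|G (x + k) - G x| <= m * `|k|.
Hypothesis A_ge : forall z a b,
  (forall s, a - b * Num.max s 0 <= F (z - e * s)) -> a - b * m <= A z.
Hypothesis A_le : forall z a b,
  (forall s, F (z - e * s) <= a + b * Num.max (- s) 0) -> A z <= a + b * m.
Hypothesis AG : forall z, `|A z - G z| <= K.
Hypothesis FG : forall x, `|F x - G x| <= M.

(** If [F] exceeds [G] by [D] at [x] then, by monotonicity, it exceeds
    [F x] on a half line to the right of [x].  The average of [F] at [x + 2 e] sees
    that half line with weight close to 1, and on the rest of the line [F] is at
    least [G - M].  The event [s > 2] has mass at most [m / 2 <= 1/4], because its
    indicator is at most [s^+ / 2]; the bound [M] therefore comes back multiplied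
    by a factor less than 1.  Deviations below [G] are treated at [x - 2 e]. *)
Lemma smoothing_contraction x :
  `|F x - G x| <= M / 3 + 4 / 3 * (K + 5 / 2 * m * e).
Proof.
have nP (a b : R) : `|a| <= b -> - b <= a /\ a <= b.
  by rewrite ler_norml => /andP.
have [Mx1 Mx2] := nP _ _ (FG x).
have [_ K1] := nP _ _ (AG (x + 2 * e)).
have [K2 _] := nP _ _ (AG (x - 2 * e)).
have me : 0 < m * e by rewrite mulr_gt0.
have lip y s : G y - m * e * `|s| <= G (y + e * s) <= G y + m * e * `|s|.
  have [] := nP _ _ (G_lip y (e * s)).
  by rewrite normrM (ger0_norm (ltW e0)) mulrA; lra.
have L1 : G (x + 2 * e) <= G x + m * e * 2.
  by have := lip x 2; rewrite ger0_norm// (mulrC e); lra.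
have L2 : G x - m * e * 2 <= G (x - 2 * e).
  by have := lip x (- 2); rewrite normrN ger0_norm// mulrN (mulrC e); lra.
pose D := F x - G x.
have DM1 : 0 <= D + M by rewrite /D; lra.
have DM2 : 0 <= M - D by rewrite /D; lra.
have up : F x - ((D + M) / 2 + m * e) * m <= A (x + 2 * e).
  apply: A_ge => s; have [s2|s2] := leP s 2.
    apply: (@le_trans _ _ (F x)); last first.
      have : 0 <= e * (2 - s) by rewrite mulr_ge0 ?subr_ge0// ltW.
      by move=> ?; apply: F_nd; lra.
    rewrite lerBlDr lerDl mulr_ge0// ?le_max ?lexx ?orbT//; lra.
  rewrite max_l; last by rewrite ltW// (lt_trans _ s2).
  have [H _] := nP _ _ (FG (x + 2 * e - e * s)).
  have := lip x (2 - s); rewrite ler0_norm; last by rewrite subr_le0 ltW.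
  have -> : x + e * (2 - s) = x + 2 * e - e * s by ring.
  move=> /andP[H' _].
  have : 0 <= (D + M) * (s - 2) by rewrite mulr_ge0// subr_ge0 ltW.
  by move: DM1; rewrite /D; lra.
have dn : A (x - 2 * e) <= F x + ((M - D) / 2 + m * e) * m.
  apply: A_le => s; have [s2|s2] := leP (- s) 2.
    apply: (@le_trans _ _ (F x)).
      have : 0 <= e * (2 + s) by rewrite mulr_ge0 ?(ltW e0)//; lra.
      by move=> ?; apply: F_nd; lra.
    rewrite lerDl mulr_ge0// ?le_max ?lexx ?orbT//; lra.
  rewrite max_l; last by rewrite ltW// (lt_trans _ s2).
  have [_ H] := nP _ _ (FG (x - 2 * e - e * s)).
  have := lip x (- 2 - s); rewrite ger0_norm; last by rewrite subr_ge0 lerNr ltW.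
  have -> : x + e * (- 2 - s) = x - 2 * e - e * s by ring.
  move=> /andP[_ H'].
  have : 0 <= (M - D) * (- s - 2) by rewrite mulr_ge0// subr_ge0 ltW.
  by move: DM2; rewrite /D; lra.
have mm : m * (m * e) <= 1 / 2 * (m * e) by rewrite ler_wpM2r// ltW.
have Dm1 : (D + M) * m <= (D + M) * (1 / 2) by rewrite ler_wpM2l.
have Dm2 : (M - D) * m <= (M - D) * (1 / 2) by rewrite ler_wpM2l.
by rewrite -/D ler_norml; move: up dn DM1 DM2 Dm1 Dm2; rewrite /D; lra.
Qed.

End contraction.

Section smoothing.
Context d (T : measurableType d) (R : realType) (P : probability T R).
Local Notation mu := (@lebesgue_measure R).
Variables (S : T -> R) (mS : measurable_fun setT S).

Definition cdf_at (x : R) : R := fine (P [set t | S t <= x]).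

Lemma measurable_le_level (x : R) : measurable [set t | S t <= x].
Proof.
rewrite (_ : [set t | _] = S @^-1` `]-oo, x]).
  by rewrite -[X in measurable X]setTI; exact: mS.
by apply/seteqP; split => t /=; rewrite in_itv.
Qed.

Lemma cdf_atE x : (cdf_at x)%:E = P [set t | S t <= x].
Proof. by rewrite /cdf_at fineK// fin_num_measure//; exact: measurable_le_level. Qed.

Lemma cdf_at_ge0 x : 0 <= cdf_at x.
Proof. by rewrite -lee_fin cdf_atE. Qed.

Lemma cdf_at_le1 x : cdf_at x <= 1.
Proof. by rewrite -lee_fin cdf_atE probability_le1//; exact: measurable_le_level. Qed.

Lemma cdf_at_nd x y : x <= y -> cdf_at x <= cdf_at y.
Proof.
move=> xy; rewrite -lee_fin !cdf_atE; apply: le_measure;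
  rewrite ?inE; [exact: measurable_le_level..|].
by move=> t /= /le_trans; exact.
Qed.

(** Both sides are the probability of [S + e N <= z], with [N] a standard normal
    variable independent of [S], integrated in the two possible orders. *)
Lemma expectation_phi (z e : R) : 0 < e ->
  (\int[P]_t (phi ((z - S t) / e))%:E
   = \int[mu]_s (cdf_at (z - e * s) * gauss_pdf s)%:E)%E.
Proof.
move=> e0.
pose f (p : T * R) := ((\1_[set p : T * R | S p.1 + e * p.2 <= z] p) * gauss_pdf p.2)%:E.
have mE : measurable [set p : T * R | S p.1 + e * p.2 <= z].
  have mg : measurable_fun setT (fun p : T * R => S p.1 + e * p.2).
    apply: measurable_funD; first exact: measurableT_comp.
    by apply: measurable_funM.
  rewrite (_ : [set p | _] = (fun p : T * R => S p.1 + e * p.2) @^-1` `]-oo, z]).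
    by rewrite -[X in measurable X]setTI; exact: mg.
  by apply/seteqP; split => p /=; rewrite in_itv.
have mf : measurable_fun setT f.
  apply/measurable_EFinP; apply: measurable_funM; first exact: measurable_indic.
  by apply: (measurableT_comp measurable_gauss_pdf).
have := @fubini_tonelli _ _ T (measurableTypeR R) R P (@lebesgue_measure R) f mf.
rewrite /fubini_F /fubini_G /f /= => fub.
transitivity (\int[P]_t \int[mu]_s
   ((\1_[set p : T * R | S p.1 + e * p.2 <= z] (t, s)) * gauss_pdf s)%:E)%E.
  apply: eq_integral => t _; rewrite phiE /normal_prob -gauss_pdfE.
  rewrite integral_mkcond; apply: eq_integral => s _.
  rewrite patchE indicE mem_setE in_itv/= ler_pdivlMr// mulrC.
  have -> : ((t, s) \in [set p : T * R | S p.1 + e * p.2 <= z]) = (e * s <= z - S t).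
    by apply/idP/idP; rewrite inE/= lerBrDl.
  by case: ifP => _; rewrite ?mul1r ?mul0r.
rewrite fub; last first.
  by move=> p; rewrite lee_fin mulr_ge0// gauss_pdf_ge0.
apply: eq_integral => s _.
rewrite EFinM cdf_atE.
transitivity ((\int[P]_t (\1_[set t | S t <= z - e * s] t)%:E) * (gauss_pdf s)%:E)%E.
  rewrite -ge0_integralZr//=; last 2 first.
  - by apply/measurable_EFinP; apply: measurable_indic; exact: measurable_le_level.
  - by rewrite lee_fin gauss_pdf_ge0.
  apply: eq_integral => t _; rewrite -EFinM; congr (_ * _)%:E.
  rewrite !indicE; congr (_ %:R); congr nat_of_bool.
  by apply/idP/idP; rewrite !inE/= lerBrDr.
by rewrite integral_indic ?setIT//; exact: measurable_le_level.
Qed.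

Lemma integrable_cdf_gauss (z e : R) : 0 <= e ->
  mu.-integrable setT (fun s => (cdf_at (z - e * s) * gauss_pdf s)%:E).
Proof.
move=> e0; apply: le_integrable integrable_gauss_pdf => //.
  apply/measurable_EFinP; apply: measurable_funM; last exact: measurable_gauss_pdf.
  apply: nonincreasing_measurable => // s t st; apply: cdf_at_nd.
  by rewrite lerD2l lerN2 ler_wpM2l.
move=> s _ /=; rewrite lee_fin normrM ler_piMl//.
by rewrite ger0_norm ?cdf_at_ge0// cdf_at_le1.
Qed.

Definition smoothed_cdf (e z : R) : R := (\int[P]_t phi ((z - S t) / e))%R.

Lemma smoothed_cdfE e z : 0 < e ->
  smoothed_cdf e z = (\int[mu]_s (cdf_at (z - e * s) * gauss_pdf s))%R.
Proof. by move=> e0; rewrite /smoothed_cdf /Rintegral expectation_phi. Qed.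

(** In this lemma and the next, [h] is the positive or the negative part. *)
Lemma smoothed_cdf_ge (h : R -> R) (e z a b : R) : 0 < e ->
  mu.-integrable setT (fun s => (h s * gauss_pdf s)%:E) ->
  (\int[mu]_s (h s * gauss_pdf s))%R = gauss_peak ->
  (forall s, a - b * h s <= cdf_at (z - e * s)) ->
  a - b * gauss_peak <= smoothed_cdf e z.
Proof.
move=> e0 ih hE ab; rewrite smoothed_cdfE//.
have ia : mu.-integrable setT (EFin \o (fun s => a * gauss_pdf s)).
  exact: (integrableZl measurableT a integrable_gauss_pdf).
have ib : mu.-integrable setT (EFin \o (fun s => b * (h s * gauss_pdf s))).
  exact: (integrableZl measurableT b ih).
have -> : a - b * gauss_peak =
    (\int[mu]_s (a * gauss_pdf s - b * (h s * gauss_pdf s)))%R.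
  rewrite RintegralB// RintegralZl//; last exact: integrable_gauss_pdf.
  by rewrite RintegralZl// hE Rintegral_gauss_pdf mulr1.
apply: le_Rintegral => //.
- exact: (integrableB measurableT ia ib).
- exact: integrable_cdf_gauss (ltW e0).
- move=> s _; rewrite mulrA -mulrBl ler_wpM2r//; exact: gauss_pdf_ge0.
Qed.

Lemma smoothed_cdf_le (h : R -> R) (e z a b : R) : 0 < e ->
  mu.-integrable setT (fun s => (h s * gauss_pdf s)%:E) ->
  (\int[mu]_s (h s * gauss_pdf s))%R = gauss_peak ->
  (forall s, cdf_at (z - e * s) <= a + b * h s) ->
  smoothed_cdf e z <= a + b * gauss_peak.
Proof.
move=> e0 ih hE ab; rewrite smoothed_cdfE//.
have ia : mu.-integrable setT (EFin \o (fun s => a * gauss_pdf s)).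
  exact: (integrableZl measurableT a integrable_gauss_pdf).
have ib : mu.-integrable setT (EFin \o (fun s => b * (h s * gauss_pdf s))).
  exact: (integrableZl measurableT b ih).
have -> : a + b * gauss_peak =
    (\int[mu]_s (a * gauss_pdf s + b * (h s * gauss_pdf s)))%R.
  rewrite RintegralD// RintegralZl//; last exact: integrable_gauss_pdf.
  by rewrite RintegralZl// hE Rintegral_gauss_pdf mulr1.
apply: le_Rintegral => //.
- exact: integrable_cdf_gauss (ltW e0).
- exact: (integrableD measurableT ia ib).
- move=> s _; rewrite mulrA -mulrDl ler_wpM2r//; exact: gauss_pdf_ge0.
Qed.

Lemma gauss_peak_le_half : (gauss_peak : R) <= 1 / 2.
Proof.
rewrite /gauss_peak div1r lef_pV2 ?posrE ?sqrtr_gt0 ?mulr_gt0 ?pi_gt0//.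
rewrite -[leLHS]ger0_norm// -sqrtr_sqr ler_sqrt; first by have := pi_ge2 R; lra.
by rewrite mulr_ge0// pi_ge0.
Qed.

Lemma smoothing_step (e K M : R) : 0 < e ->
  (forall z, `|smoothed_cdf e z - phi z| <= K) ->
  (forall x, `|cdf_at x - phi x| <= M) ->
  forall x, `|cdf_at x - phi x| <= M / 3 + 4 / 3 * (K + 5 / 2 * gauss_peak * e).
Proof.
move=> e0 AG FG x.
apply: (smoothing_contraction gauss_peak_gt0 gauss_peak_le_half e0 cdf_at_nd
  phi_lipschitz _ _ AG FG) => z a b.
- apply: (smoothed_cdf_ge e0 integrable_maxr_gauss_pdf).
  by rewrite /Rintegral integral_maxr_gauss_pdf.
- apply: (smoothed_cdf_le e0 integrable_maxrN_gauss_pdf).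
  by rewrite /Rintegral integral_maxrN_gauss_pdf.
Qed.

(** The bound [M] of [smoothing_step] reappears with the factor 1/3; taking for
    [M] the supremum of the distances lets it be absorbed. *)
Lemma smoothing (e K : R) : 0 < e ->
  (forall z, `|smoothed_cdf e z - phi z| <= K) ->
  forall x, `|cdf_at x - phi x| <= 2 * (K + 5 / 2 * gauss_peak * e).
Proof.
move=> e0 HK x.
pose A := [set `|cdf_at y - phi y| | y in [set: R]].
have A0 : A !=set0 by exists (`|cdf_at x - phi x|), x.
have Aub : has_ubound A.
  exists 1 => _ [y _ <-]; rewrite ler_norml.
  have := cdf_at_ge0 y; have := cdf_at_le1 y; have := phi_ge0 y; have := phi_le1 y.
  by lra.
have HM y : `|cdf_at y - phi y| <= sup A.
  by apply: (ub_le_sup Aub); exists y.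
have : sup A <= sup A / 3 + 4 / 3 * (K + 5 / 2 * gauss_peak * e).
  by apply: sup_le_ub => // _ [y _ <-]; exact: smoothing_step.
by have := HM x; lra.
Qed.

End smoothing.

(** * Integration against a sub-sigma-algebra *)

Section bounded_integrals.
Context d (T : measurableType d) (R : realType) (P : probability T R).
Implicit Types f g h : T -> R.

Lemma indic_cases (A : set T) t : (\1_A t = 0 :> R) \/ A t /\ (\1_A t = 1 :> R).
Proof.
have [At|At] := pselect (A t); [right|left]; rewrite indicE.
  by rewrite mem_set.
by rewrite memNset.
Qed.

Lemma bounded_near_le f (B : R) : (forall t, `|f t| <= B) ->
  [bounded f t | t in [set: T]].
Proof.
move=> fB; exists B; split; first exact: num_real.
by move=> x Bx t _ /=; rewrite (le_trans (fB t))// ltW.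
Qed.

Lemma integrable_bounded f (B : R) : measurable_fun setT f ->
  (forall t, `|f t| <= B) -> P.-integrable setT (EFin \o f).
Proof.
move=> mf fB; apply: measurable_bounded_integrable => //.
  by rewrite [ltLHS]probability_setT ltry.
exact: bounded_near_le fB.
Qed.

Lemma integrable_mul_bounded h g (B : R) : measurable_fun setT h ->
  (forall t, `|h t| <= B) -> P.-integrable setT (EFin \o g) ->
  P.-integrable setT (EFin \o (fun t => h t * g t)).
Proof.
move=> mh hB ig.
exact: (integrableMr measurableT mh (bounded_near_le hB) ig).
Qed.

Lemma integrable_cst_fun (c : R) : P.-integrable setT (EFin \o (fun _ : T => c)).
Proof. exact: (@integrable_bounded _ `|c|). Qed.

Lemma integrable_addf f g : P.-integrable setT (EFin \o f) ->
  P.-integrable setT (EFin \o g) ->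
  P.-integrable setT (EFin \o (fun t => f t + g t)).
Proof. by move=> fi gi; exact: (integrableD measurableT fi gi). Qed.

Lemma integrable_subf f g : P.-integrable setT (EFin \o f) ->
  P.-integrable setT (EFin \o g) ->
  P.-integrable setT (EFin \o (fun t => f t - g t)).
Proof. by move=> fi gi; exact: (integrableB measurableT fi gi). Qed.

Lemma integrable_scalef (c : R) f : P.-integrable setT (EFin \o f) ->
  P.-integrable setT (EFin \o (fun t => c * f t)).
Proof. by move=> fi; exact: (integrableZl measurableT c fi). Qed.

Lemma Rintegral_prob_cst (c : R) : \int[P]_t c = c.
Proof.
rewrite Rintegral_cst//; have -> : fine (P setT) = 1.
  by rewrite (_ : P setT = 1%E)//; exact: probability_setT.
exact: mulr1.
Qed.

Lemma Rintegral_abs_le f g : measurable_fun setT f ->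
  P.-integrable setT (EFin \o g) -> (forall t, `|f t| <= g t) ->
  P.-integrable setT (EFin \o f) /\ `|\int[P]_t f t| <= \int[P]_t g t.
Proof.
move=> mf ig fg.
have if_ : P.-integrable setT (EFin \o f).
  apply: le_integrable ig => //; first exact/measurable_EFinP.
  by move=> t _ /=; rewrite lee_fin (le_trans (fg t))// ler_norm.
split => //; apply: (le_trans (le_normr_Rintegral measurableT if_)).
apply: le_Rintegral => //; exact: integrable_norm if_.
Qed.

Lemma Rintegral_ge0_ae0 f : P.-integrable setT (EFin \o f) ->
  (forall t, 0 <= f t) -> \int[P]_t f t <= 0 -> {ae P, forall t, f t = 0}.
Proof.
move=> if_ f0 If.
have mf : measurable_fun setT (EFin \o f) by exact: measurable_int if_.
have I0 : (\int[P]_t `|(EFin \o f) t| = 0)%E.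
  under eq_integral => t _ do rewrite /= ger0_norm//.
  rewrite -[LHS]fineK; last exact: (integrable_fin_num measurableT if_).
  congr EFin; apply/eqP; rewrite eq_le If/=.
  by apply: fine_ge0; apply: integral_ge0 => t _; rewrite lee_fin.
have /(ae_eq_integral_abs P measurableT mf) := I0.
by apply: filterS => t /(_ Logic.I) [].
Qed.

Lemma Rintegral_indic (A : set T) f :
  \int[P]_(t in A) f t = \int[P]_t (\1_A t * f t).
Proof.
rewrite Rintegral_mkcond; apply: eq_Rintegral => t _.
by rewrite patchE indicE; case: ifP; rewrite ?mul1r ?mul0r.
Qed.

Lemma Rintegral_sum_ge0 (N : nat) (f : nat -> T -> R) :
  (forall j, P.-integrable setT (EFin \o f j)) ->
  (forall j, 0 <= \int[P]_t f j t) ->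
  P.-integrable setT (EFin \o (fun t => \sum_(j < N) f j t)) /\
  0 <= \int[P]_t \sum_(j < N) f j t.
Proof.
move=> if_ f0; elim: N => [|N [IH1 IH2]].
  rewrite (_ : (fun t => _) = cst 0); last first.
    by apply/funext => t; rewrite big_ord0.
  by rewrite Rintegral_prob_cst; split => //; exact: integrable_cst_fun.
rewrite (_ : (fun t => _) = fun t => \sum_(j < N) f j t + f N t); last first.
  by apply/funext => t; rewrite big_ord_recr.
split; first exact: integrable_addf.
by rewrite RintegralD// addr_ge0.
Qed.

End bounded_integrals.

Section conditional_nonnegativity.
Context d (T : measurableType d) (R : realType) (P : probability T R).
Variable GG : set (set T).
Hypothesis sub : <<s GG>> `<=` (measurable : set (set T)).
Local Notation TG := (g_sigma_algebraType GG).
Implicit Types g h : T -> R.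

(** The sigma-algebra generated by [GG] becomes the measurable structure of the
    copy [TG] of [T], so that the usual closure properties of measurable functions
    apply to functions measurable for it. *)
Definition Gmeas h : Prop := measurable_fun (setT : set TG) (h : TG -> R).

(** The conditional expectation of [g] given the sigma-algebra is nonnegative,
    expressed by its integrals over the sets of the sigma-algebra.  Equalities of
    conditional expectations are pairs of such inequalities. *)
Definition cond_ge0 g : Prop := P.-integrable setT (EFin \o g) /\
  forall A, <<s GG>> A -> 0 <= \int[P]_(t in A) g t.

Lemma Gmeas_measurable h : Gmeas h -> measurable_fun setT h.
Proof. by move=> mh _ Y mY; apply: sub; exact: (mh measurableT Y mY). Qed.

Lemma measurable_wrt_Gmeas h : measurable_wrt <<s GG>> h -> Gmeas h.
Proof. by move=> mh _ Y mY; apply: mh; exists Y. Qed.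

Lemma Gmeas_indic (A : set T) : <<s GG>> A -> Gmeas (\1_A : T -> R).
Proof. move=> GA; exact: (measurable_indic (GA : measurable (A : set TG))). Qed.

Lemma Gmeas_level h (c : R) : Gmeas h -> <<s GG>> [set t | c <= h t].
Proof.
move=> mh; rewrite (_ : [set t | _] = setT `&` (h @^-1` `[c, +oo[)).
  exact: (mh measurableT _ (measurable_itv _)).
by rewrite setTI; apply/seteqP; split => t /=; rewrite in_itv/= andbT.
Qed.

(** The sum counts the positive integers up to [y]. *)
Lemma staircase_le (N : nat) (y : R) : 0 <= y <= N%:R ->
  let s := (\sum_(j < N) (j.+1%:R <= y)%R%:R : R) in s <= y <= s + 1.
Proof.
elim: N => [|N IH] /andP[y0 yN] /=.
  by rewrite big_ord0; move: y0 yN; lra.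
rewrite big_ord_recr/=; have [yN'|Ny] := leP y N%:R.
  have -> : (N.+1%:R <= y) = false.
    by apply/negbTE; rewrite -ltNge (le_lt_trans yN')// ltr_nat.
  by rewrite addr0; apply: IH; rewrite y0.
rewrite (eq_bigr (fun=> 1)) => [|j _]; last first.
  by rewrite (le_trans _ (ltW Ny))// ler_nat.
rewrite sumr_const card_ord; rewrite -natr1 in yN *.
by case: (leP (N%:R + 1) y) => /= ?; apply/andP; split; lra.
Qed.

(** A bounded nonnegative [h] is within [1 / (m + 1)] of the staircase
    [hm], a combination with nonnegative coefficients of indicators of the level
    sets of [h], for which the inequality is the hypothesis on [g]. *)
Lemma cond_ge0_integral g h (B : R) : cond_ge0 g -> Gmeas h ->
  (forall t, 0 <= h t <= B) -> 0 <= \int[P]_t (h t * g t).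
Proof.
move=> [ig g0] mh hB.
have mhT := Gmeas_measurable mh.
have hnorm t : `|h t| <= B by have /andP[h0 ?] := hB t; rewrite ger0_norm.
have ih := integrable_mul_bounded mhT hnorm ig.
pose I := \int[P]_t `|g t|.
have ign : P.-integrable setT (EFin \o (fun t => `|g t|)) by exact: integrable_norm ig.
have approx (m : nat) : - (I / m.+1%:R) <= \int[P]_t (h t * g t).
  pose N := (Num.truncn (B * m.+1%:R)).+1.
  pose A (j : nat) := [set t | j.+1%:R / m.+1%:R <= h t].
  have GA j : <<s GG>> (A j) by exact: Gmeas_level.
  pose hm (t : T) : R := \sum_(j < N) m.+1%:R^-1 * \1_(A j) t.
  have m0 : 0 < m.+1%:R :> R by [].
  have hmh t : `|hm t - h t| <= m.+1%:R^-1.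
    have /andP[h0 hB'] := hB t.
    have : 0 <= h t * m.+1%:R <= N%:R.
      rewrite mulr_ge0//=; apply: le_trans (ltW (truncnS_gt _)).
      by rewrite ler_wpM2r.
    move=> /staircase_le /=.
    rewrite (_ : (\sum_(j < N) (j.+1%:R <= h t * m.+1%:R)%R%:R : R) = hm t * m.+1%:R).
      by rewrite ler_norml; move=> /andP[H1 H2];
        rewrite -(ler_pM2r m0) mulNr mulVf ?gt_eqF// mulrBl -[X in _ && X](ler_pM2r m0)
          mulrBl mulVf ?gt_eqF//; lra.
    rewrite /hm mulr_suml; apply: eq_bigr => j _.
    rewrite mulrAC mulVf ?gt_eqF// mul1r indicE; congr (nat_of_bool _)%:R.
    by rewrite /A; apply/idP/idP; rewrite inE/= ler_pdivrMr.
  have int_j (j : nat) : P.-integrable setT (EFin \o (fun t => \1_(A j) t * g t)).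
    apply: (@integrable_mul_bounded _ _ _ _ _ _ 1) => //.
      by apply: measurable_indic; exact: sub.
    by move=> t; rewrite indicE; case: (_ \in _); rewrite ?normr0 ?normr1.
  have [||iS S0] := @Rintegral_sum_ge0 _ _ _ P N (fun j t => m.+1%:R^-1 * (\1_(A j) t * g t)).
  - by move=> j; exact: integrable_scalef.
  - move=> j; rewrite RintegralZl// mulr_ge0 ?invr_ge0// -Rintegral_indic.
    exact: g0.
  have hmE t : \sum_(j < N) m.+1%:R^-1 * (\1_(A j) t * g t) = hm t * g t.
    by rewrite /hm mulr_suml; apply: eq_bigr => j _; rewrite mulrA.
  have iI := integrable_scalef m.+1%:R^-1 ign.
  apply: (@le_trans _ _ (\int[P]_t (\sum_(j < N) m.+1%:R^-1 * (\1_(A j) t * g t)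
      - m.+1%:R^-1 * `|g t|))).
    by rewrite RintegralB// RintegralZl// mulrC -[leLHS]add0r lerD2r.
  apply: le_Rintegral => //; first exact: integrable_subf.
  move=> t _; rewrite hmE lerBlDr -lerBlDl -mulrBl (le_trans (ler_norm _))//.
  by rewrite normrM ler_wpM2r.
have [//|I0] := leP 0 (\int[P]_t (h t * g t)).
have Ige0 : 0 <= I by apply: Rintegral_ge0.
have := truncnS_gt (I / - \int[P]_t (h t * g t)).
rewrite ltr_pdivrMr ?oppr_gt0// => lt.
have := approx (Num.truncn (I / - \int[P]_t (h t * g t))).
rewrite lerNl ler_pdivlMr// mulrC => /(lt_le_trans lt).
by rewrite ltxx.
Qed.

(** Shifting [h] by its bound makes it nonnegative; the shift costs nothing since
    [g] has mean zero. *)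
Lemma cond_ge0_bounded_multiple g h (B : R) : cond_ge0 g -> cond_ge0 (fun t => - g t) ->
  Gmeas h -> (forall t, `|h t| <= B) -> \int[P]_t (h t * g t) = 0.
Proof.
move=> g1 g2 mh hB.
have mhT := Gmeas_measurable mh; have [ig _] := g1; have [igN _] := g2.
have mhB : Gmeas (fun t => h t + B) by apply: measurable_funD.
have hB2 t : 0 <= h t + B <= B + B.
  by have := hB t; rewrite ler_norml => /andP[? ?]; apply/andP; split; lra.
have iB := integrable_scalef B ig.
have ih := integrable_mul_bounded mhT hB ig.
have E t : (h t + B) * g t = h t * g t + B * g t by rewrite mulrDl.
have EN t : (h t + B) * - g t = - 1 * ((h t + B) * g t) by ring.
have gi0 : \int[P]_t g t = 0.
  apply/eqP; rewrite eq_le; apply/andP; split.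
    have [_ /(_ setT)] := g2.
    under eq_Rintegral => t _ do rewrite -mulN1r.
    rewrite RintegralZl// mulN1r oppr_ge0; apply.
    exact: (@measurableT _ TG).
  by have [_ /(_ setT)] := g1; apply; exact: (@measurableT _ TG).
have I : \int[P]_t ((h t + B) * g t) = \int[P]_t (h t * g t).
  by under eq_Rintegral => t _ do rewrite E; rewrite RintegralD// RintegralZl// gi0 mulr0 addr0.
apply/eqP; rewrite eq_le; apply/andP; split; rewrite -I.
- have := cond_ge0_integral g2 mhB hB2.
  under eq_Rintegral => t _ do rewrite EN.
  rewrite RintegralZl//; first by rewrite mulN1r oppr_ge0.
  by under eq_fun => t do rewrite E; exact: integrable_addf.
- exact: cond_ge0_integral g1 mhB hB2.
Qed.

End conditional_nonnegativity.

(** * One Lindeberg step along the heat flow *)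

Section heat_measurability.
Context {R : realType}.

Lemma measurable_phi : measurable_fun [set: R] phi.
Proof.
apply: continuous_measurable_fun => x; apply: differentiable_continuous.
by apply/derivable1_diffP; have [] := is_derive_phi x.
Qed.

Lemma measurable_gauss_pdf1 : measurable_fun [set: R] gauss_pdf1.
Proof.
apply: measurable_funM; last exact: measurable_gauss_pdf.
exact: oppr_measurable.
Qed.

(** The inverse square root, frozen below the level [L] so as to be bounded and
    monotone, hence measurable, on the whole line. *)
Definition isqrt (L r : R) : R := (Num.sqrt (Num.max r L))^-1.

Variables (L : R) (L0 : 0 < L).

Lemma isqrt_gt0 r : 0 < isqrt L r.
Proof. by rewrite invr_gt0 sqrtr_gt0 lt_max L0 orbT. Qed.

Lemma isqrt_le r : isqrt L r <= (Num.sqrt L)^-1.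
Proof.
rewrite lef_pV2 ?posrE ?sqrtr_gt0 ?lt_max ?L0 ?orbT//.
by rewrite ler_sqrt le_max ?lexx ?(ltW L0) orbT.
Qed.

Lemma isqrtE r : L <= r -> isqrt L r = (Num.sqrt r)^-1.
Proof. by move=> Lr; rewrite /isqrt max_l. Qed.

Lemma measurable_isqrt : measurable_fun [set: R] (isqrt L).
Proof.
apply: nonincreasing_measurable => // r q rq.
have p t : 0 < Num.max t L by rewrite lt_max L0 orbT.
rewrite /isqrt lef_pV2 ?posrE ?sqrtr_gt0// ler_sqrt ?(ltW (p _))//.
by rewrite ge_max !le_max rq lexx orbT.
Qed.

End heat_measurability.

(** One step: [s] is the current position, [x] the next increment, [sg] its
    conditional variance, and the remaining variance goes from [v + sg] to [v].
    [A] is the event that the step is taken, and [y] bounds the ratio of the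
    conditional third moment to the conditional variance. *)
Section one_step.
Context d (T : measurableType d) (R : realType) (P : probability T R).
Variable GG : set (set T).
Hypothesis sub : <<s GG>> `<=` (measurable : set (set T)).
Local Notation Gmeas := (@Gmeas d T R GG).
Local Notation cond_ge0 := (cond_ge0 P GG).
Local Notation m := (@gauss_peak R).

Variables (A : set T) (s v sg y x : T -> R) (L N z : R).
Hypotheses (GA : <<s GG>> A) (ms : Gmeas s) (mv : Gmeas v) (msg : Gmeas sg).
Hypotheses (my : Gmeas y) (mx : measurable_fun setT x).
Hypothesis L0 : 0 < L.
Hypothesis vL : forall t, A t -> L <= v t.
Hypothesis sgN : forall t, A t -> 0 <= sg t <= N.
Hypotheses (x1 : cond_ge0 x) (x1N : cond_ge0 (fun t => - x t)).
Hypotheses (x2 : cond_ge0 (fun t => x t ^+ 2 - sg t))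
           (x2N : cond_ge0 (fun t => - (x t ^+ 2 - sg t))).
Hypothesis x3 : cond_ge0 (fun t => \1_A t * (y t * sg t - `|x t| ^+ 3)).
Hypothesis ysg : P.-integrable setT (EFin \o (fun t => \1_A t * (y t * sg t))).

Let i : T -> R := \1_A.
Let w t := isqrt L (v t).
Let y0 t := (z - s t) * w t.

Let mi : Gmeas i. Proof. exact: Gmeas_indic. Qed.
Let mw : Gmeas w. Proof. exact: (measurableT_comp (measurable_isqrt L0) mv). Qed.
Let my0 : Gmeas y0.
Proof. by apply: measurable_funM => //; apply: measurable_funB. Qed.
Let w0 t : 0 < w t. Proof. exact: isqrt_gt0. Qed.
Let wL t : w t <= (Num.sqrt L)^-1. Proof. exact: isqrt_le. Qed.

Definition step_increment t : R :=
  \1_A t * (phi ((z - (s t + x t)) / Num.sqrt (v t))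
         - phi ((z - s t) / Num.sqrt (v t + sg t))).

Definition step_error t : R :=
  \1_A t * (m / 6 * (y t * sg t * (Num.sqrt (v t)) ^- 3)
         + m / 2 * (sg t / v t) ^+ 2).

Let i_cases t : i t = 0 \/ A t /\ i t = 1.
Proof. exact: indic_cases. Qed.

(* the coefficients of [x], of [x ^ 2 - sg] and of [|x| ^ 3] in the expansion *)
Let a t := i t * - (gauss_pdf (y0 t) * w t).
Let b t := i t * (gauss_pdf1 (y0 t) / 2 * w t ^+ 2).
Let c t := i t * (m / 6 * w t ^+ 3).
Let x3g t := i t * (y t * sg t - `|x t| ^+ 3).

Let sL := (Num.sqrt L)^-1.
Let sL0 : 0 <= sL. Proof. by rewrite invr_ge0. Qed.
Let m0 : 0 < m. Proof. exact: gauss_peak_gt0. Qed.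
Let wp n t : 0 <= w t ^+ n. Proof. by rewrite exprn_ge0// ltW. Qed.
Let wpL n t : w t ^+ n <= sL ^+ n.
Proof. by rewrite lerXn2r// ?nnegrE ?(ltW (w0 t))//; exact: wL. Qed.
Let i01 t : 0 <= i t <= 1.
Proof. by have [->|[_ ->]] := i_cases t; rewrite ?lexx ler01. Qed.
Let normi t : `|i t| <= 1.
Proof. by have /andP[i0 i1] := i01 t; rewrite ger0_norm. Qed.

Let ma : Gmeas a.
Proof.
apply: measurable_funM => //; apply: measurableT_comp => //.
by apply: measurable_funM => //; exact: (measurableT_comp measurable_gauss_pdf).
Qed.

Let mb : Gmeas b.
Proof.
apply: measurable_funM => //; apply: measurable_funM; last exact: measurable_funX.
by apply: measurable_funM => //; exact: (measurableT_comp measurable_gauss_pdf1).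
Qed.

Let mc : Gmeas c.
Proof.
by apply: measurable_funM => //; apply: measurable_funM => //; exact: measurable_funX.
Qed.

Let normM2 (p q p' q' : R) : `|p| <= p' -> `|q| <= q' -> `|p * q| <= p' * q'.
Proof. by move=> pp qq; rewrite normrM ler_pM. Qed.

Let a_le t : `|a t| <= 1 * (m * sL).
Proof.
apply: normM2 => //; rewrite normrN; apply: normM2; first exact: gauss_pdf_le.
by rewrite ger0_norm ?(ltW (w0 t))//; exact: wL.
Qed.

Let b_le t : `|b t| <= 1 * (m * 2^-1 * sL ^+ 2).
Proof.
apply: normM2 => //; apply: normM2; last by rewrite ger0_norm ?wp// wpL.
by apply: normM2; [exact: gauss_pdf1_le|rewrite ger0_norm].
Qed.

Let c_le t : `|c t| <= 1 * (m / 6 * sL ^+ 3).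
Proof.
apply: normM2 => //; apply: normM2; last by rewrite ger0_norm ?wp// wpL.
by rewrite ger0_norm// divr_ge0// ltW.
Qed.

Let c_ge0 t : 0 <= c t <= 1 * (m / 6 * sL ^+ 3).
Proof.
apply/andP; split; last exact: le_trans (ler_norm _) (c_le t).
have /andP[i0 _] := i01 t.
by apply: mulr_ge0 => //; apply: mulr_ge0; rewrite ?wp// divr_ge0// ltW.
Qed.

Let step_errorE t : step_error t =
  c t * (i t * (y t * sg t)) + m / 2 * (i t * (sg t * w t ^+ 2)) ^+ 2.
Proof.
rewrite /step_error /c -/(i t); have [->|[At ->]] := i_cases t.
  by rewrite !mul0r expr0n mulr0 addr0.
rewrite /w isqrtE ?vL//.
have v0 : 0 <= v t by rewrite (le_trans (ltW L0))// vL.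
by rewrite !mul1r !exprVn sqr_sqrtr//; ring.
Qed.

Let i_sgw t : `|i t * (sg t * w t ^+ 2)| <= `|N * sL ^+ 2|.
Proof.
have [->|[At ->]] := i_cases t; first by rewrite mul0r normr0.
have /andP[s0 sN] := sgN At; have N0 := le_trans s0 sN.
have p1 : 0 <= sg t * w t ^+ 2 by apply: mulr_ge0 => //; exact: wp.
have p2 : 0 <= N * sL ^+ 2 by apply: mulr_ge0 => //; exact: exprn_ge0.
rewrite mul1r (ger0_norm p1) (ger0_norm p2).
by apply: ler_pM.
Qed.

Let int_err : P.-integrable setT (EFin \o step_error).
Proof.
rewrite (_ : step_error = fun t =>
    c t * (i t * (y t * sg t)) + m / 2 * (i t * (sg t * w t ^+ 2)) ^+ 2).
  apply: integrable_addf.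
    by apply: (integrable_mul_bounded (Gmeas_measurable sub mc) c_le).
  apply: integrable_scalef.
  apply: (@integrable_bounded _ _ _ _ _ (`|N * sL ^+ 2| ^+ 2)).
    apply: (Gmeas_measurable sub); apply: measurable_funX.
    apply: measurable_funM => //; apply: measurable_funM => //.
    exact: measurable_funX.
  by move=> t; rewrite normrX lerXn2r ?nnegrE.
by apply/funext => t; exact: step_errorE.
Qed.

Let mPsi : measurable_fun setT step_increment.
Proof.
rewrite (_ : step_increment = fun t => i t *
  (phi ((z - (s t + x t)) * w t) - phi ((z - s t) * isqrt L (v t + sg t)))).
  have mT f : Gmeas f -> measurable_fun setT f by exact: Gmeas_measurable.
  apply: measurable_funM; first exact: mT.
  apply: measurable_funB; apply: (measurableT_comp measurable_phi).
    apply: measurable_funM; last exact: mT.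
    by apply: measurable_funB => //; apply: measurable_funD => //; exact: mT.
  apply: measurable_funM; first by apply: measurable_funB => //; exact: mT.
  apply: (measurableT_comp (measurable_isqrt L0)).
  by apply: measurable_funD; exact: mT.
apply/funext => t; rewrite /step_increment -/(i t).
have [->|[At ->]] := i_cases t; first by rewrite !mul0r.
have /andP[sg0 _] := sgN At.
by rewrite /w !isqrtE ?vL// (le_trans (vL At))// lerDl.
Qed.

Let rem t := step_increment t - a t * x t - b t * (x t ^+ 2 - sg t).

(* The expansion of [phi] at order 3 in space is compared with its expansion at
   order 2 in time; by the heat equation both have the same second coefficient. *)
Let rem_le t : `|rem t| <= step_error t - c t * x3g t.
Proof.
rewrite step_errorE /rem /step_increment /a /b /c /x3g -/(i t).
have [->|[At ->]] := i_cases t.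
  by rewrite !mul0r expr0n/= mulr0 !subr0 addr0 normr0.
have v0 : 0 < v t by rewrite (lt_le_trans L0)// vL.
have /andP[sg0 _] := sgN At.
have wE : w t = (Num.sqrt (v t))^-1 by rewrite /w isqrtE ?vL.
have w2 : w t ^+ 2 = (v t)^-1 by rewrite wE exprVn sqr_sqrtr// ltW.
have H1 := phi_taylor3 (y0 t) (- (x t * w t)).
have H2 := heat_taylor2 (z - s t) v0 sg0.
have y0E : (z - s t) / Num.sqrt (v t) = y0 t by rewrite /y0 wE.
have kE : (z - (s t + x t)) / Num.sqrt (v t) = y0 t + - (x t * w t).
  by rewrite /y0 wE; ring.
rewrite y0E in H2; rewrite !mul1r kE.
rewrite normrN normrM (ger0_norm (ltW (w0 t))) in H1.
rewrite invfM in H2.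
have -> : phi (y0 t + - (x t * w t)) - phi ((z - s t) / Num.sqrt (v t + sg t))
    - - (gauss_pdf (y0 t) * w t) * x t
    - gauss_pdf1 (y0 t) / 2 * w t ^+ 2 * (x t ^+ 2 - sg t) =
  (phi (y0 t + - (x t * w t)) - phi (y0 t) - gauss_pdf (y0 t) * - (x t * w t)
    - gauss_pdf1 (y0 t) / 2 * (- (x t * w t)) ^+ 2)
  - (phi ((z - s t) / Num.sqrt (v t + sg t)) - phi (y0 t)
    - gauss_pdf1 (y0 t) * (2^-1 * (v t)^-1) * sg t) by rewrite -w2; ring.
apply: (le_trans (ler_normB _ _)); apply: (le_trans (lerD H1 H2)).
by rewrite -w2 le_eqVlt; apply/orP; left; apply/eqP; ring.
Qed.

(** The terms in [x] and [x ^ 2 - sg] integrate to zero, as bounded multiples of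
    variables with zero conditional mean.  In the bound on the remainder,
    [step_error - c * x3g], the last term only helps. *)
Lemma step_le :
  [/\ P.-integrable setT (EFin \o step_increment),
      P.-integrable setT (EFin \o step_error) &
      `|\int[P]_t step_increment t| <= \int[P]_t step_error t].
Proof.
have mT f : Gmeas f -> measurable_fun setT f by exact: Gmeas_measurable.
have ia : P.-integrable setT (EFin \o (fun t => a t * x t)).
  by apply: integrable_mul_bounded a_le _; [exact: mT|have [] := x1].
have ib : P.-integrable setT (EFin \o (fun t => b t * (x t ^+ 2 - sg t))).
  by apply: integrable_mul_bounded b_le _; [exact: mT|have [] := x2].
have ic : P.-integrable setT (EFin \o (fun t => c t * x3g t)).
  by apply: integrable_mul_bounded c_le _; [exact: mT|have [] := x3].
have mrem : measurable_fun setT rem.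
  apply: measurable_funB; first apply: measurable_funB => //.
    by apply: measurable_funM => //; exact: mT.
  apply: measurable_funM; first exact: mT.
  by apply: measurable_funB; [exact: measurable_funX|exact: mT].
have [irem Irem] := Rintegral_abs_le mrem (integrable_subf int_err ic) rem_le.
have E t : step_increment t = rem t + (a t * x t + b t * (x t ^+ 2 - sg t)).
  by rewrite /rem; ring.
have iab := integrable_addf ia ib.
split => //.
  rewrite (_ : step_increment = fun t => rem t + (a t * x t + b t * (x t ^+ 2 - sg t))).
    exact: integrable_addf.
  exact/funext.
under eq_Rintegral => t _ do rewrite E.
rewrite (RintegralD measurableT irem iab) (RintegralD measurableT ia ib).
rewrite (cond_ge0_bounded_multiple sub x1 x1N ma a_le).
rewrite (cond_ge0_bounded_multiple sub x2 x2N mb b_le) !addr0.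
apply: (le_trans Irem); rewrite RintegralB// lerBlDr lerDl.
exact: (cond_ge0_integral sub x3 mc c_ge0).
Qed.

End one_step.

(** * The fraction of a step, and Riemann sums of the errors *)

(** A fraction [th] of the increment [x], with [th] known beforehand, is added to
    [s] while the variance [L] of the smoothing stays the same. *)
Section final_fraction.
Context d (T : measurableType d) (R : realType) (P : probability T R).
Variable GG : set (set T).
Hypothesis sub : <<s GG>> `<=` (measurable : set (set T)).
Local Notation Gmeas := (@Gmeas d T R GG).
Local Notation cond_ge0 := (cond_ge0 P GG).
Local Notation m := (@gauss_peak R).

Variables (A : set T) (s sg th x : T -> R) (L z : R).
Hypotheses (GA : <<s GG>> A) (ms : Gmeas s) (mth : Gmeas th).
Hypotheses (mx : measurable_fun setT x).
Hypothesis L0 : 0 < L.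
Hypothesis th01 : forall t, A t -> 0 <= th t <= 1.
Hypotheses (x1 : cond_ge0 x) (x1N : cond_ge0 (fun t => - x t)).
Hypotheses (x2 : cond_ge0 (fun t => x t ^+ 2 - sg t))
           (x2N : cond_ge0 (fun t => - (x t ^+ 2 - sg t))).
Hypothesis ix2 : P.-integrable setT (EFin \o (fun t => x t ^+ 2)).

Definition fraction_increment t : R :=
  \1_A t * (phi ((z - (s t + th t * x t)) / Num.sqrt L)
         - phi ((z - s t) / Num.sqrt L)).

Definition fraction_error t : R := \1_A t * (m / 2 * (th t ^+ 2 / L)) * sg t.

Let i : T -> R := \1_A.
Let mi : Gmeas i. Proof. exact: Gmeas_indic. Qed.

Let i_cases t : i t = 0 \/ A t /\ i t = 1.
Proof. exact: indic_cases. Qed.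

Let sL := (Num.sqrt L)^-1.
Let a t := i t * - (gauss_pdf ((z - s t) * sL) * (th t * sL)).
Let c t := i t * (m / 2 * (th t ^+ 2 / L)).

Let sL0 : 0 < sL. Proof. by rewrite invr_gt0 sqrtr_gt0. Qed.
Let sL2 : sL ^+ 2 = L^-1.
Proof. by rewrite /sL exprVn sqr_sqrtr// ltW. Qed.
Let m0 : 0 < m. Proof. exact: gauss_peak_gt0. Qed.

Let ma : Gmeas a.
Proof.
apply: measurable_funM => //; apply: measurableT_comp => //.
apply: measurable_funM; last exact: measurable_funM.
apply: (measurableT_comp measurable_gauss_pdf).
by apply: measurable_funM => //; exact: measurable_funB.
Qed.

Let mc : Gmeas c.
Proof.
apply: measurable_funM => //; apply: measurable_funM => //.
by apply: measurable_funM => //; exact: measurable_funX.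
Qed.

Let a_le t : `|a t| <= m * sL.
Proof.
rewrite /a; have [->|[At ->]] := i_cases t.
  by rewrite mul0r normr0 mulr_ge0// ltW.
have /andP[t0 t1] := th01 At.
rewrite mul1r normrN normrM; apply: ler_pM => //; first exact: gauss_pdf_le.
by rewrite normrM !ger0_norm ?(ltW sL0)// ler_piMl// ltW.
Qed.

Let c_ge0 t : 0 <= c t <= m / 2 / L.
Proof.
have mL : 0 <= m / 2 / L by rewrite !divr_ge0// ltW.
rewrite /c; have [->|[At ->]] := i_cases t; first by rewrite mul0r lexx.
have /andP[t0 t1] := th01 At.
have -> : 1 * (m / 2 * (th t ^+ 2 / L)) = th t ^+ 2 * (m / 2 / L) by ring.
by rewrite mulr_ge0 ?sqr_ge0//= ler_piMl// expr_le1.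
Qed.

Let c_le t : `|c t| <= m / 2 / L.
Proof. by have /andP[c0 ?] := c_ge0 t; rewrite ger0_norm. Qed.

Let mPsi : measurable_fun setT fraction_increment.
Proof.
have mT f : Gmeas f -> measurable_fun setT f by exact: Gmeas_measurable.
apply: measurable_funM; first exact: mT.
apply: measurable_funB; apply: (measurableT_comp measurable_phi);
  apply: measurable_funM => //; apply: measurable_funB => //.
  by apply: measurable_funD; [exact: mT|apply: measurable_funM => //; exact: mT].
exact: mT.
Qed.

(** The first order term integrates to zero, and the second order term is bounded
    by [c * x ^ 2], which has the same mean as [c * sg]. *)
Lemma fraction_le :
  [/\ P.-integrable setT (EFin \o fraction_increment),
      P.-integrable setT (EFin \o fraction_error) &
      `|\int[P]_t fraction_increment t| <= \int[P]_t fraction_error t].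
Proof.
have mT f : Gmeas f -> measurable_fun setT f by exact: Gmeas_measurable.
have ia : P.-integrable setT (EFin \o (fun t => a t * x t)).
  by apply: integrable_mul_bounded a_le _; [exact: mT|have [] := x1].
have icx : P.-integrable setT (EFin \o (fun t => c t * x t ^+ 2)).
  by apply: integrable_mul_bounded c_le _ => //; exact: mT.
have icd : P.-integrable setT (EFin \o (fun t => c t * (x t ^+ 2 - sg t))).
  by apply: integrable_mul_bounded c_le _; [exact: mT|have [] := x2].
have errE : fraction_error = fun t => c t * x t ^+ 2 - c t * (x t ^+ 2 - sg t).
  by apply/funext => t; rewrite /fraction_error -/(i t) -/(c t); ring.
have ierr : P.-integrable setT (EFin \o fraction_error).
  by rewrite errE; exact: integrable_subf.
pose rem t := fraction_increment t - a t * x t.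
have mrem : measurable_fun setT rem.
  by apply: measurable_funB => //; apply: measurable_funM => //; exact: mT.
have rem_le t : `|rem t| <= c t * x t ^+ 2.
  rewrite /rem /fraction_increment /a /c -/(i t) -/sL.
  have [->|[At ->]] := i_cases t; first by rewrite !mul0r subr0 normr0.
  have := phi_taylor2 ((z - s t) * sL) (- (th t * x t * sL)).
  rewrite !mul1r.
  have -> : (z - (s t + th t * x t)) * sL =
    (z - s t) * sL + - (th t * x t * sL) by ring.
  have -> : - (gauss_pdf ((z - s t) * sL) * (th t * sL)) * x t =
    gauss_pdf ((z - s t) * sL) * - (th t * x t * sL) by ring.
  by rewrite sqrrN !exprMn sL2 => /le_trans; apply;
    rewrite le_eqVlt; apply/orP; left; apply/eqP; ring.
have [irem Irem] := Rintegral_abs_le mrem icx rem_le.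
have E t : fraction_increment t = rem t + a t * x t by rewrite /rem; ring.
have iinc : P.-integrable setT (EFin \o fraction_increment).
  by rewrite (_ : fraction_increment = fun t => rem t + a t * x t);
    [exact: integrable_addf|exact/funext].
split => //; under eq_Rintegral => t _ do rewrite E.
rewrite (RintegralD measurableT irem ia).
rewrite (cond_ge0_bounded_multiple sub x1 x1N ma a_le) addr0.
rewrite errE (RintegralB measurableT icx icd).
by rewrite (cond_ge0_bounded_multiple sub x2 x2N mc c_le) subr0.
Qed.

End final_fraction.

Section riemann_sums.
Context {R : realType}.
Implicit Types (v : nat -> R) (L Q : R) (N : nat).

(** With [a = v ^ (-1/2)] before a step and [b] after it, the step in [v] is
    [a ^- 2 - b ^- 2].  Replacing the right endpoint [b ^ 3] by the left one costs
    at most [Q] times the increase of the integrand, and the left endpoint sum is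
    below the integral [2 * (b - a)] of [v ^ (-3/2)]. *)
Lemma inv_cube_step (a b Q : R) : 0 < a -> a <= b ->
  a ^- 2 - b ^- 2 <= Q ->
  (a ^- 2 - b ^- 2) * b ^+ 3 <= (Q * b ^+ 3 + 2 * b) - (Q * a ^+ 3 + 2 * a).
Proof.
move=> a0 ab dQ; have b0 : 0 < b by rewrite (lt_le_trans a0).
have ab3 : 0 <= b ^+ 3 - a ^+ 3 by rewrite subr_ge0 lerXn2r ?nnegrE ?(ltW a0) ?(ltW b0).
have h1 : (a ^- 2 - b ^- 2) * (b ^+ 3 - a ^+ 3) <= Q * (b ^+ 3 - a ^+ 3).
  exact: ler_wpM2r.
have h2 : (a ^- 2 - b ^- 2) * a ^+ 3 <= 2 * (b - a).
  have -> : (a ^- 2 - b ^- 2) * a ^+ 3 = (b - a) * ((a / b) ^+ 2 + a / b).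
    by field; rewrite !gt_eqF.
  rewrite mulrC ler_wpM2r ?subr_ge0//.
  have r1 : a / b <= 1 by rewrite ler_pdivrMr// mul1r.
  have r0 : 0 <= a / b by rewrite divr_ge0 ?ltW.
  have : (a / b) ^+ 2 <= 1 by rewrite expr_le1.
  by lra.
by move: h1 h2; lra.
Qed.

Lemma inv_square_step (a b Q : R) : 0 < a -> a <= b ->
  a ^- 2 - b ^- 2 <= Q ->
  (a ^- 2 - b ^- 2) * b ^+ 4 <= (Q * b ^+ 4 + b ^+ 2) - (Q * a ^+ 4 + a ^+ 2).
Proof.
move=> a0 ab dQ; have b0 : 0 < b by rewrite (lt_le_trans a0).
have ab4 : 0 <= b ^+ 4 - a ^+ 4 by rewrite subr_ge0 lerXn2r ?nnegrE ?(ltW a0) ?(ltW b0).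
have h1 : (a ^- 2 - b ^- 2) * (b ^+ 4 - a ^+ 4) <= Q * (b ^+ 4 - a ^+ 4).
  exact: ler_wpM2r.
have h2 : (a ^- 2 - b ^- 2) * a ^+ 4 <= b ^+ 2 - a ^+ 2.
  have -> : (a ^- 2 - b ^- 2) * a ^+ 4 = (a / b) ^+ 2 * (b ^+ 2 - a ^+ 2).
    by field; rewrite !gt_eqF.
  have r1 : a / b <= 1 by rewrite ler_pdivrMr// mul1r.
  have r0 : 0 <= a / b by rewrite divr_ge0 ?ltW.
  rewrite ler_piMl ?subr_ge0; first by [].
    by rewrite lerXn2r ?nnegrE ?(ltW a0) ?(ltW b0).
  by rewrite expr_le1.
by move: h1 h2; lra.
Qed.

Variables (v : nat -> R) (L Q : R) (N : nat).
Hypothesis L0 : 0 < L.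
Hypothesis vL : forall k, (k <= N)%N -> L <= v k.
Hypothesis dv : forall k, (k < N)%N -> 0 <= v k - v k.+1 <= Q.

Let r k := (Num.sqrt (v k))^-1.
Let v0 k : (k <= N)%N -> 0 < v k.
Proof. by move=> kN; rewrite (lt_le_trans L0)// vL. Qed.
Let r0 k : (k <= N)%N -> 0 < r k.
Proof. by move=> kN; rewrite invr_gt0 sqrtr_gt0 v0. Qed.
Let rV2 k : (k <= N)%N -> r k ^- 2 = v k.
Proof. by move=> kN; rewrite /r exprVn invrK sqr_sqrtr// ltW// v0. Qed.
Let r_nd k : (k < N)%N -> r k <= r k.+1.
Proof.
move=> kN; rewrite lef_pV2 ?posrE ?sqrtr_gt0 ?v0 ?(ltnW kN)//.
rewrite ler_sqrt; last by rewrite ltW// v0// ltnW.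
by have /andP[+ _] := dv kN; rewrite subr_ge0.
Qed.
Let rL k n : (k <= N)%N -> r k ^+ n <= (Num.sqrt L) ^- n.
Proof.
move=> kN; rewrite -exprVn lerXn2r ?nnegrE ?(ltW (r0 kN))// ?invr_ge0//.
rewrite lef_pV2 ?posrE ?sqrtr_gt0 ?v0// ler_sqrt ?vL//.
by rewrite ltW// v0.
Qed.

(** A right-endpoint Riemann sum of a monotone function differs from the integral
    by at most the mesh [Q] times the variation, uniformly in the number of steps. *)
Lemma sum_inv_cube : 0 <= Q ->
  \sum_(0 <= k < N) (v k - v k.+1) * (Num.sqrt (v k.+1)) ^- 3
    <= 2 / Num.sqrt L + Q / Num.sqrt L ^+ 3.
Proof.
move=> Q0; pose f k := Q * r k ^+ 3 + 2 * r k.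
apply: (@le_trans _ _ (\sum_(0 <= k < N) (f k.+1 - f k))).
  apply: ler_sum_nat => k /andP[_ kN].
  rewrite -exprVn -[_^-1]/(r k.+1) -(rV2 (ltnW kN)) -(rV2 kN).
  apply: inv_cube_step; [exact: r0 (ltnW kN)|exact: r_nd|].
  by rewrite (rV2 (ltnW kN)) (rV2 kN); have /andP[] := dv kN.
rewrite telescope_sumr// lerBlDr -[leLHS]addr0 lerD//.
  rewrite /f addrC lerD//; last by rewrite ler_wpM2l// rL.
  by rewrite ler_wpM2l//; have := rL 1 (leqnn N); rewrite !expr1.
by rewrite /f addr_ge0// mulr_ge0 ?exprn_ge0// ltW// r0.
Qed.

Lemma sum_inv_square : 0 <= Q ->
  \sum_(0 <= k < N) (v k - v k.+1) * (v k.+1) ^- 2 <= 1 / L + Q / L ^+ 2.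
Proof.
move=> Q0; pose f k := Q * r k ^+ 4 + r k ^+ 2.
have sL2 : Num.sqrt L ^- 2 = L^-1 by rewrite sqr_sqrtr// ltW.
have sL4 : Num.sqrt L ^- 4 = L ^- 2.
  by rewrite (exprM _ 2 2) sqr_sqrtr// ltW.
apply: (@le_trans _ _ (\sum_(0 <= k < N) (f k.+1 - f k))).
  apply: ler_sum_nat => k /andP[_ kN].
  have -> : v k.+1 ^- 2 = r k.+1 ^+ 4.
    by rewrite -(rV2 kN) exprVn invrK -exprM.
  rewrite -(rV2 (ltnW kN)) -(rV2 kN).
  apply: inv_square_step; [exact: r0 (ltnW kN)|exact: r_nd|].
  by rewrite (rV2 (ltnW kN)) (rV2 kN); have /andP[] := dv kN.
rewrite telescope_sumr// lerBlDr -[leLHS]addr0 lerD//.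
  rewrite /f addrC mul1r -sL2 -sL4 lerD//; first exact: rL.
  by rewrite ler_wpM2l// rL.
by rewrite /f addr_ge0 ?mulr_ge0 ?exprn_ge0// ltW// r0.
Qed.

End riemann_sums.

(** * Almost sure comparisons and telescoping sums *)

Section almost_everywhere.
Context d (T : measurableType d) (R : realType) (P : probability T R).
Implicit Types f g : T -> R.

Lemma ae_imp (p q : T -> Prop) : {ae P, forall t, p t} ->
  (forall t, p t -> q t) -> {ae P, forall t, q t}.
Proof. by move=> [N [mN N0 sN]] pq; exists N; split => // t H; apply: sN => /pq. Qed.

Lemma ae_and (p q : T -> Prop) : {ae P, forall t, p t} ->
  {ae P, forall t, q t} -> {ae P, forall t, p t /\ q t}.
Proof. by move=> aep aeq; exact: filterI. Qed.

Lemma integrable_ae_le f g : measurable_fun setT f ->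
  P.-integrable setT (EFin \o g) -> {ae P, forall t, `|f t| <= g t} ->
  P.-integrable setT (EFin \o f).
Proof.
move=> mf ig fg; apply/integrableP; split; first exact/measurable_EFinP.
have ign := integrable_norm ig.
have /integrableP[mg gfin] := ign.
apply: le_lt_trans gfin; apply: ae_ge0_le_integral => //=.
- by apply/measurable_EFinP; exact: measurableT_comp.
- apply/measurable_EFinP; do 2 apply: measurableT_comp => //.
  exact/measurable_EFinP/(measurable_int P ig).
by apply: (ae_imp fg) => t ft _ /=; rewrite lee_fin normr_id (le_trans ft)// ler_norm.
Qed.

Lemma eq_Rintegral_ae f g : measurable_fun setT f -> measurable_fun setT g ->
  {ae P, forall t, f t = g t} -> \int[P]_t f t = \int[P]_t g t.
Proof.
move=> mf mg fg; congr fine; apply: ae_eq_integral => //; try exact/measurable_EFinP.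
by apply: (ae_imp fg) => t E _ /=; rewrite E.
Qed.

Lemma le_Rintegral_ae f g : P.-integrable setT (EFin \o f) ->
  P.-integrable setT (EFin \o g) -> {ae P, forall t, f t <= g t} ->
  \int[P]_t f t <= \int[P]_t g t.
Proof.
move=> if_ ig fg.
have mf : measurable_fun setT f by apply/measurable_EFinP; exact: (measurable_int P if_).
have mg : measurable_fun setT g by apply/measurable_EFinP; exact: (measurable_int P ig).
have mm : measurable_fun setT (fun t => Num.max (f t) (g t)).
  exact: measurable_maxr.
have mE : {ae P, forall t, Num.max (f t) (g t) = g t}.
  by apply: (ae_imp fg) => t; exact: max_r.
rewrite -(eq_Rintegral_ae mm mg mE); apply: le_Rintegral => //.
  apply: (integrable_ae_le mm (integrable_norm ig)).
  by apply: (ae_imp mE) => t ->.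
by move=> t _; rewrite le_max lexx.
Qed.

Lemma Rintegral_abs_le_ae f g : measurable_fun setT f ->
  P.-integrable setT (EFin \o g) -> {ae P, forall t, `|f t| <= g t} ->
  P.-integrable setT (EFin \o f) /\ `|\int[P]_t f t| <= \int[P]_t g t.
Proof.
move=> mf ig fg; have if_ := integrable_ae_le mf ig fg; split => //.
apply: (le_trans (le_normr_Rintegral measurableT if_)).
by apply: le_Rintegral_ae => //; exact: integrable_norm if_.
Qed.

Lemma ae_not_in (A : set T) f : measurable A -> measurable_fun setT f ->
  (forall t, A t -> 0 < f t) -> (\int[P]_(t in A) (f t)%:E <= 0)%E ->
  {ae P, forall t, ~ A t}.
Proof.
move=> mA mf f0 If.
have mfA : measurable_fun A (EFin \o f).
  by apply/measurable_EFinP; exact: measurable_funTS.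
have I0 : (\int[P]_(t in A) `|(EFin \o f) t| = 0)%E.
  under eq_integral => t /set_mem At do rewrite /= ger0_norm ?(ltW (f0 _ At))//.
  apply/eqP; rewrite eq_le If/=; apply: integral_ge0 => t At.
  by rewrite lee_fin ltW// f0.
have /(ae_eq_integral_abs P mA mfA) := I0.
move=> /ae_imp; apply=> t /= ft At; have := f0 _ At.
by have [->] := ft At; rewrite ltxx.
Qed.

(** Dominated convergence for sums of increments [D k] that stop almost surely at
    a finite random time, when each increment has a small mean but no small
    value. *)
Lemma telescoping_limit (D e : nat -> T -> R) (f B : T -> R) (C : R) :
  (forall k, [/\ P.-integrable setT (EFin \o D k),
    P.-integrable setT (EFin \o e k) &
    `|\int[P]_t D k t| <= \int[P]_t e k t]) ->
  measurable_fun setT f -> P.-integrable setT (EFin \o B) ->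
  {ae P, forall t, forall N,
    `|\sum_(0 <= k < N) D k t| <= C /\ \sum_(0 <= k < N) e k t <= B t} ->
  {ae P, forall t, exists N0, forall N, (N0 <= N)%N ->
    \sum_(0 <= k < N) D k t = f t} ->
  `|\int[P]_t f t| <= \int[P]_t B t.
Proof.
move=> De mf iB bnd ev.
have sumI N : [/\ P.-integrable setT (EFin \o (fun t => \sum_(0 <= k < N) D k t)),
    P.-integrable setT (EFin \o (fun t => \sum_(0 <= k < N) e k t)) &
    `|\int[P]_t \sum_(0 <= k < N) D k t| <= \int[P]_t \sum_(0 <= k < N) e k t].
  elim: N => [|N [i1 i2 i3]].
    have Z (F : nat -> T -> R) : (fun t => \sum_(0 <= k < 0) F k t) = fun=> 0.
      by apply/funext => t; rewrite big_geq.
    rewrite !Z Rintegral_prob_cst normr0; split => //; exact: integrable_cst_fun.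
  have S (F : nat -> T -> R) : (fun t => \sum_(0 <= k < N.+1) F k t) =
      fun t => \sum_(0 <= k < N) F k t + F N t.
    by apply/funext => t; rewrite big_nat_recr.
  have [j1 j2 j3] := De N.
  rewrite !S; split; [exact: integrable_addf|exact: integrable_addf|].
  rewrite (RintegralD measurableT i1 j1) (RintegralD measurableT i2 j2).
  by rewrite (le_trans (ler_normD _ _))// lerD.
have le_B N : `|\int[P]_t \sum_(0 <= k < N) D k t| <= \int[P]_t B t.
  have [i1 i2 i3] := sumI N; apply: (le_trans i3).
  by apply: le_Rintegral_ae => //; apply: (ae_imp bnd) => t /(_ N)[].
have [|||||/=] := @dominated_convergence _ _ _ P setT measurableT
  (fun N t => (\sum_(0 <= k < N) D k t)%:E) (EFin \o f) (cst C%:E).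
- by move=> N; have [/measurable_int] := sumI N.
- exact/measurable_EFinP.
- apply: (ae_imp ev) => t [N0 evt] _.
  apply: cvg_near_cst; exists N0 => // N /= N0N.
  by rewrite evt.
- exact: integrable_cst_fun.
- by apply: (ae_imp bnd) => t bt N _; rewrite lee_fin; have [] := bt N.
move=> if_ _ cv.
have iff : (\int[P]_t (f t)%:E = (\int[P]_t f t)%R%:E)%E.
  by rewrite /Rintegral fineK//; exact: integrable_fin_num if_.
rewrite iff in cv; have /= cvR := fine_cvg cv.
have {}cvR := cvR eventually_filter; have cvN := @cvg_norm _ _ _ _ eventually_filter _ _ cvR.
rewrite -(cvg_lim _ cvN)//; apply: limr_le; first by apply/cvg_ex; eexists; exact: cvN.
by near=> N; exact: le_B.
Unshelve. all: by end_near. Qed.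

End almost_everywhere.

(** * Consequences of the definition of conditional expectation *)

Section conditional_expectation_facts.
Context d (T : measurableType d) (R : realType) (P : probability T R).
Variable GG : set (set T).
Hypothesis sub : <<s GG>> `<=` (measurable : set (set T)).
Local Notation Gmeas := (@Gmeas d T R GG).
Local Notation cond_ge0 := (cond_ge0 P GG).

Lemma measurable_wrt_EFin_Gmeas (s : T -> R) :
  measurable_wrt <<s GG>> (EFin \o s) -> Gmeas s.
Proof.
move=> ms; apply/measurable_EFinP => _ B mB; apply: ms; exists B => //.
Qed.

Lemma Gmeas_lt_level (f g : T -> R) : Gmeas f -> Gmeas g ->
  <<s GG>> [set t | f t < g t].
Proof.
move=> mf mg; have := @measurable_fun_ltr _ (g_sigma_algebraType GG) R setT f g mf mg.
by move=> /(_ measurableT [set true] I); rewrite setTI.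
Qed.

Lemma Gmeas_le_level (f g : T -> R) : Gmeas f -> Gmeas g ->
  <<s GG>> [set t | f t <= g t].
Proof.
move=> mf mg; have := @measurable_fun_ler _ (g_sigma_algebraType GG) R setT f g mf mg.
by move=> /(_ measurableT [set true] I); rewrite setTI.
Qed.

Lemma GsetI (A B : set T) : <<s GG>> A -> <<s GG>> B -> <<s GG>> (A `&` B).
Proof. by move=> GA GB; exact: (@measurableI _ (g_sigma_algebraType GG)). Qed.

Lemma GsetT : <<s GG>> setT.
Proof. exact: (@measurableT _ (g_sigma_algebraType GG)). Qed.

Lemma cond_ge0_eq (f g : T -> R) : P.-integrable setT (EFin \o f) ->
  P.-integrable setT (EFin \o g) ->
  (forall A, <<s GG>> A -> (\int[P]_(t in A) (f t)%:E = \int[P]_(t in A) (g t)%:E)%E) ->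
  cond_ge0 (fun t => f t - g t).
Proof.
move=> if_ ig E; split; first exact: integrable_subf.
move=> A GA; have mA := sub GA.
have iA (h : T -> R) : P.-integrable setT (EFin \o h) -> P.-integrable A (EFin \o h).
  by apply: integrableS.
by rewrite RintegralB//; [rewrite /Rintegral E// subrr|exact: iA|exact: iA].
Qed.

Lemma cond_exp0 (x : T -> R) : P.-integrable setT (EFin \o x) ->
  is_cond_exp P <<s GG>> (EFin \o x) (cst 0%E) ->
  cond_ge0 x /\ cond_ge0 (fun t => - x t).
Proof.
move=> ix [_ E]; have i0 := @integrable_cst_fun _ T R P 0.
split.
- rewrite (_ : x = fun t => x t - 0); last by apply/funext => t; rewrite subr0.
  by apply: cond_ge0_eq => // A GA; rewrite -E.
- rewrite (_ : (fun t => - x t) = fun t => 0 - x t).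
    by apply: cond_ge0_eq => // A GA; rewrite -E.
  by apply/funext => t; rewrite sub0r.
Qed.

(** Nonnegativity and integrability of a version [s] are consequences:
    testing on the event [s < 0] shows that it is negligible, and then the integral
    of [|s|] is that of [f]. *)
Lemma cond_exp_nonneg (f s : T -> R) : (forall t, 0 <= f t) ->
  P.-integrable setT (EFin \o f) ->
  is_cond_exp P <<s GG>> (EFin \o f) (EFin \o s) ->
  [/\ Gmeas s, {ae P, forall t, 0 <= s t}, P.-integrable setT (EFin \o s),
      cond_ge0 (fun t => f t - s t) & cond_ge0 (fun t => - (f t - s t))].
Proof.
move=> f0 if_ [ms E]; have Gs := measurable_wrt_EFin_Gmeas ms.
have mT := Gmeas_measurable sub Gs.
have s0 : {ae P, forall t, 0 <= s t}.
  have GA : <<s GG>> [set t | s t < 0].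
    by apply: Gmeas_lt_level => //; exact: measurable_cst.
  have H : {ae P, forall t, ~ [set t | s t < 0] t}.
    apply: (@ae_not_in _ _ _ P _ (fun t => - s t)).
    - exact: sub.
    - exact: measurableT_comp.
    - by move=> t /=; rewrite oppr_gt0.
    - have := E _ GA.
      rewrite (_ : (\int[P]_(t in _) (EFin \o s) t)%E =
          (\int[P]_(t in [set t | (s t < 0)%R]) - (- s t)%:E)%E); last first.
        by apply: eq_integral => t _ /=; rewrite opprK.
      rewrite integral_ge0N; last by move=> t /= /ltW; rewrite lee_fin oppr_ge0.
      move=> EE; rewrite -[X in (X <= _)%E]oppeK EE oppe_le0; apply: integral_ge0 => t _.
      by rewrite lee_fin.
  by apply: (ae_imp H) => t /= /negP; rewrite -leNgt.
have is_ : P.-integrable setT (EFin \o s).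
  apply/integrableP; split; first exact/measurable_EFinP.
  rewrite (@ae_eq_integral _ _ _ P setT (EFin \o s)) //=.
  - by rewrite (E _ GsetT) ltey_eq (integrable_fin_num measurableT if_).
  - exact/measurable_EFinP/measurableT_comp.
  - exact/measurable_EFinP.
  - by apply: (ae_imp s0) => t st _ /=; rewrite ger0_norm.
split => //.
- by apply: cond_ge0_eq => // A GA; rewrite -E.
- rewrite (_ : (fun t => - (f t - s t)) = fun t => s t - f t).
    by apply: cond_ge0_eq => // A GA; rewrite -E.
  by apply/funext => t; rewrite opprB.
Qed.

(** The version [Z] may be infinite, and is only bounded above by [W]; replacing
    it by its positive part is harmless on a set where [W] is nonnegative. *)
Lemma cond_exp_le (f W : T -> R) (Z : T -> \bar R) (A : set T) :
  measurable_fun setT f -> (forall t, 0 <= f t) -> measurable_fun setT W ->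
  is_cond_exp P <<s GG>> (EFin \o f) Z ->
  {ae P, forall t, (Z t <= (W t)%:E)%E} ->
  <<s GG>> A -> (forall t, A t -> 0 <= W t) ->
  P.-integrable setT (EFin \o (fun t => \1_A t * W t)) ->
  cond_ge0 (fun t => \1_A t * (W t - f t)).
Proof.
move=> mf f0 mW [mZ E] ZW GA W0 iW.
have mA := sub GA.
have mZT : measurable_fun setT Z.
  by move=> _ B mB; apply: sub; apply: mZ; exists B.
have le_int B : <<s GG>> B ->
    (\int[P]_(t in B `&` A) (f t)%:E <= \int[P]_(t in B `&` A) (W t)%:E)%E.
  move=> GB; have GBA := GsetI GB GA; have mBA := sub GBA.
  rewrite -[X in (X <= _)%E](E _ GBA) integralE.
  apply: (@le_trans _ _ (\int[P]_(t in B `&` A) (Z^\+ t))%E).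
    rewrite -[leRHS]sube0; apply: leeB => //.
    by apply: integral_ge0 => t _; exact: funeneg_ge0.
  apply: ae_ge0_le_integral => //.
  - by apply: measurable_funTS; exact: measurable_funepos.
  - by move=> t [_ At]; rewrite lee_fin W0.
  - by apply: measurable_funTS; exact/measurable_EFinP.
  - apply: (ae_imp ZW) => t Zt [_ At]; rewrite funeposE ge_max Zt lee_fin.
    exact: W0.
have ind_int (h : T -> R) B :
    (\int[P]_(t in B) (\1_A t * h t)%:E = \int[P]_(t in B `&` A) (h t)%:E)%E.
  rewrite integral_mkcondr; apply: eq_integral => t _.
  by rewrite patchE indicE; case: ifP; rewrite ?mul1r ?mul0r.
have m1f (h : T -> R) : measurable_fun setT h ->
    measurable_fun setT (fun t => \1_A t * h t).
  by move=> mh; apply: measurable_funM => //; exact: measurable_indic.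
have ifA : P.-integrable setT (EFin \o (fun t => \1_A t * f t)).
  apply/integrableP; split; first by apply/measurable_EFinP; exact: m1f.
  under eq_integral => t _ do rewrite gee0_abs ?lee_fin ?mulr_ge0//.
  rewrite (ind_int f) (le_lt_trans (le_int _ GsetT))// -ind_int.
  have /integrableP[_] := iW; apply: le_lt_trans.
  by apply: (le_trans (lee_abs _)); apply: le_abse_integral => //;
    apply/measurable_EFinP; exact: m1f.
split.
  rewrite (_ : (fun t => _) = fun t => \1_A t * W t - \1_A t * f t).
    exact: integrable_subf.
  by apply/funext => t; rewrite mulrBr.
move=> B GB; have mB := sub GB.
have iB (h : T -> R) : P.-integrable setT (EFin \o h) -> P.-integrable B (EFin \o h).
  by apply: integrableS.
under eq_Rintegral => t _ do rewrite mulrBr.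
rewrite RintegralB//; [|exact: iB|exact: iB].
rewrite subr_ge0 /Rintegral fine_le//.
- exact: (integrable_fin_num mB (iB _ ifA)).
- exact: (integrable_fin_num mB (iB _ iW)).
- by rewrite (ind_int f) (ind_int W) le_int.
Qed.

End conditional_expectation_facts.

(** * From third conditional moments to conditional variances *)

Section conditional_moments.
Context d (T : measurableType d) (R : realType) (P : probability T R).
Variable GG : set (set T).
Hypothesis sub : <<s GG>> `<=` (measurable : set (set T)).
Local Notation Gmeas := (@Gmeas d T R GG).
Local Notation cond_ge0 := (cond_ge0 P GG).
Variables (x s y : T -> R).
Hypotheses (ms : Gmeas s) (my : Gmeas y) (y1 : forall t, 1 <= y t).
Hypotheses (x2 : cond_ge0 (fun t => x t ^+ 2 - s t))
           (x2N : cond_ge0 (fun t => - (x t ^+ 2 - s t))).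
Hypothesis s0 : {ae P, forall t, 0 <= s t}.

(** Young's inequality [3 y x^2 <= 2 |x|^3 + y^3] gives, after conditioning,
    [3 y s <= 2 y s + y ^ 3], that is [s <= y ^ 2].  To make the integrals finite it
    is applied on the part [A M] of the event [y ^ 2 < s] where [s] and [y] are at
    most [M]; each of these sets turns out to be negligible. *)
Lemma cond_variance_le :
  (forall A (M : R), <<s GG>> A -> (forall t, A t -> 0 <= s t <= M /\ y t <= M) ->
    cond_ge0 (fun t => \1_A t * (y t * s t - `|x t| ^+ 3))) ->
  {ae P, forall t, s t <= y t ^+ 2}.
Proof.
move=> x3.
pose A (M : nat) := [set t | (0 : R) <= s t] `&` [set t | s t <= M%:R] `&`
  [set t | y t <= M%:R] `&` [set t | y t ^+ 2 < s t].
have GA M : <<s GG>> (A M).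
  apply: GsetI; [apply: GsetI; [apply: GsetI|]|].
  - exact: Gmeas_le_level (measurable_cst _) ms.
  - exact: Gmeas_le_level ms (measurable_cst _).
  - exact: Gmeas_le_level my (measurable_cst _).
  - by apply: Gmeas_lt_level ms; exact: measurable_funX.
have mT f : Gmeas f -> measurable_fun setT f by exact: Gmeas_measurable.
have null M : {ae P, forall t, ~ A M t}.
  pose i : T -> R := \1_(A M).
  have mi : Gmeas i by exact: Gmeas_indic.
  have AB t : A M t -> 0 <= s t <= M%:R /\ y t <= M%:R.
    by move=> [[[s0' sM] yM] _]; split => //; apply/andP.
  have y0 t : 0 <= y t by rewrite (le_trans ler01).
  have c3 := x3 (A M) M%:R (GA M) AB.
  have iy_le t : `|i t * y t| <= M%:R.
    rewrite /i; have [->|[At ->]] := @indic_cases _ T R (A M) t; first by rewrite mul0r normr0.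
    by rewrite mul1r ger0_norm//; have [_] := AB _ At.
  have miy : Gmeas (fun t => i t * y t) by exact: measurable_funM.
  have p0 := cond_ge0_bounded_multiple sub x2 x2N miy iy_le.
  have [ix2 _] := x2; have [iq q0] := c3.
  have ip := integrable_mul_bounded (mT _ miy) iy_le ix2.
  have {}q0 := q0 _ (@GsetT _ _ GG).
  pose r t := i t * (y t * (s t - y t ^+ 2)).
  have r0 t : 0 <= r t <= M%:R * M%:R.
    rewrite /r /i; have [->|[At ->]] := @indic_cases _ T R (A M) t.
      by rewrite mul0r lexx mulr_ge0.
    have [/andP[s1 sM] yM] := AB _ At; have [_ /= ys] := At.
    have d0 : 0 <= s t - y t ^+ 2 by rewrite subr_ge0 ltW.
    rewrite mul1r mulr_ge0//= ler_pM//.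
    by rewrite lerBlDr (le_trans sM)// lerDl sqr_ge0.
  have ir : P.-integrable setT (EFin \o r).
    apply: (@integrable_bounded _ _ _ _ _ (M%:R * M%:R)).
      apply: mT; apply: measurable_funM => //; apply: measurable_funM => //.
      by apply: measurable_funB => //; exact: measurable_funX.
    by move=> t; have /andP[? ?] := r0 t; rewrite ger0_norm.
  (* Young's inequality in the form [0 <= (|x| - y) ^ 2 (2 |x| + y)] *)
  have le_r : \int[P]_t (i t * y t * (x t ^+ 2 - s t)
        + 2 / 3 * (i t * (y t * s t - `|x t| ^+ 3)))
      <= \int[P]_t (- (1 / 3) * r t).
    apply: le_Rintegral => //.
    - by apply: integrable_addf => //; exact: integrable_scalef.
    - exact: integrable_scalef.
    move=> t _; rewrite /r /i; have [->|[At ->]] := @indic_cases _ T R (A M) t.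
      by rewrite !(mul0r, mulr0) addr0.
    rewrite -(real_normK (num_real (x t))).
    move: (normr_ge0 (x t)) (y0 t); move: `|x t| (y t) (s t) => a b c a0 b0.
    have : 0 <= (a - b) ^+ 2 * (2 * a + b).
      by rewrite mulr_ge0 ?sqr_ge0// addr_ge0// mulr_ge0.
    lra.
  have r_le0 : \int[P]_t r t <= 0.
    move: le_r; rewrite (RintegralD measurableT ip (integrable_scalef (2 / 3) iq)).
    rewrite p0 add0r !RintegralZl//.
    by move: q0; rewrite -/i; lra.
  have r_ae := Rintegral_ge0_ae0 ir (fun t => proj1 (andP (r0 t))) r_le0.
  apply: (ae_imp r_ae) => t + At; have [_ /= ys] := At.
  rewrite /r /i indicE mem_set// mul1r => /eqP.
  by rewrite mulf_eq0 !gt_eqF// ?subr_gt0// (lt_le_trans _ (y1 t)).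
have {}null := ae_foralln null.
have : {ae P, forall t, 0 <= s t /\ forall M, ~ A M t} by exact: filterI.
move=> /ae_imp; apply => t [st nA]; rewrite leNgt; apply/negP => ys.
have M1 := ltW (truncnS_gt (s t)); have M2 := ltW (truncnS_gt (y t)).
apply: (nA (maxn (Num.truncn (s t)).+1 (Num.truncn (y t)).+1)).
split => //; split; first split => //=.
  by rewrite (le_trans M1)// ler_nat leq_maxl.
by rewrite /= (le_trans M2)// ler_nat leq_maxr.
Qed.

Lemma cond_variance_eq0 : measurable_fun setT x ->
  {ae P, forall t, s t = 0 -> x t = 0}.
Proof.
move=> mx; pose A := [set t | s t <= 0] `&` [set t | (0 : R) <= s t].
have GA : <<s GG>> A.
  apply: GsetI; first exact: Gmeas_le_level ms (measurable_cst _).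
  exact: Gmeas_le_level (measurable_cst _) ms.
pose i : T -> R := \1_A.
have i1 t : `|i t| <= 1.
  by rewrite /i; have [->|[_ ->]] := @indic_cases _ T R A t; rewrite ?normr0 ?normr1.
have mi : Gmeas i by exact: Gmeas_indic.
have p0 := cond_ge0_bounded_multiple sub x2 x2N mi i1.
have iE : (fun t => i t * (x t ^+ 2 - s t)) = fun t => i t * x t ^+ 2.
  apply/funext => t; rewrite /i; have [->|[[s1 s2] ->]] := @indic_cases _ T R A t.
    by rewrite !mul0r.
  have -> : s t = 0 by apply/eqP; rewrite eq_le s1 s2.
  by rewrite subr0.
have [ix2 _] := x2.
have ip := integrable_mul_bounded (Gmeas_measurable sub mi) i1 ix2.
rewrite iE in p0 ip.
have pos t : 0 <= i t * x t ^+ 2.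
  by rewrite mulr_ge0 ?sqr_ge0// /i; have [->|[_ ->]] := @indic_cases _ T R A t.
have p_le0 : \int[P]_t (i t * x t ^+ 2) <= 0 by rewrite p0.
apply: (ae_imp (Rintegral_ge0_ae0 ip pos p_le0)) => t E st.
have At : A t by split => /=; rewrite st.
move: E; rewrite /i; have [E|[_ ->]] := @indic_cases _ T R A t; last first.
  by rewrite mul1r => /eqP; rewrite sqrf_eq0 => /eqP.
by move: E; rewrite indicE mem_set// => /eqP; rewrite oner_eq0.
Qed.

End conditional_moments.

(** * The martingale differences and their filtration *)

Section martingale_facts.
Context d (T : measurableType d) (R : realType) (P : probability T R).
Variables (X : nat -> {RV P >-> R}) (sigmasq Y : nat -> T -> R).
Hypothesis hX : martingale_difference X.
Hypothesis hX2 : square_integrable X.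
Hypothesis hsigmasq : conditional_variances X sigmasq.
Hypothesis hYadapted : forall i, measurable_wrt (natural_filtration X i) (Y i).
Hypothesis hYmono : {ae P, forall t, forall i, Y i t <= Y i.+1 t}.
Hypothesis hY1 : forall i, (0 < i)%N -> {ae P, forall t, 1 <= Y i t}.
Hypothesis hX3 : forall i, (0 < i)%N ->
  exists2 Z : T -> \bar R,
    is_cond_exp P (natural_filtration X i.-1) (fun t => (`|X i t| ^+ 3)%:E) Z
    & {ae P, forall t, (Z t <= (Y i.-1 t * sigmasq i.-1 t)%:E)%E}.

(** The generators of [natural_filtration X k], kept as a set of sets in order to
    give [T] the corresponding measurable structure. *)
Definition past k : set (set T) :=
  \bigcup_(i in [set i | (i <= k)%N]) preimage_set_system setT (X i) measurable.

Lemma past_measurable k : <<s past k>> `<=` measurable.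
Proof.
apply: smallest_sub; first exact: sigma_algebra_measurable.
move=> A [i _ [B mB <-]]; exact: (measurable_funPT (X i)).
Qed.

Lemma past_mono k l : (k <= l)%N -> <<s past k>> `<=` <<s past l>>.
Proof.
move=> kl; apply: sub_sigma_algebra2 => A [i ik XA]; exists i => //=.
exact: leq_trans kl.
Qed.

Lemma Gmeas_past_mono k l (f : T -> R) : (k <= l)%N ->
  Gmeas (past k) f -> Gmeas (past l) f.
Proof. by move=> kl mf _ B mB; apply: (past_mono kl); exact: mf. Qed.

Lemma Gmeas_past_X k i : (i <= k)%N -> Gmeas (past k) (X i).
Proof.
by move=> ik _ B mB; apply: sub_gen_smallest; exists i => //; exists B.
Qed.

(** The bound [1 <= Y i] is only assumed for positive [i].  The maximum with 1
    changes nothing from index 1 on, almost surely, and keeps monotonicity. *)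
Definition Ymax i t : R := Num.max (Y i t) 1.

Lemma Gmeas_Ymax k : Gmeas (past k) (Ymax k).
Proof.
apply: measurable_maxr; last exact: measurable_cst.
by apply: measurable_wrt_Gmeas; exact: hYadapted.
Qed.

Lemma Ymax_ge1 k t : 1 <= Ymax k t.
Proof. by rewrite le_max lexx orbT. Qed.

Lemma integrable_X2 k : P.-integrable setT (EFin \o (fun t => X k t ^+ 2)).
Proof.
apply/integrableP; split.
  by apply/measurable_EFinP; apply: measurable_funX.
have := hX2 k; rewrite unlock; apply: le_lt_trans.
by under eq_integral => t _ do rewrite /= ger0_norm ?sqr_ge0//.
Qed.

Lemma cond_ge0_X k : cond_ge0 P (past k) (X k.+1) /\
  cond_ge0 P (past k) (fun t => - X k.+1 t).
Proof.
apply: cond_exp0; first exact: past_measurable.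
- by have [] := hX k.+1.
- by have [_] := hX k.
Qed.

Lemma sigmasq_facts k :
  [/\ Gmeas (past k) (sigmasq k), {ae P, forall t, 0 <= sigmasq k t},
      P.-integrable setT (EFin \o sigmasq k),
      cond_ge0 P (past k) (fun t => X k.+1 t ^+ 2 - sigmasq k t) &
      cond_ge0 P (past k) (fun t => - (X k.+1 t ^+ 2 - sigmasq k t))].
Proof.
apply: cond_exp_nonneg; first exact: past_measurable.
- by move=> t; exact: sqr_ge0.
- exact: integrable_X2.
- exact: hsigmasq.
Qed.

Lemma cond_third_moment k (A : set T) : <<s past k>> A ->
  (forall t, A t -> 0 <= sigmasq k t) ->
  P.-integrable setT (EFin \o (fun t => \1_A t * (Ymax k t * sigmasq k t))) ->
  cond_ge0 P (past k)
    (fun t => \1_A t * (Ymax k t * sigmasq k t - `|X k.+1 t| ^+ 3)).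
Proof.
move=> GA s0 iA; have [ms sge0 _ _ _] := sigmasq_facts k.
have [Z cZ ZY] := @hX3 k.+1 isT.
apply: (@cond_exp_le _ _ _ _ _ (@past_measurable k)
  (fun t => `|X k.+1 t| ^+ 3) _ _ _ _ _ _ cZ) => //.
- apply: measurable_funX; exact: measurableT_comp.
- apply: measurable_funM; first exact: (Gmeas_measurable (@past_measurable k) (@Gmeas_Ymax k)).
  exact: (Gmeas_measurable (@past_measurable k) ms).
- have : {ae P, forall t, (Z t <= (Y k t * sigmasq k t)%:E)%E /\ 0 <= sigmasq k t}.
    exact: filterI.
  move=> /ae_imp; apply=> t [/le_trans + st]; apply.
  by rewrite lee_fin ler_wpM2r// le_max lexx.
- by move=> t At; rewrite mulr_ge0 ?s0// (le_trans ler01)// Ymax_ge1.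
Qed.

(** A sample point at which the almost sure properties of all steps hold. *)
Definition regular (t : T) : Prop := forall k,
  [/\ 0 <= sigmasq k t, sigmasq k t <= Ymax k t ^+ 2,
      sigmasq k t = 0 -> X k.+1 t = 0,
      Ymax k t <= Ymax k.+1 t & Ymax k.+1 t = Y k.+1 t].

Lemma ae_regular : {ae P, forall t, regular t}.
Proof.
apply/ae_foralln => k.
have [ms s0 is_ x2 x2N] := sigmasq_facts k.
have sub := @past_measurable k.
have var_le : {ae P, forall t, sigmasq k t <= Ymax k t ^+ 2}.
  apply: (cond_variance_le sub ms (@Gmeas_Ymax k) (@Ymax_ge1 k) x2 x2N s0).
  move=> A M GA AM; apply: cond_third_moment => // [t /AM[/andP[]]//|].
  apply: (@integrable_bounded _ _ _ _ _ (M * M)).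
    apply: measurable_funM; first by apply: measurable_indic; exact: sub.
    apply: measurable_funM; first exact: (Gmeas_measurable sub (@Gmeas_Ymax k)).
    exact: (Gmeas_measurable sub ms).
  move=> t; have y0 := le_trans ler01 (Ymax_ge1 k t).
  rewrite indicE; have [At|At] := boolP (t \in A); last first.
    by rewrite mul0r normr0 -expr2 sqr_ge0.
  have [/andP[s1 sM] yM] := AM _ (set_mem At).
  by rewrite mul1r ger0_norm ?mulr_ge0// ler_pM.
have var0 : {ae P, forall t, sigmasq k t = 0 -> X k.+1 t = 0}.
  by apply: (cond_variance_eq0 sub ms x2 x2N).
have H1 := @hY1 k.+1 isT.
have := ae_and (ae_and s0 var_le) (ae_and var0 (ae_and hYmono H1)).
move=> /ae_imp; apply=> t [[a1 a2] [a3 [a4 a5]]]; split => //.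
  by rewrite /Ymax ge_max !le_max a4 lexx !orbT.
by rewrite /Ymax max_l.
Qed.

End martingale_facts.

(** * The crossing time *)

Section crossing_time.
Context d (T : measurableType d) {R : realType}.
Variables (sigmasq : nat -> T -> R) (n : nat).
Local Notation nu := (nu sigmasq n).

Definition Vpart k t : R := \sum_(0 <= i < k) sigmasq i t.

Lemma VpartS k t : Vpart k.+1 t = Vpart k t + sigmasq k t.
Proof. by rewrite /Vpart big_nat_recr. Qed.

Lemma Vpart0 t : Vpart 0 t = 0.
Proof. by rewrite /Vpart big_geq. Qed.

Lemma Vpart_mono t j k : (forall i, 0 <= sigmasq i t) -> (j <= k)%N ->
  Vpart j t <= Vpart k t.
Proof.
move=> s0; elim: k => [|k IH]; first by rewrite leqn0 => /eqP ->.
rewrite leq_eqVlt => /predU1P[->//|jk]; rewrite VpartS.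
by rewrite (le_trans (IH jk))// lerDl.
Qed.

(** The property that [k] is the value of [nu n], without the default value 0. *)
Definition crosses k t : Prop := [/\ (0 < k)%N, n%:R <= Vpart k.+1 t &
  forall j, (0 < j)%N -> n%:R <= Vpart j.+1 t -> (k <= j)%N].

Lemma nuE k t : crosses k t -> nu t = k.
Proof.
move=> ck; rewrite /nu.
case: xgetP => [l _ [l0 nl ml]|/(_ k)[]//].
have [k0 nk mk] := ck.
by apply/eqP; rewrite eqn_leq ml// mk.
Qed.

Lemma nu_crosses t : (0 < nu t)%N -> crosses (nu t) t.
Proof. by rewrite {1}/nu /nu; case: xgetP => [k -> ck|]. Qed.

(** If no partial sum reached [n], the increasing partial sums would converge. *)
Lemma nu_gt0 t : (forall i, 0 <= sigmasq i t) ->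
  ~ cvgn (series (fun i => sigmasq i t)) -> (0 < nu t)%N.
Proof.
move=> s0 ncv.
have [k [k0 nk]] : exists k, (0 < k)%N /\ n%:R <= Vpart k.+1 t.
  apply: contrapT => H; apply: ncv.
  apply: nondecreasing_is_cvgn.
    by apply/nondecreasing_seqP => i; rewrite /series/= big_nat_recr//= lerDl.
  exists n%:R => _ [i _ <-]; rewrite leNgt; apply/negP => ni.
  apply: H; exists i.+1; split => //; apply: (le_trans (ltW ni)).
  by rewrite /series/=; apply: (@Vpart_mono t i i.+2) => //; rewrite ltnW.
have ex : exists k, (0 < k)%N && (n%:R <= Vpart k.+1 t) by exists k; rewrite k0.
have [m /andP[m0 nm] mm] := ex_minnP ex.
rewrite (@nuE m) //; split => // j j0 nj; apply: mm; rewrite j0 nj.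
by [].
Qed.

Lemma Vpart_lt_nu t j : (0 < j)%N -> (j < nu t)%N -> Vpart j.+1 t < n%:R.
Proof.
move=> j0 jn; rewrite ltNge; apply/negP => nj.
have [_ _ /(_ j j0 nj)] := nu_crosses (leq_ltn_trans (leq0n _) jn).
by rewrite leqNgt jn.
Qed.

Lemma crossesE k : (0 < k)%N -> [set t | crosses k t] =
  [set t | n%:R <= Vpart k.+1 t] `&`
   \bigcap_(j in [set j | (0 < j < k)%N]) [set t | Vpart j.+1 t < n%:R].
Proof.
move=> k0; apply/seteqP; split => t /=.
  move=> [_ nk mk]; split => // j /= /andP[j0 jk].
  rewrite ltNge; apply/negP => /(mk j j0); by rewrite leqNgt jk.
move=> [nk lt]; split => // j j0 nj; rewrite leqNgt; apply/negP => jk.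
by have := lt j; rewrite /= j0 jk => /(_ isT); rewrite ltNge nj.
Qed.

(** Stopping a sum: indicators of [k < v] amount to a smaller upper bound. *)
Lemma sum_indicator_lt (N v : nat) (g : nat -> R) :
  \sum_(0 <= k < N) (k < v)%N%:R * g k = \sum_(0 <= k < minn N v) g k.
Proof.
elim: N => [|N IH]; first by rewrite min0n !big_geq.
rewrite big_nat_recr//= IH; have [Nv|vN] := ltnP N v.
  have -> : minn N.+1 v = N.+1 by apply/minn_idPl.
  rewrite mul1r.
  by rewrite [in RHS]big_nat_recr.
have -> : minn N.+1 v = v by apply/minn_idPr/leqW.
by rewrite mul0r addr0.
Qed.

End crossing_time.

Section crossing_time_measurability.
Context d (T : measurableType d) (R : realType).
Variables (sigmasq : nat -> T -> R) (n : nat).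
Hypothesis msg : forall k, measurable_fun setT (sigmasq k).
Local Notation nu := (nu sigmasq n).

Lemma measurable_Vpart k : measurable_fun setT (Vpart sigmasq k).
Proof. exact: measurable_sum. Qed.

Lemma measurable_crosses k : measurable [set t | crosses sigmasq n k t].
Proof.
have [->|k0] := posnP k.
  by rewrite (_ : [set t | _] = set0)//; apply/seteqP; split => t //= [].
rewrite crossesE//; apply: measurableI.
  rewrite (_ : [set t | _] = Vpart sigmasq k.+1 @^-1` `[n%:R, +oo[).
    rewrite -[X in measurable X]setTI; exact: measurable_Vpart.
  by apply/seteqP; split => t /=; rewrite in_itv/= andbT.
apply: bigcap_measurableType => j _.
rewrite (_ : [set t | _] = Vpart sigmasq j.+1 @^-1` `]-oo, n%:R[).
  rewrite -[X in measurable X]setTI; exact: measurable_Vpart.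
by apply/seteqP; split => t /=; rewrite in_itv.
Qed.

Lemma nu_eqE k : (0 < k)%N ->
  [set t | nu t = k] = [set t | crosses sigmasq n k t].
Proof.
move=> k0; apply/seteqP; split => t /=; last exact: nuE.
by move=> E; rewrite -E; apply: nu_crosses; rewrite E.
Qed.

Lemma measurable_nu_eq k : measurable [set t | nu t = k].
Proof.
have H l : (0 < l)%N -> measurable [set t | nu t = l].
  by move=> l0; rewrite nu_eqE//; exact: measurable_crosses.
have [->|] := posnP k; last exact: H.
rewrite (_ : [set t | _] = ~` \bigcup_l [set t | nu t = l.+1]).
  by apply: measurableC; apply: bigcup_measurable => l _; exact: H.
apply/seteqP; split => t /=.
  by move=> n0 [l _ /=]; rewrite n0.
move=> nn; case E : (nu t) => [//|l]; exfalso; apply: nn; exists l => //=.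
Qed.

Lemma measurable_at_nu (f : nat -> T -> R) :
  (forall k, measurable_fun setT (f k)) ->
  measurable_fun setT (fun t => f (nu t) t).
Proof.
move=> mf _ B mB; rewrite setTI.
rewrite (_ : _ @^-1` B = \bigcup_k ([set t | nu t = k] `&` (f k @^-1` B))).
  apply: bigcup_measurable => k _; apply: measurableI; first exact: measurable_nu_eq.
  by rewrite -[X in measurable X]setTI; exact: mf.
apply/seteqP; split => t /=; first by move=> Bt; exists (nu t).
by move=> [k _ [/= ->]].
Qed.

End crossing_time_measurability.

(** * The replacement up to the crossing time *)

Lemma normX_le {R : realDomainType} (a : R) (j : nat) : (j <= 4)%N ->
  `|a ^+ j| <= 1 + a ^+ 4.
Proof.
move=> j4; have -> : a ^+ 4 = `|a| ^+ 4.
  by rewrite -normrX ger0_norm// exprn_even_ge0.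
rewrite normrX; have := normr_ge0 a; set b := `|a| => b0.
have [b1|/ltW b1] := leP b 1.
  by apply: (@le_trans _ _ 1); [rewrite exprn_ile1|rewrite lerDl exprn_ge0].
by apply: (@le_trans _ _ (b ^+ 4)); [rewrite ler_weXn2l|rewrite lerDr].
Qed.

(** The total error of the replacement as a function of [r = Y_nu / sqrt L].  The
    terms of degrees 1 and 2 come from the integrals that the Riemann sums
    approximate, those of degrees 3 and 4 from the mesh. *)
Definition lindeberg_bound {R : realType} (r : R) : R :=
  gauss_peak / 6 * (2 * r + r ^+ 3) + gauss_peak / 2 * (r ^+ 2 + r ^+ 4).

Section fourth_moment.
Context d (T : measurableType d) (R : realType) (P : probability T R).
Variable y : T -> R.
Hypothesis my : measurable_fun setT y.
Hypothesis iy4 : P.-integrable setT (EFin \o (fun t => y t ^+ 4)).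

Lemma integrable_expr (j : nat) : (j <= 4)%N ->
  P.-integrable setT (EFin \o (fun t => y t ^+ j)).
Proof.
move=> j4; apply: (@integrable_ae_le _ _ _ _ _ (fun t => 1 + y t ^+ 4)).
- exact: measurable_funX.
- by apply: integrable_addf => //; exact: integrable_cst_fun.
by apply: aeW => t; exact: normX_le.
Qed.

Lemma integrable_expr_div (a : R) (j : nat) : (j <= 4)%N ->
  P.-integrable setT (EFin \o (fun t => (y t / a) ^+ j)).
Proof.
move=> j4; rewrite (_ : (fun t => _) = fun t => a ^- j * y t ^+ j).
  by apply: integrable_scalef; exact: integrable_expr.
by apply/funext => t; rewrite expr_div_n mulrC.
Qed.

Lemma integrable_lindeberg_bound (a c : R) : P.-integrable setT
  (EFin \o (fun t => lindeberg_bound (y t / a) + c * (y t / a) ^+ 2)).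
Proof.
have i1 : P.-integrable setT (EFin \o (fun t => y t / a)).
  rewrite (_ : (fun t => _) = fun t => (y t / a) ^+ 1); first exact: integrable_expr_div.
  by apply/funext => t; rewrite expr1.
rewrite /lindeberg_bound; apply: integrable_addf; last first.
  by apply: integrable_scalef; exact: integrable_expr_div.
apply: integrable_addf; apply: integrable_scalef; apply: integrable_addf;
  try exact: integrable_expr_div.
exact: integrable_scalef.
Qed.

End fourth_moment.

(** From here on, the properties of the conditional moments are taken as
    hypotheses of the section. *)
Section stopped_heat_estimate.
Context d (T : measurableType d) (R : realType) (P : probability T R).
Variables (X : nat -> {RV P >-> R}) (sigmasq Y : nat -> T -> R).
Variables (gamma : T -> R) (n : nat).
Local Notation Ymax := (Ymax Y).
Local Notation past := (past X).
Local Notation V := (Vpart sigmasq).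
Local Notation S := (Spart X).
Local Notation nu := (nu sigmasq n).
Local Notation m := (@gauss_peak R).
Hypothesis msg : forall k, Gmeas (past k) (sigmasq k).
Hypothesis mYmax : forall k, Gmeas (past k) (Ymax k).
Hypothesis mY : forall k, measurable_fun setT (Y k).
Hypothesis x1 : forall k, cond_ge0 P (past k) (X k.+1).
Hypothesis x1N : forall k, cond_ge0 P (past k) (fun t => - X k.+1 t).
Hypothesis x2 : forall k, cond_ge0 P (past k) (fun t => X k.+1 t ^+ 2 - sigmasq k t).
Hypothesis x2N : forall k,
  cond_ge0 P (past k) (fun t => - (X k.+1 t ^+ 2 - sigmasq k t)).
Hypothesis ix2 : forall k, P.-integrable setT (EFin \o (fun t => X k t ^+ 2)).
Hypothesis x3 : forall k (A : set T), <<s past k>> A ->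
  (forall t, A t -> 0 <= sigmasq k t) ->
  P.-integrable setT (EFin \o (fun t => \1_A t * (Ymax k t * sigmasq k t))) ->
  cond_ge0 P (past k)
    (fun t => \1_A t * (Ymax k t * sigmasq k t - `|X k.+1 t| ^+ 3)).
Hypothesis ae_reg : {ae P, forall t, regular X sigmasq Y t}.
Hypothesis ae_div : {ae P, forall t, ~ cvgn (series (fun i => sigmasq i t))}.
Hypothesis ae_gamma : {ae P, forall t, 0 <= gamma t /\
  V (nu t) t + gamma t * sigmasq (nu t) t = n%:R}.
Hypothesis iY4 : P.-integrable setT (EFin \o (fun t => Y (nu t) t ^+ 4)).

Let msgT k : measurable_fun setT (sigmasq k).
Proof. exact: (Gmeas_measurable (@past_measurable _ _ _ _ X k) (@msg k)). Qed.

Let y t := Y (nu t) t.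
Let my : measurable_fun setT y. Proof. exact: measurable_at_nu. Qed.

(** What is needed at a sample point to follow the replacement to its end. *)
Record stable (t : T) : Prop := Stable {
  stable_sg : forall k, 0 <= sigmasq k t <= Ymax k t ^+ 2;
  stable_x0 : forall k, sigmasq k t = 0 -> X k.+1 t = 0;
  stable_nu : (0 < nu t)%N;
  stable_Y : forall k, (k <= nu t)%N -> 1 <= Ymax k t <= y t;
  stable_g : 0 <= gamma t;
  stable_n : V (nu t) t + gamma t * sigmasq (nu t) t = n%:R }.

Lemma ae_stable : {ae P, forall t, stable t}.
Proof.
have H := ae_and (ae_and ae_reg ae_div) ae_gamma.
apply: (ae_imp H) => t [[reg dv] [g0 gn]].
have s0 i : 0 <= sigmasq i t by have [] := reg i.
have nu0 := nu_gt0 n s0 dv.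
split => //.
- by move=> k; have [-> ->] := reg k.
- by move=> k; have [] := reg k.
- move=> k kn; rewrite Ymax_ge1/=.
  have Ymono j l : (j <= l)%N -> Ymax j t <= Ymax l t.
    elim: l => [|l IH]; first by rewrite leqn0 => /eqP ->.
    rewrite leq_eqVlt => /predU1P[->//|jl].
    by rewrite (le_trans (IH jl))//; have [] := reg l.
  have -> : y t = Ymax (nu t) t.
    by rewrite /y -(prednK nu0); have [_ _ _ _ ->] := reg (nu t).-1.
  exact: Ymono.
Qed.

Lemma stable_V t k : stable t -> (k <= nu t)%N -> 0 <= V k t <= n%:R.
Proof.
move=> st kn; have s0 i : 0 <= sigmasq i t by have /andP[] := stable_sg st i.
have := Vpart_mono s0 (leq0n k); rewrite Vpart0 => -> /=.
rewrite (le_trans (Vpart_mono s0 kn))// -(stable_n st) lerDl mulr_ge0//.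
exact: stable_g.
Qed.

(** The variance that is missing at the crossing time is less than one step. *)
Lemma stable_rest t : stable t ->
  0 <= n%:R - V (nu t) t <= sigmasq (nu t) t.
Proof.
move=> st; have /andP[_ Vn] := stable_V st (leqnn (nu t)).
rewrite subr_ge0 Vn/= lerBlDr addrC -VpartS.
by have [] := nu_crosses (stable_nu st).
Qed.

(** The event [k < nu n] up to a negligible set ([runningE]), but measurable at
    time [k]; the clauses after the first hold almost surely on it, and make the
    hypotheses of [step_le] hold surely. *)
Definition running k : set T :=
  [set t | forall j, (0 < j <= k)%N -> V j.+1 t < n%:R] `&`
  [set t | V k.+1 t <= n%:R] `&` [set t | 0 <= sigmasq k t] `&`
  [set t | sigmasq k t <= n%:R].

Lemma Gmeas_Vpart k l : (k <= l.+1)%N -> Gmeas (past l) (V k).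
Proof.
elim: k => [_|k IH kl].
  rewrite (_ : V 0 = cst 0); first exact: measurable_cst.
  by apply/funext => t; rewrite Vpart0.
rewrite (_ : V k.+1 = fun t => V k t + sigmasq k t).
  apply: measurable_funD; first exact: (IH (ltnW kl)).
  exact: (Gmeas_past_mono (kl : (k <= l)%N) (@msg k)).
by apply/funext => t; rewrite VpartS.
Qed.

Lemma past_running k : <<s past k>> (running k).
Proof.
apply: GsetI; [apply: GsetI; [apply: GsetI|]|].
- rewrite (_ : [set t | _] = \bigcap_(j in [set j | (0 < j <= k)%N])
    [set t | V j.+1 t < n%:R]).
    apply: (@bigcap_measurableType _ (g_sigma_algebraType (past k))) => j /= /andP[_ jk].
    by apply: Gmeas_lt_level (measurable_cst _); apply: Gmeas_Vpart.
  by apply/seteqP; split => t /= H j; exact: H.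
- by apply: Gmeas_le_level (measurable_cst _); apply: Gmeas_Vpart.
- exact: Gmeas_le_level (measurable_cst _) (@msg k).
- exact: Gmeas_le_level (@msg k) (measurable_cst _).
Qed.

Lemma runningE t k : stable t -> \1_(running k) t = (k < nu t)%N%:R :> R.
Proof.
move=> st; have s0 i : 0 <= sigmasq i t by have /andP[] := stable_sg st i.
rewrite indicE; congr (nat_of_bool _)%:R; apply/idP/idP => [/set_mem|kn].
  move=> [[[H _] _] _]; rewrite ltnNge; apply/negP => nk.
  have [_ + _] := nu_crosses (stable_nu st); rewrite leNgt H//.
  by rewrite (stable_nu st).
have Vk : V k.+1 t <= n%:R by have /andP[] := stable_V st kn.
rewrite inE; split; first split; first split => //=.
- move=> j /andP[j0 jk]; apply: Vpart_lt_nu => //.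
  exact: leq_ltn_trans kn.
- exact: s0.
- by rewrite /= (le_trans _ Vk)// VpartS lerDr -(Vpart0 sigmasq t) Vpart_mono.
Qed.

Lemma Gmeas_Spart k : Gmeas (past k) (S k).
Proof.
suff H j : (j <= k)%N -> Gmeas (past k) (S j) by exact: H.
elim: j => [_|j IH jk].
  rewrite (_ : S 0 = cst 0); first exact: measurable_cst.
  by apply/funext => t; rewrite /Spart big_geq.
rewrite (_ : S j.+1 = fun t => S j t + X j.+1 t).
  apply: measurable_funD; first exact: (IH (ltnW jk)).
  exact: (@Gmeas_past_X _ _ _ _ X _ _ jk).
by apply/funext => t; rewrite /Spart big_nat_recr.
Qed.

Lemma SpartS k t : S k.+1 t = S k t + X k.+1 t.
Proof. by rewrite /Spart big_nat_recr. Qed.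

Lemma measurable_Spart k : measurable_fun setT (S k).
Proof.
exact: (Gmeas_measurable (@past_measurable _ _ _ _ X k) (@Gmeas_Spart k)).
Qed.

Variables (L z : R).
Hypothesis L0 : 0 < L.

(* the remaining variance, smoothing included, after [k] steps *)
Let v k t := n%:R + L - V k t.
Let heat k t := phi ((z - S k t) / Num.sqrt (v k t)).
Let D k := step_increment (running k) (S k) (v k.+1) (sigmasq k) (X k.+1) z.
Let e k := step_error (running k) (v k.+1) (sigmasq k) (Ymax k).

Let int_Ysg k : P.-integrable setT
  (EFin \o (fun t => \1_(running k) t * (Ymax k t * sigmasq k t))).
Proof.
have sub := @past_measurable _ _ _ _ X k.
apply: (@integrable_ae_le _ _ _ _ _ (fun t => n%:R * y t)).
- apply: measurable_funM; first exact: measurable_indic (sub _ (@past_running k)).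
  by apply: measurable_funM => //; exact: (Gmeas_measurable sub (@mYmax k)).
- apply: integrable_scalef; have := integrable_expr my iY4 (isT : 1 <= 4)%N.
  by under eq_fun do rewrite expr1.
apply: (ae_imp ae_stable) => t st; rewrite runningE//.
have /andP[Y1 _] := stable_Y st (leqnn (nu t)).
have y0 : 0 <= y t.
  have /andP[a b] := stable_Y st (leqnn (nu t)).
  by rewrite (le_trans ler01)// (le_trans a).
case: ltnP => kn; last by rewrite mul0r normr0 mulr_ge0.
have /andP[s0 _] := stable_sg st k.
have /andP[Yk1 Yky] := stable_Y st (ltnW kn).
have Yk0 := le_trans ler01 Yk1.
rewrite mul1r ger0_norm ?mulr_ge0// mulrC ler_pM//.
have /andP[_ Vn] := stable_V st kn; apply: le_trans Vn.
have /andP[V0 _] := stable_V st (ltnW kn).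
by rewrite VpartS lerDr.
Qed.

Let step k : [/\ P.-integrable setT (EFin \o D k),
  P.-integrable setT (EFin \o e k) &
  `|\int[P]_t D k t| <= \int[P]_t e k t].
Proof.
have sub := @past_measurable _ _ _ _ X k.
apply: (step_le sub (L := L) (N := n%:R)) => //.
- exact: past_running.
- exact: Gmeas_Spart.
- by apply: measurable_funB; [exact: measurable_cst|exact: Gmeas_Vpart].
- by move=> t [[[_ /= Vn] _] _]; rewrite /v addrAC lerDr subr_ge0.
- by move=> t [[_ /= ->]].
- apply: x3 => //; first exact: past_running.
  by move=> t [[_ /=]].
Qed.

Let vS k t : v k.+1 t + sigmasq k t = v k t.
Proof. by rewrite /v VpartS opprD addrA subrK. Qed.

Let sum_D t N : stable t ->
  \sum_(0 <= k < N) D k t = heat (minn N (nu t)) t - heat 0 t.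
Proof.
move=> st.
rewrite (eq_bigr (fun k => (k < nu t)%N%:R * (heat k.+1 t - heat k t))).
  by rewrite sum_indicator_lt telescope_sumr.
by move=> k _; rewrite /D /step_increment runningE// vS -SpartS.
Qed.

(* The decrements of [v] are the conditional variances, so the errors are dominated
   by Riemann sums with mesh [y t ^ 2]. *)
Let sum_e t N : stable t ->
  \sum_(0 <= k < N) e k t <= lindeberg_bound (y t / Num.sqrt L).
Proof.
move=> st; have sL : 0 < Num.sqrt L by rewrite sqrtr_gt0.
pose g k := m / 6 * (Ymax k t * sigmasq k t * (Num.sqrt (v k.+1 t)) ^- 3)
         + m / 2 * (sigmasq k t / v k.+1 t) ^+ 2.
rewrite (eq_bigr (fun k => (k < nu t)%N%:R * g k)); last first.
  by move=> k _; rewrite /e /step_error runningE.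
rewrite sum_indicator_lt; set M := minn N (nu t).
have Mnu : (M <= nu t)%N by exact: geq_minr.
have kM k : (k < M)%N -> (k < nu t)%N by move=> /leq_trans; exact.
have vL k : (k <= M)%N -> L <= v k t.
  move=> kM'; have /andP[_ Vn] := stable_V st (leq_trans kM' Mnu).
  by rewrite /v addrAC lerDr subr_ge0.
have dvE k : v k t - v k.+1 t = sigmasq k t by rewrite -vS addrC addKr.
have /andP[y1 _] := stable_Y st (leqnn (nu t)).
have y1' : 1 <= y t by have /andP[a b] := stable_Y st (leqnn (nu t)); exact: le_trans b.
have y0 : 0 <= y t by exact: le_trans ler01 y1'.
have dv k : (k < M)%N -> 0 <= v k t - v k.+1 t <= y t ^+ 2.
  move=> km; rewrite dvE; have /andP[-> sY] /= := stable_sg st k.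
  have /andP[Yk1 Yky] := stable_Y st (ltnW (kM k km)).
  by rewrite (le_trans sY)// lerXn2r ?nnegrE// (le_trans ler01).
have m0 : 0 <= m by rewrite ltW// gauss_peak_gt0.
have c1 := sum_inv_cube L0 vL dv (sqr_ge0 (y t)).
have c2 := sum_inv_square L0 vL dv (sqr_ge0 (y t)).
apply: (@le_trans _ _ (\sum_(0 <= k < M)
   (m / 6 * y t * ((v k t - v k.+1 t) * (Num.sqrt (v k.+1 t)) ^- 3)
    + m / 2 * y t ^+ 2 * ((v k t - v k.+1 t) * (v k.+1 t) ^- 2)))).
  apply: ler_sum_nat => k /andP[_ km]; rewrite dvE /g.
  have /andP[s0 sY] := stable_sg st k.
  have /andP[Yk1 Yky] := stable_Y st (ltnW (kM k km)).
  have vk : 0 < v k.+1 t by exact: lt_le_trans (vL _ km).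
  have sy2 : sigmasq k t <= y t ^+ 2.
    by have := dv k km; rewrite dvE => /andP[].
  have r0 : 0 <= (Num.sqrt (v k.+1 t)) ^- 3 by rewrite invr_ge0 exprn_ge0.
  have q0 : 0 <= (v k.+1 t) ^- 2 by rewrite invr_ge0 exprn_ge0// ltW.
  have h1 : Ymax k t * (sigmasq k t * Num.sqrt (v k.+1 t) ^- 3) <=
      y t * (sigmasq k t * Num.sqrt (v k.+1 t) ^- 3).
    by apply: ler_wpM2r => //; exact: mulr_ge0.
  have h2 : sigmasq k t * (sigmasq k t * v k.+1 t ^- 2) <=
      y t ^+ 2 * (sigmasq k t * v k.+1 t ^- 2).
    by apply: ler_wpM2r => //; exact: mulr_ge0.
  have m6 : 0 <= m / 6 by rewrite divr_ge0.
  have m2 : 0 <= m / 2 by rewrite divr_ge0.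
  have := ler_wpM2l m6 h1; have := ler_wpM2l m2 h2; rewrite expr_div_n; lra.
rewrite big_split/= -!mulr_sumr.
apply: (le_trans (lerD (ler_wpM2l _ c1) (ler_wpM2l _ c2))).
- by rewrite mulr_ge0// divr_ge0.
- by rewrite mulr_ge0 ?sqr_ge0// divr_ge0.
rewrite /lindeberg_bound le_eqVlt; apply/orP; left; apply/eqP.
rewrite -[in LHS](sqr_sqrtr (ltW L0)) sqrtr_sqr ger0_norm ?(ltW sL)//.
by field; rewrite gt_eqF.
Qed.

Let r t := y t / Num.sqrt L.
Let m0 : 0 < m. Proof. exact: gauss_peak_gt0. Qed.

Let ir (j : nat) : (j <= 4)%N -> P.-integrable setT (EFin \o (fun t => r t ^+ j)).
Proof. exact: integrable_expr_div. Qed.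

Let i_bound : P.-integrable setT (EFin \o (fun t => lindeberg_bound (r t))).
Proof.
have := integrable_lindeberg_bound my iY4 (Num.sqrt L) 0.
by under eq_fun do rewrite mul0r addr0.
Qed.

Lemma measurable_S_nu : measurable_fun setT (fun t => S (nu t) t).
Proof. by apply: measurable_at_nu => // k; exact: measurable_Spart. Qed.

Lemma measurable_V_nu : measurable_fun setT (fun t => V (nu t) t).
Proof. by apply: measurable_at_nu => // k; exact: measurable_Vpart. Qed.

Let v_nu_le t : stable t -> L <= v (nu t) t.
Proof.
move=> st; have /andP[_ Vn] := stable_V st (leqnn (nu t)).
by rewrite /v addrAC lerDr subr_ge0.
Qed.

(* [heat (nu t) t], in a form that is measurable without exceptional points *)
Let hstop t := phi ((z - S (nu t) t) * isqrt L (v (nu t) t)).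

Let hstopE t : stable t -> hstop t = heat (nu t) t.
Proof. by move=> st; rewrite /hstop isqrtE// v_nu_le. Qed.

Let mhstop : measurable_fun setT hstop.
Proof.
apply: (measurableT_comp measurable_phi); apply: measurable_funM.
  by apply: measurable_funB => //; exact: measurable_S_nu.
apply: (measurableT_comp (measurable_isqrt L0)).
by apply: measurable_funB => //; exact: measurable_V_nu.
Qed.

Let heat0 t : heat 0 t = phi (z / Num.sqrt (n%:R + L)).
Proof. by rewrite /heat /v Vpart0 subr0 /Spart big_geq// subr0. Qed.

Let lindeberg :
  `|\int[P]_t (hstop t - phi (z / Num.sqrt (n%:R + L)))|
    <= \int[P]_t lindeberg_bound (r t).
Proof.
apply: (telescoping_limit (C := 1) step) => //.
- exact: measurable_funB.
- apply: (ae_imp ae_stable) => t st N; split; last exact: sum_e.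
  rewrite sum_D// ler_norml /heat.
  move: (phi_ge0 ((z - S (minn N (nu t)) t) / Num.sqrt (v (minn N (nu t)) t)))
    (phi_le1 ((z - S (minn N (nu t)) t) / Num.sqrt (v (minn N (nu t)) t)))
    (phi_ge0 ((z - S 0 t) / Num.sqrt (v 0 t)))
    (phi_le1 ((z - S 0 t) / Num.sqrt (v 0 t))).
  by move: (phi _) (phi _) => a b; lra.
- apply: (ae_imp ae_stable) => t st; exists (nu t) => N nN.
  by rewrite sum_D// (minn_idPr nN) hstopE// heat0.
Qed.

Definition phi_stopped t := phi ((z - S (nu t) t) / Num.sqrt L).

Lemma measurable_phi_stopped : measurable_fun setT phi_stopped.
Proof.
apply: (measurableT_comp measurable_phi); apply: measurable_funM => //.
by apply: measurable_funB => //; exact: measurable_S_nu.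
Qed.

Let int_phi (f : T -> R) : measurable_fun setT f ->
  P.-integrable setT (EFin \o (fun t => phi (f t))).
Proof.
move=> mf; apply: (@integrable_bounded _ _ _ _ _ 1).
  exact: (measurableT_comp measurable_phi).
by move=> t; rewrite ger0_norm ?phi_ge0// phi_le1.
Qed.

Let sLr t : r t ^+ 2 = y t ^+ 2 / L.
Proof. by rewrite /r expr_div_n sqr_sqrtr// ltW. Qed.

(** The replacement leads to [heat] at the crossing time, where the variance is [L]
    plus the missing variance; the latter is at most [y ^ 2] and is removed by the
    Lipschitz bound in [v]. *)
Lemma stopped_le : `|\int[P]_t (phi_stopped t - phi (z / Num.sqrt (n%:R + L)))|
    <= \int[P]_t (lindeberg_bound (r t) + m / 2 * r t ^+ 2).
Proof.
have mps := measurable_phi_stopped.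
have i1 : P.-integrable setT (EFin \o phi_stopped).
  by apply: int_phi; apply: measurable_funM => //; apply: measurable_funB => //; exact: measurable_S_nu.
have i2 : P.-integrable setT (EFin \o hstop).
  apply: int_phi; apply: measurable_funM.
    by apply: measurable_funB => //; exact: measurable_S_nu.
  apply: (measurableT_comp (measurable_isqrt L0)).
  by apply: measurable_funB => //; exact: measurable_V_nu.
have i3 := @integrable_cst_fun _ T R P (phi (z / Num.sqrt (n%:R + L))).
have im2 : P.-integrable setT (EFin \o (fun t => m / 2 * r t ^+ 2)).
  by apply: integrable_scalef; exact: ir.
have d12 : {ae P, forall t, `|phi_stopped t - hstop t| <= m / 2 * r t ^+ 2}.
  apply: (ae_imp ae_stable) => t st; rewrite hstopE// /phi_stopped /heat.
  have /andP[d0 ds] := stable_rest st.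
  have -> : v (nu t) t = L + (n%:R - V (nu t) t) by rewrite /v; ring.
  rewrite distrC (le_trans (heat_lipschitz _ L0 d0))//.
  have /andP[s0 sY] := stable_sg st (nu t).
  have /andP[Y1 Yy] := stable_Y st (leqnn (nu t)).
  have dy : n%:R - V (nu t) t <= y t ^+ 2.
    apply: (le_trans ds); apply: (le_trans sY).
    by rewrite lerXn2r ?nnegrE ?(le_trans ler01)// (le_trans Y1).
  have -> : m / (2 * L) * (n%:R - V (nu t) t) = m / 2 * ((n%:R - V (nu t) t) / L).
    by field; rewrite gt_eqF.
  by rewrite sLr ler_wpM2l ?divr_ge0 ?(ltW m0)// ler_wpM2r// invr_ge0 ltW.
have [j12 I12] := Rintegral_abs_le_ae (measurable_funB mps mhstop) im2 d12.
have -> : \int[P]_t (phi_stopped t - phi (z / Num.sqrt (n%:R + L))) =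
    \int[P]_t (phi_stopped t - hstop t) +
    \int[P]_t (hstop t - phi (z / Num.sqrt (n%:R + L))).
  rewrite -RintegralD//; last exact: integrable_subf.
  by apply: eq_Rintegral => t _; rewrite addrA subrK.
rewrite (RintegralD measurableT i_bound im2) addrC.
by rewrite (le_trans (ler_normD _ _))// lerD.
Qed.

Hypothesis mgamma : measurable_fun setT gamma.

(* the event that the crossing occurs at [k], measurable at time [k] *)
Let A k : set T := [set t | crosses sigmasq n k t] `&` [set t | V k t <= n%:R].

Let past_A k : <<s past k>> (A k).
Proof.
apply: GsetI; last first.
  by apply: Gmeas_le_level (measurable_cst _); exact: Gmeas_Vpart.
have [->|k0] := posnP k.
  rewrite (_ : [set t | _] = set0); last by apply/seteqP; split => t //= [].
  exact: (@measurable0 _ (g_sigma_algebraType (past 0))).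
rewrite crossesE//; apply: GsetI.
  by apply: Gmeas_le_level; [exact: measurable_cst|exact: Gmeas_Vpart].
apply: (@bigcap_measurableType _ (g_sigma_algebraType (past k))) => j /= /andP[_ jk].
apply: Gmeas_lt_level (measurable_cst _).
by apply: Gmeas_Vpart; exact: ltnW.
Qed.

(* The weight of the last increment, expressed by the past only, whereas [gamma] is
   just a random variable; real powers are measurable and agree with the quotient
   and the square root on [A k]. *)
Let th k t := ((n%:R - V k t) * (sigmasq k t) `^ (-1)) `^ 2^-1.

Let A_bounds k t : A k t -> 0 <= n%:R - V k t <= sigmasq k t.
Proof.
move=> [[_ + _] /= Vn]; rewrite VpartS subr_ge0 Vn /= lerBlDr addrC.
exact.
Qed.

Let th2 k t : A k t -> th k t = Num.sqrt ((n%:R - V k t) / sigmasq k t).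
Proof.
move=> /A_bounds/andP[d0 ds]; have s0 := le_trans d0 ds.
by rewrite /th powR_inv1// powR12_sqrt// divr_ge0.
Qed.

Let Gth k : Gmeas (past k) (th k).
Proof.
apply: (measurableT_comp (measurable_powR _)); apply: measurable_funM.
  by apply: measurable_funB; [exact: measurable_cst|exact: Gmeas_Vpart].
by apply: (measurableT_comp (measurable_powR _)); exact: msg.
Qed.

Let fD k := fraction_increment (A k) (S k) (th k) (X k.+1) L z.
Let fe k := fraction_error (A k) (sigmasq k) (th k) L.

Let fstep k : [/\ P.-integrable setT (EFin \o fD k),
  P.-integrable setT (EFin \o fe k) &
  `|\int[P]_t fD k t| <= \int[P]_t fe k t].
Proof.
apply: (fraction_le (@past_measurable _ _ _ _ X k)) => //.
- exact: Gmeas_Spart.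
- move=> t At; rewrite (th2 At); have /andP[d0 ds] := A_bounds At.
  rewrite sqrtr_ge0 /= -[leRHS]sqrtr1 ler_sqrt//.
  have := le_trans d0 ds; rewrite le_eqVlt => /predU1P[<-|s0].
    by rewrite invr0 mulr0.
  by rewrite ler_pdivrMr// mul1r.
Qed.

Let nu_A t k : stable t -> A k t -> nu t = k.
Proof. by move=> st [ck _]; exact: nuE. Qed.

Let A_nu t : stable t -> A (nu t) t.
Proof.
move=> st; split; first exact: nu_crosses (stable_nu st).
by have /andP[] := stable_V st (leqnn (nu t)).
Qed.

Let indA t k : stable t -> \1_(A k) t = (k == nu t)%:R :> R.
Proof.
move=> st; rewrite indicE; congr (nat_of_bool _)%:R.
apply/idP/eqP => [/set_mem At|->]; first by rewrite (nu_A st At).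
by rewrite inE; exact: A_nu.
Qed.

Lemma measurable_Sprime :
  measurable_fun setT (Sprime X sigmasq (fun=> gamma) n).
Proof.
apply: measurable_funD; first exact: measurable_S_nu.
apply: measurable_funM; last first.
  by apply: (@measurable_at_nu _ _ _ _ _ _ (fun k => X k.+1)).
rewrite (_ : (fun t => Num.sqrt (gamma t)) = fun t => (Num.max (gamma t) 0) `^ 2^-1).
  by apply: (measurableT_comp (measurable_powR _)); exact: measurable_maxr.
apply/funext => t; rewrite powR12_sqrt ?le_max ?lexx ?orbT//.
have [g0|g0] := leP (gamma t) 0; last by [].
by rewrite sqrtr0 ler0_sqrtr.
Qed.

Definition phi_stopped' t := phi ((z - Sprime X sigmasq (fun=> gamma) n t) / Num.sqrt L).

Lemma measurable_phi_stopped' : measurable_fun setT phi_stopped'.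
Proof.
apply: (measurableT_comp measurable_phi); apply: measurable_funM => //.
by apply: measurable_funB => //; exact: measurable_Sprime.
Qed.

(* Where [sigmasq] is positive, [gamma] is determined by its equation; where
   [sigmasq] vanishes, so does the increment. *)
Let thX t : stable t ->
  th (nu t) t * X (nu t).+1 t = Num.sqrt (gamma t) * X (nu t).+1 t.
Proof.
move=> st; have [s0|s0] := eqVneq (sigmasq (nu t) t) 0.
  by rewrite (stable_x0 st s0) !mulr0.
rewrite (th2 (A_nu st)); congr (Num.sqrt _ * _).
by rewrite -(stable_n st) addrAC subrr add0r mulfK.
Qed.

Let sum_eq (N k0 : nat) (g : nat -> R) :
  \sum_(0 <= k < N) (k == k0)%:R * g k = (k0 < N)%N%:R * g k0.
Proof.
elim: N => [|N IH]; first by rewrite big_geq// mul0r.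
rewrite big_nat_recr//= IH; have [->|kN] := eqVneq k0 N.
  by rewrite ?eqxx ltnn ltnSn mul0r add0r.
have -> : (k0 < N.+1)%N = (k0 < N)%N by rewrite ltnS leq_eqVlt (negbTE kN).
by rewrite mul0r addr0.
Qed.

Let sum_fD t N : stable t ->
  \sum_(0 <= k < N) fD k t = (nu t < N)%N%:R * (phi_stopped' t - phi_stopped t).
Proof.
move=> st.
rewrite (eq_bigr (fun k => (k == nu t)%:R *
   (phi ((z - (S k t + th k t * X k.+1 t)) / Num.sqrt L)
         - phi ((z - S k t) / Num.sqrt L)))); last first.
  by move=> k _; rewrite /fD /fraction_increment indA.
by rewrite sum_eq thX.
Qed.

Let sum_fe t N : stable t ->
  \sum_(0 <= k < N) fe k t <= m / 2 * r t ^+ 2.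
Proof.
move=> st.
rewrite (eq_bigr (fun k => (k == nu t)%:R *
   (m / 2 * (th k t ^+ 2 / L) * sigmasq k t))); last first.
  by move=> k _; rewrite /fe /fraction_error indA// -[LHS]mulrA.
rewrite sum_eq (th2 (A_nu st)).
have /andP[d0 ds] := A_bounds (A_nu st).
have /andP[s0 sY] := stable_sg st (nu t).
have /andP[Y1 Yy] := stable_Y st (leqnn (nu t)).
have dy : sigmasq (nu t) t <= y t ^+ 2.
  apply: (le_trans sY).
  by rewrite lerXn2r ?nnegrE ?(le_trans ler01)// (le_trans Y1).
have m2 : 0 <= m / 2 by rewrite divr_ge0// ltW.
have r0 : 0 <= m / 2 * r t ^+ 2 by rewrite mulr_ge0// sqr_ge0.
case: ltnP => _; last by rewrite mul0r.
rewrite mul1r sqr_sqrtr ?divr_ge0//.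
have h : (n%:R - V (nu t) t) / sigmasq (nu t) t * sigmasq (nu t) t <= y t ^+ 2.
  have [->|s00] := eqVneq (sigmasq (nu t) t) 0; first by rewrite mulr0 sqr_ge0.
  by rewrite divfK// (le_trans ds).
have -> : m / 2 * ((n%:R - V (nu t) t) / sigmasq (nu t) t / L) * sigmasq (nu t) t
  = m / 2 * ((n%:R - V (nu t) t) / sigmasq (nu t) t * sigmasq (nu t) t / L) by ring.
by rewrite sLr; apply: ler_wpM2l => //; apply: ler_wpM2r => //; rewrite invr_ge0 ltW.
Qed.

Let fraction :
  `|\int[P]_t (phi_stopped' t - phi_stopped t)| <= \int[P]_t (m / 2 * r t ^+ 2).
Proof.
apply: (telescoping_limit (C := 1) fstep) => //.
- by apply: measurable_funB; [exact: measurable_phi_stopped'|exact: measurable_phi_stopped].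
- by apply: integrable_scalef; exact: ir.
- apply: (ae_imp ae_stable) => t st N; split; last exact: sum_fe.
  rewrite sum_fD// /phi_stopped' /phi_stopped.
  move: (phi_ge0 ((z - Sprime X sigmasq (fun=> gamma) n t) / Num.sqrt L))
    (phi_le1 ((z - Sprime X sigmasq (fun=> gamma) n t) / Num.sqrt L))
    (phi_ge0 ((z - S (nu t) t) / Num.sqrt L))
    (phi_le1 ((z - S (nu t) t) / Num.sqrt L)).
  move: (phi _) (phi _) => a b; case: ltnP => _; rewrite ?mul0r ?normr0// mul1r ler_norml.
  by lra.
- apply: (ae_imp ae_stable) => t st; exists (nu t).+1 => N nN.
  by rewrite sum_fD// nN mul1r.
Qed.

Lemma stopped'_le : `|\int[P]_t (phi_stopped' t - phi (z / Num.sqrt (n%:R + L)))|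
    <= \int[P]_t (lindeberg_bound (r t) + m * r t ^+ 2).
Proof.
have i1 : P.-integrable setT (EFin \o phi_stopped).
  by apply: int_phi; apply: measurable_funM => //; apply: measurable_funB => //; exact: measurable_S_nu.
have i2 : P.-integrable setT (EFin \o phi_stopped').
  by apply: int_phi; apply: measurable_funM => //; apply: measurable_funB => //; exact: measurable_Sprime.
have i3 := @integrable_cst_fun _ T R P (phi (z / Num.sqrt (n%:R + L))).
have im2 : P.-integrable setT (EFin \o (fun t => m / 2 * r t ^+ 2)).
  by apply: integrable_scalef; exact: ir.
have -> : \int[P]_t (phi_stopped' t - phi (z / Num.sqrt (n%:R + L))) =
    \int[P]_t (phi_stopped' t - phi_stopped t) +
    \int[P]_t (phi_stopped t - phi (z / Num.sqrt (n%:R + L))).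
  rewrite -RintegralD//; [|exact: integrable_subf|exact: integrable_subf].
  by apply: eq_Rintegral => t _; rewrite addrA subrK.
have -> : \int[P]_t (lindeberg_bound (r t) + m * r t ^+ 2) =
    \int[P]_t (m / 2 * r t ^+ 2) +
    \int[P]_t (lindeberg_bound (r t) + m / 2 * r t ^+ 2).
  rewrite -RintegralD//; last exact: integrable_addf.
  by apply: eq_Rintegral => t _; field.
by rewrite (le_trans (ler_normD _ _))// lerD// stopped_le.
Qed.

End stopped_heat_estimate.

(** * Constants *)

Section assembly.
Context d (T : measurableType d) (R : realType) (P : probability T R).
Local Notation m := (@gauss_peak R).

(** Twice [m / 2 * k ^ 2]: the variance missing at the crossing time, and the
    fraction of the last increment. *)
Definition total_bound (k : R) : R := lindeberg_bound k + m * k ^+ 2.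

(** The square of the left-hand side is [pi / 2], which is less than 2. *)
Lemma gauss_peak_pi : m * pi <= 3 / 2.
Proof.
have p0 := pi_gt0 R.
have p4 : (pi : R) < 4 by have := pihalf_lt2 R; lra.
have m0 := @gauss_peak_gt0 R.
have m2 : m ^+ 2 * (2 * pi) = 1.
  by rewrite /gauss_peak exprVn sqr_sqrtr ?mulVf ?gt_eqF ?mulr_gt0// mulr_ge0// ltW.
rewrite -(@ler_pXn2r _ 2)// ?nnegrE ?mulr_ge0 ?(ltW m0) ?(ltW p0)//.
rewrite exprMn.
have -> : m ^+ 2 * pi ^+ 2 = (m ^+ 2 * (2 * pi)) * (pi / 2) by field.
by rewrite m2; lra.
Qed.

(** Here [k] stands for [n ^ (-1/4)], [r] for [b n ^ (-1/4)], [p] for [pi] and [c]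
    for [gauss_peak]; [r <= p / 11] is the only case in which the final bound is
    less than 1. *)
Lemma error_constant_le (k r p c : R) : 0 <= k -> k <= r -> 0 < c -> 0 < p -> p <= 4 ->
  c * p <= 3 / 2 -> r <= p / 11 ->
  2 * (c / 6 * (2 * k + k ^+ 3) + c / 2 * (k ^+ 2 + k ^+ 4) + c * k ^+ 2
       + c / 2 * r ^+ 2 + 5 / 2 * c * r) <= 11 / p * r.
Proof.
move=> k0 kr c0 p0 p4 cp rp.
have r0 : 0 <= r := le_trans k0 kr.
have r1 : r <= 4 / 11 by lra.
have kX j : k ^+ j <= r ^+ j by rewrite lerXn2r// ?nnegrE.
have k2 := kX 2; have k3 := kX 3; have k4 := kX 4.
have r2 : r ^+ 2 <= 4 / 11 * r by rewrite expr2 ler_wpM2r.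
have r3 : r ^+ 3 <= 4 / 11 * (4 / 11 * r).
  by rewrite exprS (le_trans (ler_wpM2l r0 r2))// mulrCA ler_wpM2l// ler_wpM2r.
have r4 : r ^+ 4 <= 4 / 11 * (4 / 11 * (4 / 11 * r)).
  rewrite exprS (le_trans (ler_wpM2l r0 r3))//.
  by rewrite mulrCA ler_wpM2l// mulrCA ler_wpM2l// ler_wpM2r.
have h : 2 * ((2 * k + k ^+ 3) / 6 + (k ^+ 2 + k ^+ 4) / 2 + k ^+ 2 + r ^+ 2 / 2
    + 5 / 2 * r) <= 22 / 3 * r by lra.
apply: (@le_trans _ _ (c * (22 / 3 * r))).
  by have := ler_wpM2l (ltW c0) h; lra.
have cle : c <= 3 / 2 / p by rewrite ler_pdivlMr.
have -> : 11 / p * r = 3 / 2 / p * (22 / 3 * r) by field; rewrite gt_eqF.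
by rewrite ler_wpM2r// mulr_ge0.
Qed.

(** The scaling [z * q ^ 2] turns the heat flow at variance [q ^ 2 b ^ 2] into the
    Gaussian smoothing of [S / q ^ 2] at scale [b / q].  The starting point of the
    flow has variance [n + L] instead of [n], which costs a term in
    [(b / q) ^ 2]. *)
Lemma berry_esseen_of_heat (S : T -> R) (q b : R) : measurable_fun setT S ->
  0 < q -> 1 <= b ->
  (forall z, `|\int[P]_t (phi ((z - S t) / Num.sqrt (q ^+ 2 * b ^+ 2))
      - phi (z / Num.sqrt (q ^+ 4 + q ^+ 2 * b ^+ 2)))| <= total_bound q^-1) ->
  forall x, `|fine (P [set t | S t <= x * Num.sqrt (q ^+ 4)]) - phi x|
    <= 11 / pi * (b / q).
Proof.
move=> mS q0 b1 H x.
have b0 : 0 < b by rewrite (lt_le_trans _ b1).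
have q4 : Num.sqrt (q ^+ 4) = q ^+ 2.
  by rewrite (exprM _ 2 2) sqrtr_sqr ger0_norm// sqr_ge0.
have sL : Num.sqrt (q ^+ 2 * b ^+ 2) = q * b.
  by rewrite -exprMn sqrtr_sqr ger0_norm// mulr_ge0// ltW.
pose S1 t := S t / q ^+ 2.
have mS1 : measurable_fun setT S1 by apply: measurable_funM.
have q20 : 0 < q ^+ 2 by rewrite exprn_gt0.
have -> : [set t | S t <= x * Num.sqrt (q ^+ 4)] = [set t | S1 t <= x].
  by apply/seteqP; split => t; rewrite /= q4 /S1 ler_pdivrMr.
rewrite -/(cdf_at P S1 x).
have p0 := pi_gt0 R.
have [big|small] := leP (pi / 11) (b / q).
  have c0 := cdf_at_ge0 P mS1 x; have c1 := cdf_at_le1 P mS1 x.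
  have f0 := phi_ge0 x; have f1 := phi_le1 x.
  apply: (@le_trans _ _ 1).
    by move: c0 c1 f0 f1; move: (cdf_at _ _ _) (phi _) => u v; rewrite ler_norml; lra.
  by rewrite mulrC -ler_pdivrMr ?divr_gt0// invf_div mul1r.
have e0 : 0 < b / q by rewrite divr_gt0.
have K z : `|smoothed_cdf P S1 (b / q) z - phi z|
    <= total_bound q^-1 + m / 2 * (b / q) ^+ 2.
  have Hz := H (z * q ^+ 2); rewrite sL in Hz.
  have i1 : P.-integrable setT (EFin \o (fun t => phi ((z - S1 t) / (b / q)))).
    apply: (@integrable_bounded _ _ _ _ _ 1).
      apply: (measurableT_comp measurable_phi); apply: measurable_funM => //.
      by apply: measurable_funB.
    by move=> t; rewrite ger0_norm ?phi_ge0// phi_le1.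
  have E : \int[P]_t (phi ((z * q ^+ 2 - S t) / (q * b))
      - phi (z * q ^+ 2 / Num.sqrt (q ^+ 4 + q ^+ 2 * b ^+ 2))) =
     smoothed_cdf P S1 (b / q) z
      - phi (z * q ^+ 2 / Num.sqrt (q ^+ 4 + q ^+ 2 * b ^+ 2)).
    set c := phi (z * _ / _); have i3 := @integrable_cst_fun _ T R P c.
    rewrite /smoothed_cdf -[in RHS](Rintegral_prob_cst P c).
    rewrite -(RintegralB measurableT i1 i3).
    apply: eq_Rintegral => t _; congr (phi _ - _).
    by rewrite /S1; field; rewrite !gt_eqF.
  rewrite E in Hz.
  have q40 : 0 < q ^+ 4 by rewrite exprn_gt0.
  have L0 : 0 <= q ^+ 2 * b ^+ 2 by rewrite mulr_ge0 ?sqr_ge0.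
  have := heat_lipschitz (z * q ^+ 2) q40 L0.
  rewrite q4 mulfK ?gt_eqF//.
  have -> : m / (2 * q ^+ 4) * (q ^+ 2 * b ^+ 2) = m / 2 * (b / q) ^+ 2.
    by field; rewrite gt_eqF.
  move=> Hh; rewrite -(subrKA (phi (z * q ^+ 2 / Num.sqrt (q ^+ 4 + q ^+ 2 * b ^+ 2)))).
  by rewrite (le_trans (ler_normD _ _))// lerD.
apply: (le_trans (smoothing mS1 e0 K x)).
rewrite /total_bound /lindeberg_bound.
apply: (@error_constant_le q^-1 (b / q) pi m) => //.
- by rewrite invr_ge0 ltW.
- by rewrite ler_pdivlMr// mulVf// gt_eqF.
- exact: gauss_peak_gt0.
- by have := pihalf_lt2 R; lra.
- exact: gauss_peak_pi.
- exact: ltW.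
Qed.

(** Each power of [w] is bounded by Young's inequality between 1 and [w ^ 4], the
    weights being such that the right-hand side at [w ^ 4 = 1] is the value of the
    left-hand side at [w = 1]. *)
Lemma lindeberg_bound_young (k w : R) : 0 <= k ->
  lindeberg_bound (k * w) + m * (k * w) ^+ 2 <=
  (m / 6 * (2 * k * (3 / 4) + k ^+ 3 / 4) + m / 2 * (k ^+ 2 / 2) + m * k ^+ 2 / 2)
  + (m / 6 * (2 * k / 4 + k ^+ 3 * (3 / 4)) + m / 2 * (k ^+ 2 / 2 + k ^+ 4)
     + m * k ^+ 2 / 2) * w ^+ 4.
Proof.
move=> k0; have m0 := ltW (@gauss_peak_gt0 R); rewrite /lindeberg_bound.
move: m m0 => c c0.
have w1 : w <= 3 / 4 + w ^+ 4 / 4.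
  have := sqr_ge0 (w ^+ 2 - 1); have := sqr_ge0 (w - 1); nra.
have w2 : w ^+ 2 <= 1 / 2 + w ^+ 4 / 2 by have := sqr_ge0 (w ^+ 2 - 1); lra.
have w3 : w ^+ 3 <= 1 / 4 + w ^+ 4 * (3 / 4).
  have -> : w ^+ 4 = w ^+ 2 * w ^+ 2 by ring.
  have := sqr_ge0 (w ^+ 2 - w); have := sqr_ge0 (w - 1);
  have := sqr_ge0 (w ^+ 2 - 1); lra.
have c1 : 0 <= c * k by rewrite mulr_ge0.
have c2 : 0 <= c * k ^+ 2 by rewrite mulr_ge0// exprn_ge0.
have c3 : 0 <= c * k ^+ 3 by rewrite mulr_ge0// exprn_ge0.
have := ler_wpM2l c1 w1; have := ler_wpM2l c2 w2; have := ler_wpM2l c3 w3.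
rewrite !exprMn; lra.
Qed.

End assembly.

Section moment_bound.
Context d (T : measurableType d) (R : realType) (P : probability T R).
Local Notation m := (@gauss_peak R).

(** [y / b] has fourth moment 1, so [lindeberg_bound_young] is exact in mean. *)
Lemma integral_total_bound_le (y : T -> R) (q b : R) : measurable_fun setT y ->
  P.-integrable setT (EFin \o (fun t => y t ^+ 4)) ->
  0 < q -> 0 < b -> \int[P]_t y t ^+ 4 = b ^+ 4 ->
  \int[P]_t (lindeberg_bound (y t / (q * b)) + m * (y t / (q * b)) ^+ 2)
    <= total_bound q^-1.
Proof.
move=> my iy q0 b0 yb; have ib := integrable_lindeberg_bound my iy (q * b) m.
 set k := q^-1.
have k0 : 0 <= k by rewrite invr_ge0 ltW.
set c0 := (m / 6 * (2 * k * (3 / 4) + k ^+ 3 / 4) + m / 2 * (k ^+ 2 / 2)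
  + m * k ^+ 2 / 2).
set c1 := (m / 6 * (2 * k / 4 + k ^+ 3 * (3 / 4)) + m / 2 * (k ^+ 2 / 2 + k ^+ 4)
     + m * k ^+ 2 / 2).
have i0 := @integrable_cst_fun _ T R P c0.
have i1 : P.-integrable setT (EFin \o (fun t => c1 / b ^+ 4 * y t ^+ 4)).
  exact: integrable_scalef.
apply: (@le_trans _ _ (\int[P]_t (c0 + c1 / b ^+ 4 * y t ^+ 4))).
  apply: le_Rintegral => //; first exact: integrable_addf.
  move=> t _; have := lindeberg_bound_young (y t / b) k0.
  have -> : k * (y t / b) = y t / (q * b) by rewrite /k; field; rewrite !gt_eqF.
  move=> /le_trans; apply; rewrite -/c0 -/c1 expr_div_n.
  by rewrite le_eqVlt; apply/orP; left; apply/eqP; field; rewrite gt_eqF.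
rewrite (RintegralD measurableT i0 i1) Rintegral_prob_cst RintegralZl// yb.
rewrite divfK ?gt_eqF ?exprn_gt0// /total_bound /lindeberg_bound /c0 /c1.
by rewrite le_eqVlt; apply/orP; left; apply/eqP; field.
Qed.

End moment_bound.

Theorem theorem1 (d : measure_display) (T : measurableType d) (R : realType)
    (P : probability T R) (X : nat -> {RV P >-> R})
    (sigmasq Y : nat -> T -> R) (gamma : nat -> {RV P >-> R})
    (hX : martingale_difference X)
    (hX2 : square_integrable X)
    (hsigmasq : conditional_variances X sigmasq)
    (hdiv : {ae P, forall t, ~ cvgn (series (fun i => sigmasq i t))})
    (hYadapted : forall i, measurable_wrt (natural_filtration X i) (Y i))
    (hYmono : {ae P, forall t, forall i, Y i t <= Y i.+1 t})
    (hY4 : forall i, (0 < i)%N -> ('E_P[fun t => (Y i t ^+ 4)%R] < +oo)%E)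
    (hY1 : forall i, (0 < i)%N -> {ae P, forall t, 1 <= Y i t})
    (hX3 : forall i, (0 < i)%N ->
      exists2 Z : T -> \bar R,
        is_cond_exp P (natural_filtration X i.-1)
          (fun t => (`|X i t| ^+ 3)%:E) Z
        & {ae P, forall t, (Z t <= (Y i.-1 t * sigmasq i.-1 t)%:E)%E})
    (hgamma : \forall n \near \oo,
      {ae P, forall t, 0 <= gamma n t /\
        \sum_(0 <= i < nu sigmasq n t) sigmasq i t
          + gamma n t * sigmasq (nu sigmasq n t) t = n%:R}) :
  \forall n \near \oo,
    (sup_dist (Fdist X sigmasq n) phi
       <= a_ P Y sigmasq n `^ (1 / 2)
          * ((pi * n%:R `^ (1 / 4))^-1
             * (11 + 3 / (4 * n%:R `^ (1 / 4)) + 2 / (9 * n%:R `^ (1 / 2))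
                + 1 / (8 * n%:R `^ (3 / 4))))%:E)%E
    /\
    (sup_dist (Hdist X sigmasq gamma n) phi
       <= a_ P Y sigmasq n `^ (1 / 2)
          * ((pi * n%:R `^ (1 / 4))^-1
             * (11 + 9 / (4 * n%:R `^ (1 / 4)) + 2 / (9 * n%:R `^ (1 / 2))
                + 1 / (8 * n%:R `^ (3 / 4))))%:E)%E.
Proof.
near=> n.
have n0 : (0 < n)%N by near: n; exact: nbhs_infty_gt.
have hg : {ae P, forall t, 0 <= gamma n t /\
    Vpart sigmasq (nu sigmasq n t) t
      + gamma n t * sigmasq (nu sigmasq n t) t = n%:R}.
  by near: n.
have reg := ae_regular hX2 hsigmasq hYadapted hYmono hY1 hX3.
have sg k : [/\ Gmeas (past X k) (sigmasq k),
      cond_ge0 P (past X k) (fun t => X k.+1 t ^+ 2 - sigmasq k t) &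
      cond_ge0 P (past X k) (fun t => - (X k.+1 t ^+ 2 - sigmasq k t))].
  by have [] := sigmasq_facts hX2 hsigmasq k.
have msg k : Gmeas (past X k) (sigmasq k) by have [] := sg k.
have x2 k : cond_ge0 P (past X k) (fun t => X k.+1 t ^+ 2 - sigmasq k t).
  by have [] := sg k.
have x2N k : cond_ge0 P (past X k) (fun t => - (X k.+1 t ^+ 2 - sigmasq k t)).
  by have [] := sg k.
have x1 k : cond_ge0 P (past X k) (X k.+1) by have [] := cond_ge0_X hX k.
have x1N k : cond_ge0 P (past X k) (fun t => - X k.+1 t).
  by have [] := cond_ge0_X hX k.
have mYm k : Gmeas (past X k) (Ymax Y k) by exact: Gmeas_Ymax.
have subT k := @past_measurable _ _ _ _ X k.
have mY k : measurable_fun setT (Y k).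
  by apply: (Gmeas_measurable (subT k)); apply: measurable_wrt_Gmeas; exact: hYadapted.
have ix2 k := integrable_X2 hX2 k.
have x3 k (A : set T) (GA : <<s past X k>> A) :=
  cond_third_moment hX2 hsigmasq hYadapted hX3 GA.
have msgT k : measurable_fun setT (sigmasq k).
  by apply: (Gmeas_measurable (subT k)); exact: msg.
pose y t := Y (nu sigmasq n t) t.
have my : measurable_fun setT y by exact: measurable_at_nu.
have q0 : 0 < (n%:R : R) `^ (1 / 4) by rewrite powR_gt0// ltr0n.
set q := n%:R `^ (1 / 4) in q0 *.
have pos c : 0 <= c -> 11 <= 11 + c / (4 * q) + 2 / (9 * n%:R `^ (1 / 2))
    + 1 / (8 * n%:R `^ (3 / 4)) :> R.
  move=> c0; have t1 : 0 <= c / (4 * q) by rewrite divr_ge0// mulr_ge0// ltW.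
  have t2 : 0 <= 2 / (9 * n%:R `^ (1 / 2)) :> R.
    by rewrite divr_ge0// mulr_ge0// powR_ge0.
  have t3 : 0 <= 1 / (8 * n%:R `^ (3 / 4)) :> R.
    by rewrite divr_ge0// mulr_ge0// powR_ge0.
  by rewrite -addrA -addrA lerDl; apply: addr_ge0 => //; exact: addr_ge0.
have pq0 : 0 < (pi * q)^-1 by rewrite invr_gt0 mulr_gt0// pi_gt0.
pose E4 := (\int[P]_t (y t ^+ 4)%:E)%E.
have aE : a_ P Y sigmasq n = (E4 `^ (1 / 2))%E by rewrite /a_ unlock.
have E40 : (0 <= E4)%E.
  by apply: integral_ge0 => t _; rewrite lee_fin exprn_even_ge0.
(* an infinite fourth moment makes both bounds infinite *)
have [E4y|E4fin] := eqVneq E4 +oo%E.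
  have inf c : 0 <= c -> (a_ P Y sigmasq n `^ (1 / 2) *
     ((pi * q)^-1 * (11 + c / (4 * q) + 2 / (9 * n%:R `^ (1 / 2))
    + 1 / (8 * n%:R `^ (3 / 4))))%:E = +oo)%E.
    move=> c0; rewrite aE E4y !poweRyr// gt0_mulye// lte_fin mulr_gt0//.
    exact: lt_le_trans (pos c c0).
  by rewrite !inf// !leey.
(* from here on [b = e4 ^ (1/4)] is a real number at least 1 *)
have iy4 : P.-integrable setT (EFin \o (fun t => y t ^+ 4)).
  apply/integrableP; split; first by apply/measurable_EFinP; exact: measurable_funX.
  under eq_integral => t _ do rewrite /= ger0_norm ?exprn_even_ge0//.
  by rewrite -/E4 ltey.
have st := ae_stable reg hdiv hg.
pose e4 := \int[P]_t (y t ^+ 4).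
have E4E : E4 = e4%:E by rewrite /e4 /Rintegral fineK// ge0_fin_numE// ltey.
have e41 : 1 <= e4.
  rewrite -(Rintegral_prob_cst P 1); apply: le_Rintegral_ae => //.
    exact: integrable_cst_fun.
  apply: (ae_imp st) => t s; have /andP[h1 h2] := stable_Y s (leqnn _).
  by rewrite exprn_ege1// (le_trans h1).
have e40 : 0 <= e4 by rewrite (le_trans ler01).
have root4 (r : R) : 0 <= r -> (r `^ (1 / 4)) ^+ 4 = r.
  by move=> r0; rewrite -powR_mulrn ?powR_ge0// -powRrM mul1r mulVf// powRr1.
pose b := e4 `^ (1 / 4).
have b4 : b ^+ 4 = e4 by exact: root4.
have b0 : 0 < b by rewrite powR_gt0// (lt_le_trans ltr01).
have b1 : 1 <= b.
  by rewrite -(@ler_pXn2r _ 4)// ?nnegrE ?ler01 ?(ltW b0)// expr1n b4.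
have q4 : q ^+ 4 = n%:R by apply: root4.
have abE : (a_ P Y sigmasq n `^ (1 / 2) = b%:E)%E.
  rewrite aE E4E !poweR_EFin -powRrM /b; congr (_ `^ _)%:E.
  by field.
have L0 : 0 < q ^+ 2 * b ^+ 2 by rewrite mulr_gt0// exprn_gt0.
have sL : Num.sqrt (q ^+ 2 * b ^+ 2) = q * b.
  by rewrite -exprMn sqrtr_sqr ger0_norm// mulr_ge0// ltW.
have tot := integral_total_bound_le my iy4 q0 b0 (esym b4).
have final (F : R -> R) c : 0 <= c ->
    (forall x, `|F x - phi x| <= 11 / pi * (b / q)) ->
    (sup_dist F phi <= a_ P Y sigmasq n `^ (1 / 2) *
     ((pi * q)^-1 * (11 + c / (4 * q) + 2 / (9 * n%:R `^ (1 / 2))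
    + 1 / (8 * n%:R `^ (3 / 4))))%:E)%E.
  move=> c0 HF; rewrite abE -EFinM; apply: ge_ereal_sup => _ [x _ <-].
  rewrite lee_fin (le_trans (HF x))//.
  have -> : 11 / pi * (b / q) = b * ((pi * q)^-1 * 11).
    by have := pi_gt0 R; move: pi => p p0; field; rewrite !gt_eqF.
  by rewrite ler_wpM2l ?(ltW b0)// ler_wpM2l ?(ltW pq0)// pos.
have mS : measurable_fun setT (fun t => Spart X (nu sigmasq n t) t).
  exact: measurable_S_nu.
split; apply: final => // x; rewrite /Fdist /Hdist -q4.
- apply: (berry_esseen_of_heat mS q0 b1) => z; rewrite q4.
  have := stopped_le msg mYm mY x1 x1N x2 x2N x3 reg hdiv hg iy4 z L0.
  rewrite /phi_stopped => /le_trans; apply; rewrite sL; apply: le_trans tot.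
  apply: le_Rintegral => //.
  + exact: integrable_lindeberg_bound.
  + exact: integrable_lindeberg_bound.
  + move=> t _; rewrite lerD2l ler_wpM2r ?sqr_ge0// ler_pdivrMr// ler_peMr//.
      by rewrite ltW// gauss_peak_gt0.
    by rewrite ler1n.
- apply: (berry_esseen_of_heat _ q0 b1) => [|z].
    exact: measurable_Sprime.
  rewrite q4.
  have := stopped'_le msg mYm mY x1 x1N x2 x2N ix2 x3 reg hdiv hg iy4 z L0.
  rewrite /phi_stopped' => /(_ (measurable_funPT (gamma n)))/le_trans; apply.
  by rewrite sL; exact: tot.
Unshelve. all: by end_near. Qed.
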